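(* Let $\psi\colon\mathbb{D}\to\mathbb{C}$ be an analytic function that is not identically zero, let $\varphi\colon\mathbb{D}\to\mathbb{D}$ be analytic, let $\alpha,\beta\in(0,\infty)$, and let $X\neq\{0\}$ be a complex Banach space. Let $W_{\psi,\varphi}$ and $\widetilde{W}_{\psi,\varphi}$ denote the weighted composition operators $f\mapsto\psi\cdot(f\circ\varphi)$ acting on scalar-valued and on $X$-valued analytic functions, respectively. Then: (1) $W_{\psi,\varphi}$ is weakly compact $\mathcal{B}_\alpha\to\mathcal{B}_\beta$ if and only if it is compact $\mathcal{B}_\alpha\to\mathcal{B}_\beta$. (2) $\widetilde{W}_{\psi,\varphi}$ is bounded $\mathcal{B}_\alpha(X)\to\mathcal{B}_\beta(X)$ if and only if $W_{\psi,\varphi}$ is bounded $\mathcal{B}_\alpha\to\mathcal{B}_\beta$. (3) $\widetilde{W}_{\psi,\varphi}$ is weakly compact $\mathcal{B}_\alpha(X)\to\mathcal{B}_\beta(X)$ if and only if $W_{\psi,\varphi}$ is compact (equivalently, by (1), weakly compact) $\mathcal{B}_\alpha\to\mathcal{B}_\beta$ and $X$ is reflexive.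
   Context: $\mathbb{D}$ is the open unit disc in $\mathbb{C}$; $H(\mathbb{D},X)$ is the space of analytic functions $\mathbb{D}\to X$ for a complex Banach space $X$. For $\psi\in H(\mathbb{D},\mathbb{C})$ and an analytic $\varphi\colon\mathbb{D}\to\mathbb{D}$, the weighted composition operator is $f\mapsto\psi\cdot(f\circ\varphi)$, i.e. $z\mapsto\psi(z)f(\varphi(z))$; it is written $W_{\psi,\varphi}$ on $H(\mathbb{D},\mathbb{C})$ and $\widetilde{W}_{\psi,\varphi}$ on $H(\mathbb{D},X)$. For $\alpha\in(0,\infty)$, the vector-valued Bloch-type space $\mathcal{B}_\alpha(X)$ is the Banach space of all $f\in H(\mathbb{D},X)$ with $$\|f\|_{\mathcal{B}_\alpha(X)}=\|f(0)\|_X+\sup_{z\in\mathbb{D}}\|f'(z)\|_X(1-|z|^2)^\alpha<\infty,$$ and $\mathcal{B}_\alpha=\mathcal{B}_\alpha(\mathbb{C})$. Saying that an operator is bounded (compact, weakly compact) from one space to another means that it maps the first space into the second and is a bounded (compact, weakly compact) linear operator between them. A bounded linear operator $T\colon U\to V$ between Banach spaces is (weakly) compact if for every bounded sequence $(u_n)$ in $U$ the sequence $(Tu_n)$ has a (weakly) convergent subsequence in $V$. *)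

(* Defs.v *)
From HB Require Import structures.
From mathcomp Require Import all_boot all_order all_algebra.
From mathcomp Require Import complex.
From mathcomp Require Import all_classical all_reals all_analysis.

Set Implicit Arguments.
Unset Strict Implicit.
Unset Printing Implicit Defensive.

Import Order.TTheory GRing.Theory Num.Theory numFieldNormedType.Exports.

Local Open Scope classical_set_scope.
Local Open Scope ring_scope.
Local Open Scope complex_scope.

(* The library equips [R[i]^o] with its normed-space structure; this makes it
   available on [R[i]] itself. *)
HB.instance Definition _ (R : rcfType) := NormedModule.copy R[i] R[i]^o.

(* In a [normedModType R[i]] the library norm takes its (real) values in
   [R[i]]; [nrm] is the same norm with values in [R]. *)
Definition nrm (R : realType) (V : normedModType R[i]) (x : V) : R :=
  complex.Re `|x|.

Section NrmTheory.
Variables (R : realType) (V : normedModType R[i]).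
Implicit Types x y : V.

Lemma nrmE x : `|x| = (nrm x)%:C.
Proof.
have := normr_ge0 x; rewrite /nrm; case: `|x| => a b.
by rewrite lecE /= => /andP[/eqP -> _].
Qed.

Lemma nrm_ge0 x : 0 <= nrm x.
Proof. by have := normr_ge0 x; rewrite nrmE lecR. Qed.

Lemma ler_nrmD x y : nrm (x + y) <= nrm x + nrm y.
Proof. by have := ler_normD x y; rewrite !nrmE -rmorphD lecR. Qed.

Lemma nrmN x : nrm (- x) = nrm x.
Proof. by rewrite /nrm normrN. Qed.

Lemma nrm0 : nrm (0 : V) = 0.
Proof. by rewrite /nrm normr0. Qed.

Lemma nrm_eq0 x : nrm x = 0 -> x = 0.
Proof. by move=> x0; apply/normr0_eq0; rewrite nrmE x0. Qed.

Lemma nrmZ (a : R[i]) x : nrm (a *: x) = nrm a * nrm x.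
Proof. by have := normrZ a x; rewrite !nrmE -rmorphM => /complexI. Qed.

End NrmTheory.

Lemma nrm_real (R : realType) (r : R) : nrm (r%:C : R[i]) = `|r|.
Proof. by rewrite /nrm normc_def /= expr0n addr0 sqrtr_sqr. Qed.

Section SupNorm.
Variables (R : realType) (T : Type) (A : set T).
Implicit Types g h k : T -> R.

Lemma sup_image_ge0 g : (forall t, 0 <= g t) -> 0 <= sup (g @` A).
Proof.
move=> g0; have [[[x [t At gtx]] ub]|/sup_out ->//] := pselect (has_sup (g @` A)).
by apply: le_trans (g0 t) _; apply: ub_le_sup => //; exists t.
Qed.

Lemma le_sup_image g t : has_ubound (g @` A) -> A t -> g t <= sup (g @` A).
Proof. by move=> ub At; apply: ub_le_sup => //; exists t. Qed.

Lemma sup_image_le g c : A !=set0 -> (forall t, A t -> g t <= c) ->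
  sup (g @` A) <= c.
Proof.
move=> [t At] gc; apply: ge_sup; first by exists (g t), t.
by move=> _ [s As <-]; exact: gc.
Qed.

Lemma sup_imageD g h k : A !=set0 ->
    has_ubound (g @` A) -> has_ubound (h @` A) ->
    (forall t, A t -> k t <= g t + h t) ->
  sup (k @` A) <= sup (g @` A) + sup (h @` A).
Proof.
move=> A0 ubg ubh kgh; apply: sup_image_le => // t At.
by apply: le_trans (kgh _ At) _; apply: lerD; exact: le_sup_image.
Qed.

Lemma sup_imageZ g h (c : R) : A !=set0 -> 0 <= c -> has_ubound (g @` A) ->
  (forall t, A t -> 0 <= g t) ->
  (forall t, A t -> h t = c * g t) -> sup (h @` A) = c * sup (g @` A).
Proof.
move=> A0 c0 ubg g0 hcg.
have hle t : A t -> h t <= c * sup (g @` A).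
  by move=> At; rewrite hcg// ler_wpM2l// le_sup_image.
apply/le_anti/andP; split; first exact: sup_image_le.
have [->|cn0] := eqVneq c 0.
  case: A0 => t At; rewrite mul0r.
  have ht0 : 0 <= h t by rewrite hcg// mulr_ge0// g0.
  apply: le_trans ht0 _; apply: le_sup_image => //.
  by exists (c * sup (g @` A)) => _ [s As <-]; exact: hle.
have cp : 0 < c by rewrite lt_def cn0.
rewrite -ler_pdivlMl//; apply: sup_image_le => // t At.
rewrite ler_pdivlMl// -hcg//; apply: le_sup_image => //.
by exists (c * sup (g @` A)) => _ [s As <-]; exact: hle.
Qed.

End SupNorm.

Section Operators.
Variable R : realType.

Definition bounded_op (U V : normedModType R[i]) (T : U -> V) :=
  exists M : R, forall x, nrm (T x) <= M * nrm x.

Definition bounded_seq (V : normedModType R[i]) (u : nat -> V) :=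
  exists M : R, forall n, nrm (u n) <= M.

End Operators.

Section Dual.
Variables (R : realType) (V : normedModType R[i]).

Definition dual_pred : {pred V -> R[i]} :=
  [pred L | `[< linear L /\ bounded_op L >]].

Record dual : Type := Dual { dual_fun :> V -> R[i] ; _ : dual_fun \in dual_pred }.

HB.instance Definition _ := [isSub for dual_fun].
HB.instance Definition _ := [Choice of dual by <:].

Lemma dual_predP (L : V -> R[i]) :
  reflect (linear L /\ bounded_op L) (L \in dual_pred).
Proof. exact: asboolP. Qed.

Lemma dual_submod : submod_closed dual_pred.
Proof.
split=> [|a L K /dual_predP[linL [M bL]] /dual_predP[linK [N bK]]].
  apply/dual_predP; split=> [b x y|].
    by rewrite -[LHS]/(0 : R[i]) -[RHS]/(b *: (0 : R[i]) + 0) scaler0 addr0.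
  by exists 0 => x; rewrite mul0r -[_ x]/(0 : R[i]) nrm0.
apply/dual_predP; split=> [b x y|].
  by rewrite !fctE linL linK !scalerDr addrACA !scalerA (mulrC a).
exists (nrm a * M + N) => x; rewrite !fctE; apply: le_trans (ler_nrmD _ _) _.
by rewrite nrmZ mulrDl lerD// -mulrA ler_wpM2l ?nrm_ge0.
Qed.

HB.instance Definition _ := GRing.isSubmodClosed.Build _ _ dual_pred dual_submod.
HB.instance Definition _ := [SubChoice_isSubLmodule of dual by <:].

Definition dual_norm (L : dual) : R := sup [set nrm (L x) | x in [set x | nrm x <= 1]].

Let ball1 : [set x : V | nrm x <= 1] !=set0.
Proof. by exists 0; rewrite /= nrm0. Qed.

Let dual_ub (L : dual) :
  has_ubound [set nrm (L x) | x in [set x | nrm x <= 1]].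
Proof.
have /dual_predP[_ [M bL]] := valP L.
exists `|M| => _ [x x1 <-]; apply: le_trans (bL x) _.
apply: (@le_trans _ _ (`|M| * nrm x)); first by rewrite ler_wpM2r ?nrm_ge0 ?ler_norm.
by rewrite ler_piMr.
Qed.

Let dual_normD L K :
  (dual_norm (L + K))%:C <= (dual_norm L)%:C + (dual_norm K)%:C.
Proof.
rewrite -rmorphD lecR; apply: sup_imageD => // x _; exact: ler_nrmD.
Qed.

Let dual_normZ a L : (dual_norm (a *: L))%:C = `|a| * (dual_norm L)%:C.
Proof.
rewrite (nrmE (a : R[i])) -rmorphM; congr (_%:C); apply: sup_imageZ => //.
- exact: nrm_ge0.
- by move=> x _; exact: nrm_ge0.
- by move=> x _; exact: (nrmZ a (L x : R[i])).
Qed.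

Let dual_norm_eq0 L : (dual_norm L)%:C = 0 -> L = 0.
Proof.
move=> /complexI L0; apply: val_inj; apply/funext => x /=.
have /dual_predP[+ _] := valP L; rewrite /= => linL.
have [->|x0] := eqVneq x 0.
  by have := linL (-1) 0 0; rewrite scaler0 addr0 scaleN1r addNr.
have nx0 : nrm x != 0 by apply: contra x0 => /eqP/nrm_eq0 ->.
have LZ a : L (a *: x) = a *: L x.
  have L00 : L 0 = 0 by have := linL (-1) 0 0; rewrite scaler0 addr0 scaleN1r addNr.
  by have := linL a x 0; rewrite L00 !addr0.
have nV : nrm ((nrm x)^-1%:C : R[i]) = (nrm x)^-1.
  by rewrite nrm_real ger0_norm// invr_ge0 nrm_ge0.
have : nrm (L ((nrm x)^-1%:C *: x)) <= 0.
  rewrite -L0; apply: (@le_sup_image _ _ _ (fun x => nrm (L x))) => //=.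
  by rewrite nrmZ nV mulVf.
rewrite LZ nrmZ nV pmulr_rle0; last by rewrite invr_gt0 lt_def nx0 nrm_ge0.
by move=> Lx; apply: nrm_eq0; apply/le_anti; rewrite Lx nrm_ge0.
Qed.

HB.instance Definition _ := @Lmodule_isNormed.Build R[i] dual
  (fun L => (dual_norm L)%:C) dual_normD dual_normZ dual_norm_eq0.

End Dual.

Section Compactness.
Variable R : realType.

(* The canonical embedding of [V] into its bidual is onto. *)
Definition reflexive_space (V : normedModType R[i]) :=
  forall Phi : dual (dual V), exists x : V, forall L : dual V, Phi L = L x.

Definition weakly_cvg_to (V : normedModType R[i]) (u : nat -> V) (l : V) :=
  forall L : dual V, L (u n) @[n --> \oo] --> (L l : R[i]).

Definition compact_op (U V : normedModType R[i]) (T : U -> V) :=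
  forall u : nat -> U, bounded_seq u ->
    exists s : nat -> nat, {homo s : m n / (m < n)%N} /\
      exists l : V, T (u (s n)) @[n --> \oo] --> l.

Definition weakly_compact_op (U V : normedModType R[i]) (T : U -> V) :=
  forall u : nat -> U, bounded_seq u ->
    exists s : nat -> nat, {homo s : m n / (m < n)%N} /\
      exists l : V, weakly_cvg_to (fun n => T (u (s n))) l.

End Compactness.

Definition disc (R : realType) : set R[i] := [set z | `|z| < 1].
Arguments disc : clear implicits.

(* The scalar field is [R[i]], so [derivable f z 1] is complex
   differentiability at [z], and [derive1 f z] below is the complex derivative. *)
Definition analytic_on_disc (R : realType) (X : normedModType R[i])
    (f : R[i] -> X) :=
  forall z, disc R z -> derivable f z 1.

Section Bloch.
Variables (R : realType) (alpha : R) (X : normedModType R[i]).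

Definition bloch_weight (f : R[i] -> X) (z : R[i]) : R :=
  nrm (derive1 f z) * (1 - nrm z ^+ 2) `^ alpha.

(* A function on the disc is represented by its extension by 0 to the whole
   plane, so that equality of elements is equality on the disc. *)
Definition bloch_pred : {pred R[i] -> X} :=
  [pred f | `[< [/\ forall z, ~ disc R z -> f z = 0,
                    analytic_on_disc f &
                    has_ubound [set bloch_weight f z | z in disc R]] >]].

Record bloch : Type :=
  Bloch { bloch_fun :> R[i] -> X ; _ : bloch_fun \in bloch_pred }.

HB.instance Definition _ := [isSub for bloch_fun].
HB.instance Definition _ := [Choice of bloch by <:].

Lemma bloch_predP (f : R[i] -> X) :
  reflect [/\ forall z, ~ disc R z -> f z = 0, analytic_on_disc f &
              has_ubound [set bloch_weight f z | z in disc R]]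
          (f \in bloch_pred).
Proof. exact: asboolP. Qed.

Let derive1ZD (a : R[i]) (f g : R[i] -> X) z : derivable f z 1 ->
  derivable g z 1 -> derive1 (a *: f + g) z = a *: derive1 f z + derive1 g z.
Proof.
move=> df dg; rewrite !derive1E deriveD//; last exact: derivableZ.
by rewrite deriveZ.
Qed.

Let weightZD (a : R[i]) (f g : R[i] -> X) z : derivable f z 1 -> derivable g z 1 ->
  bloch_weight (a *: f + g) z <= nrm a * bloch_weight f z + bloch_weight g z.
Proof.
move=> df dg; rewrite /bloch_weight mulrA -mulrDl ler_wpM2r ?powR_ge0//.
by rewrite derive1ZD// -nrmZ ler_nrmD.
Qed.

Lemma bloch_submod : submod_closed bloch_pred.
Proof.
split=> [|a f g /bloch_predP[f0 df [M bf]] /bloch_predP[g0 dg [N bg]]].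
  apply/bloch_predP; split=> [//|z _|]; first exact: derivable_cst.
  exists 0 => _ [z _ <-]; rewrite /bloch_weight.
  by rewrite (derive1_cst (0 : X)) nrm0 mul0r.
apply/bloch_predP; split=> [z zD|z zD|].
- by rewrite !fctE f0// g0// scaler0 addr0.
- by apply: derivableD; [apply: derivableZ; exact: df|exact: dg].
exists (nrm a * M + N) => _ [z zD <-].
apply: le_trans (weightZD a (df z zD) (dg z zD)) _.
apply: lerD; last by apply: bg; exists z.
by rewrite ler_wpM2l ?nrm_ge0//; apply: bf; exists z.
Qed.

HB.instance Definition _ := GRing.isSubmodClosed.Build _ _ bloch_pred bloch_submod.
HB.instance Definition _ := [SubChoice_isSubLmodule of bloch by <:].

Definition bloch_norm (f : bloch) : R :=
  nrm (f 0) + sup [set bloch_weight f z | z in disc R].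

Let disc0 : disc R !=set0.
Proof. by exists 0; rewrite /disc/= normr0. Qed.

Let weight_ub (f : bloch) : has_ubound [set bloch_weight f z | z in disc R].
Proof. by have /bloch_predP[] := valP f. Qed.

Let derivable_bloch (f : bloch) z : disc R z -> derivable f z 1.
Proof. by have /bloch_predP[_ + _] := valP f; exact. Qed.

Let weight_ge0 (f : R[i] -> X) z : 0 <= bloch_weight f z.
Proof. by rewrite /bloch_weight mulr_ge0 ?nrm_ge0 ?powR_ge0. Qed.

Let bloch_normD f g :
  (bloch_norm (f + g))%:C <= (bloch_norm f)%:C + (bloch_norm g)%:C.
Proof.
rewrite -rmorphD lecR /bloch_norm addrACA; apply: lerD; first exact: ler_nrmD.
apply: sup_imageD => // z zD.
have := weightZD 1 (@derivable_bloch f z zD) (@derivable_bloch g z zD).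
by rewrite scale1r (_ : nrm (1 : R[i]) = 1) ?mul1r// /nrm normr1.
Qed.

Let bloch_normZ a f : (bloch_norm (a *: f))%:C = `|a| * (bloch_norm f)%:C.
Proof.
rewrite (nrmE (a : R[i])) -rmorphM; congr (_%:C).
rewrite /bloch_norm mulrDr; congr (_ + _); first exact: nrmZ.
apply: sup_imageZ => // [|z zD]; first exact: nrm_ge0.
rewrite /bloch_weight mulrA -nrmZ; congr (nrm _ * _).
by rewrite !derive1E deriveZ//; exact: derivable_bloch.
Qed.

Let small_increment (f : R[i] -> X) (w : R[i]) : derivable f w 1 ->
  derive1 f w = 0 -> forall e : R, 0 < e ->
  exists2 d : R, 0 < d &
    forall k : R[i], nrm k < d -> nrm (f (k + w) - f w) <= e * nrm k.
Proof.
move=> df f'0 e e0.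
have : (fun h : R[i] => h^-1 *: (f (h + w) - f w)) @ 0^' --> (0 : X).
  rewrite -[X in _ --> X]f'0; move: df; rewrite /derivable /derive1.
  have -> : (fun h : R[i] => h^-1 *: ((f \o shift w) (h *: (1 : R[i])) - f w)) =
            (fun h : R[i] => h^-1 *: (f (h + w) - f w)).
    by apply/funext => h /=; rewrite /GRing.scale/= mulr1.
  exact.
move=> /cvgrPdist_le /(_ e%:C); rewrite ltcR => /(_ e0).
rewrite near_withinE => /nbhs_normP[[d1 d2]] /=; rewrite ltcE /= => /andP[/eqP -> d10] H.
exists d1 => // k kd.
have [->|k0] := eqVneq k 0; first by rewrite add0r subrr !nrm0 mulr0.
have := H k; rewrite /= !sub0r !normrN !nrmE ltcR lecR nrmZ => /(_ kd k0).
have kp : 0 < nrm k by rewrite lt_def nrm_ge0 andbT; apply: contra k0 => /eqP/nrm_eq0 ->.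
have -> : nrm (k^-1 : R[i]) = (nrm k)^-1.
  by apply: complexI; rewrite -nrmE normfV nrmE fmorphV.
by rewrite ler_pdivrMl// mulrC.
Qed.

Let radial_derive (f : R[i] -> X) (z : R[i]) (t : R) :
  nrm z <= 1 -> derivable f (t%:C * z) 1 -> derive1 f (t%:C * z) = 0 ->
  is_derive t (1 : R) (fun s : R => nrm (f (s%:C * z) - f 0)) 0.
Proof.
move=> z1 df f'0; set N := fun s : R => _.
suff H : (fun h : R => h^-1 *: (N (h *: 1 + t) - N t)) @ 0^' --> (0 : R).
  by split; [apply/cvg_ex; exists 0|exact/cvg_lim].
apply/cvgrPdist_le => e e0.
have [d d0 H] := small_increment df f'0 e0.
rewrite near_withinE; apply/nbhs_normP; exists d => //= h.
rewrite /ball_/= !sub0r !normrN => hd h0.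
have hz : nrm (h%:C * z) <= `|h|.
  by rewrite (nrmZ h%:C (z : R[i])) nrm_real ler_piMr.
have {}H := H (h%:C * z) (le_lt_trans hz hd).
rewrite normrM normfV ler_pdivrMl ?normr_gt0// mulrC.
apply: le_trans (ler_wpM2l (ltW e0) hz).
apply: le_trans H; rewrite /N /GRing.scale /= mulr1 rmorphD mulrDl.
have tri (x y : X) : `|nrm x - nrm y| <= nrm (x - y).
  rewrite ler_norml lerNl opprB !lerBlDr; apply/andP; split.
    by rewrite -(nrmN (x - y)) opprB -[X in nrm X <= _](subrK x y) ler_nrmD.
  by rewrite -[X in nrm X <= _](subrK y x) ler_nrmD.
by apply: le_trans (tri _ _) _; rewrite opprB addrA subrK.
Qed.

Let bloch_norm_eq0 f : (bloch_norm f)%:C = 0 -> f = 0.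
Proof.
move=> /complexI/eqP; rewrite /bloch_norm paddr_eq0 ?nrm_ge0//; last first.
  exact: sup_image_ge0.
move=> /andP[/eqP/nrm_eq0 f0 /eqP s0]; apply: val_inj; apply/funext => z /=.
have /bloch_predP[fN _ _] := valP f.
have [zD|zD] := pselect (disc R z); last exact: fN.
have f'0 w : disc R w -> derive1 f w = 0.
  move=> wD; apply: nrm_eq0; apply/le_anti; rewrite nrm_ge0 andbT.
  have : bloch_weight f w <= 0.
    by rewrite -s0; apply: le_sup_image => //; exact: weight_ub.
  rewrite /bloch_weight pmulr_lle0//; apply: powR_gt0.
  rewrite subr_gt0 expr_lt1//; last exact: nrm_ge0.
  by move: wD; rewrite /disc /= nrmE ltcR.
have z1 : nrm z < 1 by move: zD; rewrite /disc /= nrmE ltcR.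
have tzD (t : R) : t \in `[0, 1] -> disc R (t%:C * z).
  rewrite in_itv /= => /andP[t0 t1]; rewrite /disc /= nrmE ltcR.
  rewrite (nrmZ t%:C (z : R[i])) nrm_real ger0_norm//.
  by apply: le_lt_trans z1; rewrite ler_piMl// nrm_ge0.
pose N (s : R) := nrm (f (s%:C * z) - f 0).
have dN (t : R) : t \in `[0, 1] -> is_derive t (1 : R) N 0.
  by move=> t01; apply: radial_derive; [exact: ltW|exact/derivable_bloch/tzD|
    exact/f'0/tzD].
have dN' (t : R) : t \in `]0, 1[ -> is_derive t (1 : R) N 0.
  by move=> t01; apply: dN; exact: subset_itv_oo_cc.
have cN : {within `[0, 1], continuous N}.
  by apply: derivable_within_continuous => t /dN [].
have [c _] := @MVT_segment R N (fun=> 0) 0 1 ler01 dN' cN.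
rewrite mul0r /N mul1r mul0r subrr nrm0 subr0 f0 subr0.
exact: nrm_eq0.
Qed.

HB.instance Definition _ := @Lmodule_isNormed.Build R[i] bloch
  (fun f => (bloch_norm f)%:C) bloch_normD bloch_normZ bloch_norm_eq0.

End Bloch.

Section WeightedComposition.
Variables (R : realType) (psi phi : R[i] -> R[i]) (alpha beta : R).
Variable X : normedModType R[i].

(* For [T] defined on the whole of [bloch alpha X] this says that
   f |-> psi . (f \o phi) maps [bloch alpha X] into [bloch beta X] and that [T]
   is the resulting operator.  Such a [T] is unique when it exists. *)
Definition is_weighted_composition (T : bloch alpha X -> bloch beta X) :=
  forall (f : bloch alpha X) (z : R[i]), disc R z ->
    T f z = psi z *: f (phi z).

Definition wco_bounded :=
  exists T : {linear bloch alpha X -> bloch beta X},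
    is_weighted_composition T /\ bounded_op T.

Definition wco_compact :=
  exists T : {linear bloch alpha X -> bloch beta X},
    [/\ is_weighted_composition T, bounded_op T & compact_op T].

Definition wco_weakly_compact :=
  exists T : {linear bloch alpha X -> bloch beta X},
    [/\ is_weighted_composition T, bounded_op T & weakly_compact_op T].

End WeightedComposition.

(* Main.v *)
(* Composing with functionals and tensoring with vectors transfers norm bounds
   between the scalar and the vector-valued operator.  Tensoring also makes weak
   compactness descend to the scalar operator and, applied to constant functions,
   gives every bounded sequence of [X] a weakly convergent subsequence, so [X] is
   reflexive.  Conversely, compactness of the scalar operator [T] yields
   [|T f| <= e |f| + C (|f (q 0)| + ... + |f (q m)|)]; applied to [L \o f], this
   and Hahn-Banach approximate any functional of the vector-valued operator by
   functionals of finitely many values [f (q j)], which converge weakly along a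
   subsequence when [X] is reflexive.

   For (1), the functionals norming [T f] are weighted derivative evaluations, so
   they are continuous for bounded pointwise convergence.  If [T f_n] does not
   tend to 0 for some bounded, pointwise null sequence [f_n], dilate the [f_n] so
   that their weighted derivatives vanish at the boundary, and pick functionals
   [K_n] of norm at most 1 with [|K_n (T f_n)| >= delta].  A gliding hump
   argument produces a subsequence whose partial sums over any set of indices
   stay bounded while the matrix [K_i (T f_j)] is nearly diagonal.  Then
   [K_2k - K_2k+1] tends to 0 on every [T f_j], hence by Mazur's theorem almost
   does so at a weak limit of [T] of the partial sums over even indices, where it
   nevertheless stays close to [delta]. *)

Require Import Defs.
From HB Require Import structures.
From mathcomp Require Import all_boot all_order all_algebra.
From mathcomp Require Import complex.
From mathcomp Require Import all_classical all_reals all_analysis.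
From mathcomp Require Import ring lra.

Set Implicit Arguments.
Unset Strict Implicit.
Unset Printing Implicit Defensive.

Import Order.TTheory GRing.Theory Num.Theory numFieldNormedType.Exports.

Local Open Scope classical_set_scope.
Local Open Scope ring_scope.
Local Open Scope complex_scope.

(** * Moduli and complex derivatives *)

Section Modulus.
Variable R : realType.
Implicit Types (V : normedModType R[i]) (z c : R[i]).

(** Analyticity is bare complex differentiability, so the function theory rests on one estimate,
    [derivative_le]: Cauchy's bound for functions whose derivative is bounded, as it is for a Bloch
    function on every smaller disc. It makes derivatives Lipschitz with constants depending only on
    the norm and the disc. This turns bounded pointwise null sequences into null sequences of
    derivatives, and makes weak pointwise limits differentiable in norm. Weak compactness is stated
    with sequences, reflexivity with the bidual; the passage between them, of Eberlein-Smulian type,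
    is carried out in both directions. In the gliding hump the rows [K_i (T f_j)], [i] fixed, tend
    to 0, but the columns converge only after extraction, to limits that may be nonzero. Hence the
    differences [K_2k - K_2k+1]. Boundedness of the partial sums forces the column limits to be
    small, so that these differences still see the diagonal. Dilation confines each hump: near the
    boundary the earlier functions are small, on the rest of the disc the new one is. *)

Lemma nrm_gt0 V (x : V) : (0 < nrm x) = (x != 0).
Proof.
rewrite lt_def nrm_ge0 andbT; apply/idP/idP; apply: contra => /eqP.
  by move=> ->; rewrite nrm0.
by move/nrm_eq0 ->.
Qed.

Lemma nrm_distC V (x y : V) : nrm (x - y) = nrm (y - x).
Proof. by rewrite -nrmN opprB. Qed.

Lemma ler_nrmB V (x y : V) : nrm (x - y) <= nrm x + nrm y.
Proof. by rewrite -(nrmN y) ler_nrmD. Qed.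

Lemma ler_nrm_dist V (x y : V) : nrm x <= nrm y + nrm (x - y).
Proof. by rewrite -{1}(subrK y x) addrC ler_nrmD. Qed.

Lemma ler_nrm_sum V (I : Type) (r : seq I) (P : pred I) (F : I -> V) :
  nrm (\sum_(i <- r | P i) F i) <= \sum_(i <- r | P i) nrm (F i).
Proof.
elim/big_rec2: _ => [|i y x _ le]; first by rewrite nrm0.
by apply: le_trans (ler_nrmD _ _) _; rewrite lerD2l.
Qed.

Lemma nrmM z c : nrm (z * c) = nrm z * nrm c.
Proof. exact: (nrmZ z (c : R[i])). Qed.

Lemma nrm1 : nrm (1 : R[i]) = 1.
Proof. by rewrite /nrm normr1. Qed.

Lemma nrmX z n : nrm (z ^+ n) = nrm z ^+ n.
Proof. by elim: n => [|n ih]; rewrite ?expr0 ?nrm1// !exprS nrmM ih. Qed.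

Lemma nrmV z : nrm z^-1 = (nrm z)^-1.
Proof. by apply: complexI; rewrite -nrmE normfV nrmE fmorphV. Qed.

Lemma nrmC z : nrm z = Num.sqrt (complex.Re z ^+ 2 + complex.Im z ^+ 2).
Proof. by rewrite /nrm normc_def. Qed.

Lemma Re_le_nrm z : `|complex.Re z| <= nrm z.
Proof. by rewrite nrmC -sqrtr_sqr ler_wsqrtr// lerDl sqr_ge0. Qed.

Lemma Im_le_nrm z : `|complex.Im z| <= nrm z.
Proof. by rewrite nrmC -sqrtr_sqr ler_wsqrtr// lerDr sqr_ge0. Qed.

Lemma nrm_le_ReIm z : nrm z <= `|complex.Re z| + `|complex.Im z|.
Proof.
rewrite nrmC; set a := complex.Re z; set b := complex.Im z.
rewrite -[leRHS]ger0_norm ?addr_ge0// -sqrtr_sqr ler_wsqrtr//.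
rewrite -(real_normK (num_real a)) -(real_normK (num_real b)) sqrrD.
by rewrite lerD2r lerDl mulrn_wge0// mulr_ge0.
Qed.

Lemma nrm_conjc z : nrm (z^*)%C = nrm z.
Proof. by rewrite !nrmC; case: z => a b /=; rewrite sqrrN. Qed.

Lemma mul_conjc z : z * (z^*)%C = ((nrm z) ^+ 2)%:C.
Proof.
rewrite nrmC sqr_sqrtr ?addr_ge0 ?sqr_ge0//.
by case: z => a b; apply/eqP; rewrite eq_complex /=; apply/andP; split; apply/eqP; ring.
Qed.

Lemma phase z : exists2 c : R[i], nrm c = 1 & c * z = (nrm z)%:C.
Proof.
have [->|z0] := eqVneq z 0; first by exists 1; rewrite ?nrm1// mul1r nrm0.
have nz : nrm z != 0 by rewrite gt_eqF// nrm_gt0.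
exists ((z^*)%C * ((nrm z)^-1)%:C).
  by rewrite nrmM nrm_conjc nrm_real ger0_norm ?invr_ge0 ?nrm_ge0// divff.
by rewrite mulrC mulrA mul_conjc -rmorphM expr2 mulfK.
Qed.

Lemma Re_real (r : R) : complex.Re (r%:C : R[i]) = r. Proof. by []. Qed.

Lemma ReD z c : complex.Re (z + c) = complex.Re z + complex.Re c.
Proof. by case: z; case: c. Qed.

Lemma ReB z c : complex.Re (z - c) = complex.Re z - complex.Re c.
Proof. by case: z; case: c. Qed.

Lemma ImB z c : complex.Im (z - c) = complex.Im z - complex.Im c.
Proof. by case: z; case: c. Qed.

Lemma Re_scale (r : R) z : complex.Re (r%:C * z) = r * complex.Re z.
Proof. by case: z => a b /=; rewrite mul0r subr0. Qed.

Lemma Im_scale (r : R) z : complex.Im (r%:C * z) = r * complex.Im z.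
Proof. by case: z => a b /=; rewrite mul0r addr0. Qed.

Lemma Re_mulNi z : complex.Re (- 'i%C * z) = complex.Im z.
Proof. by case: z => a b /=; ring. Qed.

Lemma discE z : disc R z <-> nrm z < 1.
Proof. by rewrite /disc /= nrmE ltcR. Qed.

End Modulus.

Section Sequences.
Variable R : realType.
Implicit Types V : normedModType R[i].

Lemma cvg_nrmP V (u : nat -> V) (l : V) :
  (u n @[n --> \oo] --> l) <->
  (forall e : R, 0 < e -> \forall n \near \oo, nrm (u n - l) < e).
Proof.
split=> [/cvgrPdist_lt H e e0|H].
  have e0C : 0 < e%:C :> R[i] by rewrite ltcR.
  have := H _ e0C; apply: filterS => n.
  by rewrite nrm_distC nrmE ltcR.
apply/cvgrPdist_lt => -[a b]; rewrite ltcE /= => /andP[/eqP -> a0].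
have := H a a0; apply: filterS => n.
by rewrite nrm_distC nrmE ltcR.
Qed.

End Sequences.

Section ComplexDerivative.
Variables (R : realType) (V : normedModType R[i]).
Implicit Types (f : R[i] -> V) (z : R[i]).

(** A first-order expansion without division by [h]: the product and chain rules become norm
    estimates, and [h = 0] is an admissible increment. *)
Definition cdiff f z (d : V) := forall e : R, 0 < e ->
  exists2 r : R, 0 < r & forall h : R[i], nrm h < r ->
    nrm (f (h + z) - f z - h *: d) <= e * nrm h.

Let quotE f z : (fun h : R[i] => h^-1 *: ((f \o shift z) (h *: (1 : R[i])) - f z)) =
            (fun h : R[i] => h^-1 *: (f (h + z) - f z)).
Proof. by apply/funext => h /=; rewrite /GRing.scale/= mulr1. Qed.

Let cdiff_cvg f z d : cdiff f z d <->
  (fun h : R[i] => h^-1 *: (f (h + z) - f z)) @ 0^' --> d.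
Proof.
have E (h : R[i]) : h != 0 ->
    nrm (f (h + z) - f z - h *: d) = nrm h * nrm (d - h^-1 *: (f (h + z) - f z)).
  move=> h0; rewrite -nrmZ scalerBr scalerA mulfV// scale1r.
  by rewrite -nrmN opprB.
split=> H.
  apply/cvgrPdist_le => -[e e']; rewrite ltcE /= => /andP[/eqP -> e0].
  have [r r0 Hr] := H e e0.
  rewrite near_withinE; apply/nbhs_normP; exists r%:C; first by rewrite /= ltcR.
  move=> h /=; rewrite sub0r normrN !nrmE ltcR => hr h0.
  rewrite lecR; have := Hr h hr; rewrite E// mulrC.
  by rewrite ler_pM2r// nrm_gt0.
move=> e e0; move/cvgrPdist_le : H => /(_ e%:C); rewrite ltcR => /(_ e0).
rewrite near_withinE => /nbhs_normP[[d1 d2]] /=; rewrite ltcE /= => /andP[/eqP -> d10] H.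
exists d1 => // k kd.
have [->|k0] := eqVneq k 0; first by rewrite add0r subrr scale0r subr0 !nrm0 mulr0.
rewrite E// mulrC ler_wpM2r ?nrm_ge0//.
by have := H k; rewrite /= !sub0r !normrN !nrmE ltcR lecR; apply.
Qed.

Lemma cdiffP f z d : cdiff f z d <-> derivable f z 1 /\ derive1 f z = d.
Proof.
rewrite cdiff_cvg /derivable /derive1 quotE; split=> [H|[H <-//]].
by split; [apply/cvg_ex; exists d|exact/cvg_lim].
Qed.

Lemma derivable_cdiff f z : derivable f z 1 -> cdiff f z (derive1 f z).
Proof. by move=> H; apply/cdiffP. Qed.

Lemma cdiff_derive1 f z d : cdiff f z d -> derive1 f z = d.
Proof. by case/cdiffP. Qed.

Lemma cdiff_derivable f z d : cdiff f z d -> derivable f z 1.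
Proof. by case/cdiffP. Qed.

(** Elements of [bloch] are cut off by 0 outside the disc, so they agree with the formula defining
    them only near points of the disc. *)
Lemma cdiff_local f g z d (r : R) : 0 < r ->
  (forall h : R[i], nrm h < r -> f (h + z) = g (h + z)) ->
  cdiff f z d -> cdiff g z d.
Proof.
move=> r0 fg H e e0; have [s s0 Hs] := H e e0.
exists (Num.min r s) => [|h]; first by rewrite lt_min r0.
rewrite lt_min => /andP[hr hs].
have z0 := fg 0; rewrite nrm0 add0r in z0.
by rewrite -fg// -z0//; exact: Hs.
Qed.

Lemma cdiff_cst (x : V) z : cdiff (fun=> x) z 0.
Proof.
move=> e e0; exists 1 => // h _; rewrite scaler0 subrr subr0 nrm0.
by rewrite mulr_ge0 ?nrm_ge0// ltW.
Qed.

Lemma cdiffZD (a : R[i]) f g z d d' : cdiff f z d -> cdiff g z d' ->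
  cdiff (fun w => a *: f w + g w) z (a *: d + d').
Proof.
move=> /cdiffP[df <-] /cdiffP[dg <-]; apply/cdiffP; split.
  by apply: derivableD => //; exact: derivableZ.
rewrite !derive1E deriveD//; last exact: derivableZ.
by rewrite deriveZ.
Qed.

Lemma cdiff_bound f z d : cdiff f z d -> exists2 r : R, 0 < r &
  forall h : R[i], nrm h < r -> nrm (f (h + z) - f z) <= (1 + nrm d) * nrm h.
Proof.
move=> /(_ 1 ltr01)[r r0 H]; exists r => // h /H.
rewrite mulrDl mul1r => H1; apply: le_trans (ler_nrm_dist _ (h *: d)) _.
by rewrite nrmZ (mulrC (nrm d)) addrC lerD2r.
Qed.

End ComplexDerivative.

Section ComplexDerivativeRules.
Variables (R : realType) (V : normedModType R[i]).
Implicit Types (f : R[i] -> V) (z : R[i]).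

Let comp_incr (k h p : R[i]) (a b d : V) :
  a - b - h *: (p *: d) = (a - b - k *: d) + (k - h * p) *: d.
Proof. by rewrite scalerBl -scalerA [RHS]addrA subrK. Qed.

Lemma cdiff_comp f (phi : R[i] -> R[i]) z d (p : R[i]) :
  cdiff phi z p -> cdiff f (phi z) d -> cdiff (fun w => f (phi w)) z (p *: d).
Proof.
move=> Hp Hf e e0.
have [r1 r10 H1] := cdiff_bound Hp.
pose K := 1 + nrm p; have K0 : 0 < K by rewrite /K ltr_wpDr// nrm_ge0.
pose D := 1 + nrm d; have D0 : 0 < D by rewrite /D ltr_wpDr// nrm_ge0.
have [r2 r20 H2] := Hf (e / 2 / K) ltac:(by rewrite !divr_gt0).
have [r3 r30 H3] := Hp (e / 2 / D) ltac:(by rewrite !divr_gt0).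
(* The bound [r2 / K] keeps the increment [k] of [phi], of size at most [K * nrm h], inside the
   radius valid for [f]. *)
exists (Num.min r1 (Num.min (r2 / K) r3)) => [|h].
  by rewrite !lt_min r10 r30 divr_gt0.
rewrite !lt_min => /and3P[h1 h2 h3].
set k := phi (h + z) - phi z.
have kh : nrm k <= K * nrm h by exact: H1.
have kr : nrm k < r2.
  by apply: le_lt_trans kh _; rewrite mulrC -ltr_pdivlMr.
have {}H2 := H2 k kr; rewrite /k subrK -/k in H2.
have {}H3 := H3 h h3; rewrite -/k in H3.
have -> : f (phi (h + z)) - f (phi z) - h *: (p *: d) =
   (f (phi (h + z)) - f (phi z) - k *: d) + (k - h * p) *: d.
  exact: comp_incr.
apply: le_trans (ler_nrmD _ _) _; rewrite (splitr e) mulrDl; apply: lerD.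
  apply: le_trans H2 _.
  apply: le_trans (ler_wpM2l _ kh) _; first by rewrite !divr_ge0// ltW.
  by rewrite mulrA divfK// gt_eqF.
rewrite nrmZ; apply: le_trans (ler_wpM2r (nrm_ge0 _) H3) _.
rewrite mulrAC ler_wpM2r ?nrm_ge0// -[leRHS](divfK (lt0r_neq0 D0)).
by apply: ler_wpM2l; rewrite ?lerDr// !divr_ge0// ltW.
Qed.

Let prod_incr (k c h p : R[i]) (m v d : V) :
  (k + c) *: (m + v) - c *: v - h *: (p *: v + c *: d) =
  (k - h * p) *: v + c *: (m - h *: d) + k *: m.
Proof.
rewrite scalerDl !scalerDr scalerBl scalerN !scalerA (mulrC h c) opprD.
rewrite (addrA _ (c *: m)) addrK.
by rewrite [LHS](AC (3*2) (2*4*(3*5)*1))%AC.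
Qed.

Lemma cdiffM (psi : R[i] -> R[i]) f z (p : R[i]) d :
  cdiff psi z p -> cdiff f z d ->
  cdiff (fun w => psi w *: f w) z (p *: f z + psi z *: d).
Proof.
move=> Hp Hf e e0.
have [r1 r10 H1] := cdiff_bound Hp.
have [r4 r40 H4] := cdiff_bound Hf.
pose K := 1 + nrm p; have K0 : 0 < K by rewrite /K ltr_wpDr// nrm_ge0.
pose L := 1 + nrm d; have L0 : 0 < L by rewrite /L ltr_wpDr// nrm_ge0.
pose A := 1 + nrm (f z); have A0 : 0 < A by rewrite /A ltr_wpDr// nrm_ge0.
pose B := 1 + nrm (psi z); have B0 : 0 < B by rewrite /B ltr_wpDr// nrm_ge0.
have e3 : 0 < e / 3 by rewrite divr_gt0.
have [r2 r20 H2] := Hp (e / 3 / A) ltac:(by rewrite divr_gt0).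
have [r3 r30 H3] := Hf (e / 3 / B) ltac:(by rewrite divr_gt0).
have KL0 : 0 < K * L by rewrite mulr_gt0.
(* The last bound controls the second-order term [k *: m], whose size is at most
   [K * L * nrm h ^+ 2]. *)
exists (Num.min (Num.min r1 r4) (Num.min (Num.min r2 r3) (e / 3 / (K * L)))) => [|h].
  by rewrite !lt_min r10 r20 r30 r40 divr_gt0.
rewrite !lt_min => /andP[/andP[h1 h4]] /andP[/andP[h2 h3] h5].
set k := psi (h + z) - psi z; set m := f (h + z) - f z.
have -> : psi (h + z) *: f (h + z) - psi z *: f z - h *: (p *: f z + psi z *: d) =
   (k - h * p) *: f z + psi z *: (m - h *: d) + k *: m.
  have -> : psi (h + z) = k + psi z by rewrite subrK.
  have -> : f (h + z) = m + f z by rewrite subrK.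
  exact: prod_incr.
apply: le_trans (ler_nrmD _ _) _.
have -> : e * nrm h = e / 3 * nrm h + e / 3 * nrm h + e / 3 * nrm h by field.
apply: lerD; first apply: le_trans (ler_nrmD _ _) _; first apply: lerD.
- rewrite nrmZ; apply: le_trans (ler_wpM2r (nrm_ge0 _) (H2 h h2)) _.
  rewrite mulrAC ler_wpM2r ?nrm_ge0// -[leRHS](divfK (lt0r_neq0 A0)).
  by apply: ler_wpM2l; rewrite ?lerDr// !divr_ge0// ltW.
- rewrite nrmZ mulrC; apply: le_trans (ler_wpM2r (nrm_ge0 _) (H3 h h3)) _.
  rewrite mulrAC ler_wpM2r ?nrm_ge0// -[leRHS](divfK (lt0r_neq0 B0)).
  by apply: ler_wpM2l; rewrite ?lerDr// !divr_ge0// ltW.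
rewrite nrmZ; apply: le_trans (ler_pM (nrm_ge0 _) (nrm_ge0 _) (H1 h h1) (H4 h h4)) _.
rewrite mulrACA mulrA ler_wpM2r ?nrm_ge0//.
by rewrite mulrC -ler_pdivlMr ?ltW.
Qed.
End ComplexDerivativeRules.

(** * Circle means *)

Section CircleMeans.
Variable R : realType.
Notation mu := (@lebesgue_measure R).
Implicit Types (a b T K : R) (f F v D : R -> R).

Lemma continuous_integrable_segment f a b : continuous f ->
  mu.-integrable `[a, b] (EFin \o f).
Proof.
move=> cf; apply: continuous_compact_integrable; first exact: segment_compact.
exact: continuous_subspaceT.
Qed.

Lemma is_derive_continuous f x d : is_derive x (1 : R) f d -> {for x, continuous f}.
Proof. by move=> [df _]; apply/differentiable_continuous/derivable1_diffP. Qed.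

Lemma is_derive_addl a (x : R) : is_derive x (1 : R) (fun h : R => a + h) 1.
Proof.
by have := is_deriveD (is_derive_cst a x 1) (is_derive_id x 1); rewrite add0r.
Qed.

Lemma Rintegral_segment_primitive f F a b : a < b -> continuous f ->
  (forall t, t \in `[a, b] -> is_derive t (1 : R) F (f t)) ->
  \int[mu]_(t in `[a, b]) f t = F b - F a.
Proof.
move=> ab cf dF.
have cF t : t \in `[a, b] -> {for t, continuous F}.
  by move=> /dF; exact: is_derive_continuous.
rewrite /Rintegral (@continuous_FTC2 _ f F a b)//.
- exact: continuous_subspaceT.
- split.
  + move=> t tab; have [] := dF t _ => //.
    by apply: subset_itv_oo_cc; rewrite inE in tab *.
  + apply: cvg_at_right_filter; apply: cF.
    by rewrite in_itv /= lexx ltW.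
  + apply: cvg_at_left_filter; apply: cF.
    by rewrite in_itv /= lexx ltW.
- move=> t tab; have [_] := dF t (subset_itv_oo_cc tab).
  by rewrite derive1E.
Qed.

Lemma primitive_exists f a b : continuous f ->
  exists F, forall t, t \in `]a, b[ -> is_derive t (1 : R) F (f t).
Proof.
move=> cf; exists (fun x => \int[mu]_(t in `[a, x]) f t) => t.
rewrite in_itv /= => /andP[a_t tb].
have [d e] := continuous_FTC1_closed tb (continuous_integrable_segment a b cf) a_t (cf t).
have e' := e; rewrite derive1E in e'.
exact: (DeriveDef d e').
Qed.

Lemma lebesgue_segment a b : a < b -> fine (mu `[a, b]) = b - a.
Proof.
by move=> ab; have := @lebesgue_measure_itv R `[a, b]; rewrite /= lte_fin ab => ->.
Qed.

Lemma Rintegral_segment_bound f a b (B : R) : a < b -> continuous f ->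
  (forall t, `|f t| <= B) -> `|\int[mu]_(t in `[a, b]) f t| <= B * (b - a).
Proof.
move=> ab cf fB.
apply: le_trans (le_normr_Rintegral _ (continuous_integrable_segment a b cf)) _ => //.
have -> : B * (b - a) = \int[mu]_(t in `[a, b]) cst B t.
  by rewrite Rintegral_cst// lebesgue_segment.
apply: le_Rintegral => //.
- apply: continuous_integrable_segment => t.
  by apply: cvg_norm; exact: cf.
- by apply: continuous_integrable_segment => t; exact: cvg_cst.
Qed.

(* The derivative need not be continuous: differentiating the integral of
   [v (t + h)] with respect to [h] gives the result by dominated convergence. *)
Lemma Rintegral_bounded_derivative v D T K : 0 < T ->
  (forall t, is_derive t (1 : R) v (D t)) -> (forall t, `|D t| <= K) ->
  \int[mu]_(t in `[0, T]) D t = v T - v 0.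
Proof.
move=> T0 dv DK.
have cv : continuous v by move=> t; exact: is_derive_continuous (dv t).
have dvs h t : is_derive h (1 : R) (fun h => v (t + h)) (D (t + h)).
  have := @is_derive1_comp R v (fun h => t + h) h (D (t + h)) 1 (dv _) _.
  by rewrite mulr1; apply; exact: is_derive_addl.
have d1 h t : partial1of2 (fun h t => v (t + h)) h t = D (t + h).
  by rewrite partial1of2E; have [_] := dvs h t.
have K0 : 0 <= K by apply: le_trans (DK 0).
have I0 : (`]-1, 1[%classic : set R) 0 by rewrite /= in_itv /= ltrN10 ltr01.
have csh h : continuous (fun t => v (t + h)).
  by move=> t; apply: (@continuous_comp _ _ _ (fun t => t + h) v); [apply: cvgD; [exact: cvg_id|exact: cvg_cst]|exact: cv].
have step : (fun h => \int[mu]_(t in `[0, T]) v (t + h))^`()%classic 0 =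
    \int[mu]_(t in `[0, T]) D t.
  rewrite (@differentiation_under_integral R _ _ mu (fun h t => v (t + h)) `[0, T]
    _ 0 (-1) 1 I0 _ _ (cst K))//.
  - by apply: eq_Rintegral => t _; rewrite d1 addr0.
  - by move=> h _; apply: continuous_integrable_segment; exact: csh.
  - by apply: continuous_integrable_segment => t; exact: cvg_cst.
  - by move=> h t _ _; rewrite d1.
(* The margin around [[0, T]] leaves room for every shift [h] with [|h| < 1]. *)
have [F dF] := primitive_exists (-2) (T + 2) cv.
have Fh h : `|h| < 1 -> \int[mu]_(t in `[0, T]) v (t + h) = F (T + h) - F h.
  rewrite ltr_norml => /andP[h1 h2].
  have dFh t : t \in `[0, T] -> is_derive t (1 : R) (fun t => F (t + h)) (v (t + h)).
    rewrite in_itv /= => /andP[t0 tT].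
    have dt : is_derive t (1 : R) (fun t => t + h) 1.
      by have := is_deriveD (is_derive_id t 1) (is_derive_cst h t 1); rewrite addr0.
    have dFt : is_derive (t + h) (1 : R) F (v (t + h)).
      by apply: dF; rewrite in_itv /=; apply/andP; split; lra.
    by have := @is_derive1_comp R F (fun t => t + h) t (v (t + h)) 1 dFt dt; rewrite mulr1.
  by have := Rintegral_segment_primitive T0 (csh h) dFh; rewrite add0r.
rewrite -step.
have J : is_derive (0 : R) (1 : R) (fun h => F (T + h) - F h) (v T - v 0).
  apply: is_deriveB; last by apply: dF; rewrite in_itv /=; apply/andP; split; lra.
  have := @is_derive1_comp R F (fun h => T + h) 0 (v T) 1 _ _.
  rewrite mulr1; apply.
    by rewrite addr0; apply: dF; rewrite in_itv /=; apply/andP; split; lra.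
  exact: is_derive_addl.
have [_ <-] := J; rewrite derive1E.
apply: near_eq_derive.
near=> h; apply: Fh.
near: h; apply: (@nbhs0_lt R R); exact: ltr01.
Unshelve. all: by end_near. Qed.

(** [D] encodes the Cauchy-Riemann equation [u_s = v_t] in the coordinates log-radius and angle.
    Differentiating under the integral sign, the mean of [u] over a period has derivative
    [v s T - v s 0 = 0], so it does not depend on [s]; for [s] decreasing it approaches [c]. *)
Lemma circle_mean (u v D : R -> R -> R) (S T K B c : R) : 0 < T ->
  (forall s t, s < S -> is_derive s (1 : R) (u ^~ t) (D s t)) ->
  (forall s t, s < S -> is_derive t (1 : R) (v s) (D s t)) ->
  (forall s t, s < S -> `|D s t| <= K) ->
  (forall s, s < S -> v s T = v s 0) ->
  (forall s, s < S -> continuous (u s)) ->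
  (forall e, 0 < e -> exists2 s0, s0 < S &
     forall s t, s <= s0 -> `|u s t - c| <= e) ->
  forall s, s < S -> (forall t, `|u s t| <= B) -> `|c| <= B.
Proof.
move=> T0 du dv DK vT cu uc s sS uB.
pose I s := \int[mu]_(t in `[0, T]) u s t.
have dI r : r < S -> is_derive r (1 : R) I 0.
  move=> rS.
  have I0 : (`]r - 1, S[%classic : set R) r by rewrite /= in_itv /= rS ltrBlDr ltrDl ltr01.
  have d1 x t : x < S -> partial1of2 u x t = D x t.
    by move=> xS; rewrite partial1of2E; have [_] := du x t xS.
  have K0 : 0 <= K by apply: le_trans (DK s 0 sS).
  have xS x : x \in `]r - 1, S[ -> x < S by rewrite in_itv /= => /andP[].
  have h1 : forall x : R, x \in `]r - 1, S[ -> mu.-integrable `[0, T] (EFin \o u x).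
    by move=> x /xS xS'; apply: continuous_integrable_segment; exact: cu.
  have h2 : forall (x : R) t, x \in `]r - 1, S[ -> t \in `[0, T] -> derivable (u ^~ t) x 1.
    by move=> x t /xS xS' _; have [] := du x t xS'.
  have h3 : mu.-integrable `[0, T] (EFin \o cst K).
    by apply: continuous_integrable_segment => t; exact: cvg_cst.
  have h4 : forall (x : R) t, x \in `]r - 1, S[ -> t \in `[0, T] -> `|partial1of2 u x t| <= cst K t.
    by move=> x t /xS xS' _; rewrite d1//; exact: DK.
  have dI := @derivable_under_integral R _ _ mu u `[0, T] (measurable_itv _) r (r - 1) S I0 h1 h2
     (cst K) (fun=> K0) h3 h4.
  apply: (DeriveDef dI); rewrite -derive1E.
  rewrite (@differentiation_under_integral R _ _ mu u `[0, T] (measurable_itv _) r (r - 1) S I0 h1 h2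
     (cst K) (fun=> K0) h3 h4).
  have -> : \int[mu]_(t in `[0, T]) partial1of2 u r t = \int[mu]_(t in `[0, T]) D r t.
    by apply: eq_Rintegral => t _; exact: d1.
  by rewrite (Rintegral_bounded_derivative T0 (fun t => dv r t rS) (fun t => DK r t rS)) vT// subrr.
have Icst r : r <= s -> I r = I s.
  rewrite le_eqVlt => /predU1P[->//|rs].
  have [|x|x _] := @MVT R I (fun=> 0) r s rs.
  - by move=> x; rewrite in_itv /= => /andP[_ xs]; apply: dI; exact: lt_trans xs sS.
  - apply: derivable_within_continuous => y; rewrite in_itv /= => /andP[_ ys].
    by have [] := dI y (le_lt_trans ys sS).
  - by rewrite mul0r => /eqP; rewrite subr_eq0 => /eqP ->.
apply/ler_addgt0Pr => e e0; have [s0 s0S us0] := uc e e0.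
pose r := Num.min s0 s.
have rS : r < S by rewrite /r gt_min s0S.
have Ir : `|I r| <= B * T.
  rewrite Icst; last by rewrite /r ge_min lexx orbT.
  by have := Rintegral_segment_bound T0 (cu s sS) uB; rewrite subr0.
have cuc : continuous (fun t => u r t - c).
  by move=> t; apply: cvgB; [exact: cu|exact: cvg_cst].
have Irc : `|I r - c * T| <= e * T.
  have -> : I r - c * T = \int[mu]_(t in `[0, T]) (u r t - c).
    have cc : continuous (cst c : R -> R) by move=> t; exact: cvg_cst.
    transitivity (\int[mu]_(t in `[0, T]) u r t - \int[mu]_(t in `[0, T]) cst c t).
      by rewrite Rintegral_cst// lebesgue_segment// subr0.
    apply/esym/RintegralB; first exact: measurable_itv.
      exact: continuous_integrable_segment (cu r rS).
    exact: continuous_integrable_segment cc.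
  have := Rintegral_segment_bound T0 cuc (fun t => us0 r t _).
  by rewrite subr0; apply; rewrite /r ge_min lexx.
rewrite -(ler_pM2r T0) -{1}(gtr0_norm T0) -normrM mulrDl.
rewrite -[c * T](subrK (I r)) (le_trans (ler_normD _ _))// addrC.
by rewrite lerD// -normrN opprB.
Qed.

End CircleMeans.

(** * Cauchy estimates *)

Section RealCurves.
Variable R : realType.
Implicit Types (x y g : R -> R) (f : R[i] -> R[i]).

Lemma rdiffP g (t c : R) : is_derive t (1 : R) g c <->
  (forall e : R, 0 < e -> exists2 r : R, 0 < r & forall h : R, `|h| < r ->
    `|g (h + t) - g t - h * c| <= e * `|h|).
Proof.
have E (h : R) : h != 0 ->
    `|g (h + t) - g t - h * c| = `|h| * `|c - h^-1 *: (g (h *: (1 : R) + t) - g t)|.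
  move=> h0; rewrite -normrM -normrN /GRing.scale /= mulr1; congr `|_|.
  by rewrite mulrBr mulVKf// opprB addrC.
have S : is_derive t (1 : R) g c <->
    (fun h : R => h^-1 *: (g (h *: (1 : R) + t) - g t)) @ 0^' --> c.
  split=> [[dg <-]|H]; first exact: dg.
  have dg : derivable g t 1 by apply/cvg_ex; exists c.
  by apply: (DeriveDef dg); exact/cvg_lim.
rewrite S; split=> H.
  move=> e e0; move/cvgrPdist_le : H => /(_ e e0).
  rewrite near_withinE => /nbhs_normP[d /= d0 H].
  exists d => // k kd; have [->|k0] := eqVneq k 0.
    by rewrite add0r subrr mul0r subr0 normr0 mulr0.
  rewrite E// mulrC ler_wpM2r//.
  by have := H k; rewrite /= !sub0r !normrN; apply.
apply/cvgrPdist_le => e e0; have [r r0 Hr] := H e e0.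
rewrite near_withinE; apply/nbhs_normP; exists r => //.
move=> h /=; rewrite sub0r normrN => hr h0.
have := Hr h hr; rewrite E// mulrC.
by rewrite ler_pM2r// normr_gt0.
Qed.

Lemma is_derive_Re_comp f x y (t a b : R) (d : R[i]) :
  is_derive t (1 : R) x a -> is_derive t (1 : R) y b ->
  cdiff f (x t +i* y t) d ->
  is_derive t (1 : R) (fun s => complex.Re (f (x s +i* y s)))
    (complex.Re (d * (a +i* b))).
Proof.
move=> /rdiffP Hx /rdiffP Hy Hf; apply/rdiffP => e e0.
set p := a +i* b; set c := x t +i* y t.
pose g s := x s +i* y s.
have Hg (e1 : R) : 0 < e1 -> exists2 r : R, 0 < r & forall h : R, `|h| < r ->
    nrm (g (h + t) - c - h%:C * p) <= e1 * `|h|.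
  move=> e10; have e20 : 0 < e1 / 2 by rewrite divr_gt0.
  have [r1 r10 H1] := Hx _ e20; have [r2 r20 H2] := Hy _ e20.
  exists (Num.min r1 r2) => [|h]; first by rewrite lt_min r10.
  rewrite lt_min => /andP[h1 h2]; apply: le_trans (nrm_le_ReIm _) _.
  rewrite !ReB !ImB Re_scale Im_scale /=.
  by rewrite (splitr e1) mulrDl lerD ?H1 ?H2.
pose K := 1 + nrm p; have K0 : 0 < K by rewrite /K ltr_wpDr// nrm_ge0.
pose D := 1 + nrm d; have D0 : 0 < D by rewrite /D ltr_wpDr// nrm_ge0.
have [r1 r10 H1] := Hg 1 ltr01.
have [r2 r20 H2] := Hf (e / 2 / K) ltac:(by rewrite !divr_gt0).
have [r3 r30 H3] := Hg (e / 2 / D) ltac:(by rewrite !divr_gt0).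
exists (Num.min r1 (Num.min (r2 / K) r3)) => [|h].
  by rewrite !lt_min r10 r30 divr_gt0.
rewrite !lt_min => /and3P[h1 h2 h3].
pose k := g (h + t) - c.
have kh : nrm k <= K * `|h|.
  apply: le_trans (ler_nrm_dist _ (h%:C * p)) _.
  rewrite nrmM nrm_real mulrDl addrC (mulrC `|h|) lerD2r.
  exact: H1.
have kr : nrm k < r2 by apply: le_lt_trans kh _; rewrite mulrC -ltr_pdivlMr.
have {}H2 := H2 k kr; rewrite /k subrK -/k in H2.
have {}H3 := H3 h h3; rewrite -/k in H3.
rewrite -/(g (h + t)) -/c -Re_scale -!ReB.
have -> : f (g (h + t)) - f c - h%:C * (d * p) =
   (f (g (h + t)) - f c - k * d) + (k - h%:C * p) * d by ring.
apply: le_trans (Re_le_nrm _) _; apply: le_trans (ler_nrmD _ _) _.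
rewrite {1}(splitr e) [leRHS]mulrDl; apply: lerD.
  apply: le_trans H2 _.
  apply: le_trans (ler_wpM2l _ kh) _; first by rewrite !divr_ge0// ltW.
  by rewrite mulrA divfK// gt_eqF.
rewrite nrmM; apply: le_trans (ler_wpM2r (nrm_ge0 _) H3) _.
rewrite mulrAC ler_wpM2r ?nrm_ge0// -[leRHS](divfK (lt0r_neq0 D0)).
by apply: ler_wpM2l; rewrite ?lerDr// !divr_ge0// ltW.
Qed.

Lemma cdiffMl (c : R[i]) f z (d : R[i]) : cdiff f z d -> cdiff (fun w => c * f w) z (c * d).
Proof.
move=> Hf; have := cdiffZD c Hf (cdiff_cst (0 : R[i]) z).
by under [fun w : R[i] => _ *: _ + _]eq_fun do rewrite addr0; rewrite addr0.
Qed.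

Lemma is_derive_Im_comp f x y (t a b : R) (d : R[i]) :
  is_derive t (1 : R) x a -> is_derive t (1 : R) y b ->
  cdiff f (x t +i* y t) d ->
  is_derive t (1 : R) (fun s => complex.Im (f (x s +i* y s)))
    (complex.Im (d * (a +i* b))).
Proof.
move=> Hx Hy Hf; have := is_derive_Re_comp Hx Hy (cdiffMl (- 'i%C) Hf).
by rewrite -mulrA Re_mulNi; under [fun s : R => _]eq_fun do rewrite Re_mulNi.
Qed.

End RealCurves.

Section MeanValue.
Variable R : realType.
Implicit Types (f : R[i] -> R[i]).

(** A phase makes the increment [f z - f w] real; the real mean value theorem then applies to the
    real part along the segment, with no loss in the constant. *)
Lemma mean_value f (D : R[i] -> R[i]) (z w : R[i]) (K : R) :
  (forall t : R, 0 <= t <= 1 -> cdiff f (w + t%:C * (z - w)) (D (w + t%:C * (z - w)))) ->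
  (forall t : R, 0 <= t <= 1 -> nrm (D (w + t%:C * (z - w))) <= K) ->
  nrm (f z - f w) <= K * nrm (z - w).
Proof.
move=> df DK; have [c c1 cE] := phase (f z - f w).
pose x (t : R) := complex.Re w + t * complex.Re (z - w).
pose y (t : R) := complex.Im w + t * complex.Im (z - w).
have xyE (t : R) : x t +i* y t = w + t%:C * (z - w).
  rewrite /x /y -Re_scale -Im_scale; move: (_ * _); case: (w) => a b.
  by case.
have dlin (a b t : R) : is_derive t (1 : R) (fun s => a + s * b) b.
  apply/rdiffP => e e0; exists 1 => // h _.
  by rewrite (_ : _ - _ - _ = 0) ?normr0 ?mulr_ge0// ?ltW//; ring.
pose N (t : R) := complex.Re (c * f (x t +i* y t)).
pose N' (t : R) := complex.Re (c * D (w + t%:C * (z - w)) * (z - w)).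
have dN (t : R) : 0 <= t <= 1 -> is_derive t (1 : R) N (N' t).
  move=> t01; have := is_derive_Re_comp (dlin (complex.Re w) (complex.Re (z - w)) t)
    (dlin (complex.Im w) (complex.Im (z - w)) t) (_ : cdiff (fun u => c * f u) _ _).
  rewrite -/(x t) -/(y t) xyE => /(_ _ (cdiffMl c (df t t01))).
  by rewrite /N' [X in _ * X](_ : _ = z - w)//; case: (z - w).
have [||s] := @MVT_segment R N N' 0 1 ler01.
- by move=> s; rewrite in_itv /= => /andP[s0 s1]; apply: dN; rewrite !ltW.
- apply: derivable_within_continuous => s; rewrite in_itv /= => s01.
  by have [] := dN s s01.
rewrite in_itv /= => s01; rewrite subr0 mulr1 /N !xyE mul1r mul0r addr0.
rewrite [w + (z - w)]addrC subrK -ReB -mulrBr cE Re_real => ->.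
apply: le_trans (ler_norm _) _; apply: le_trans (Re_le_nrm _) _.
by rewrite !nrmM c1 mul1r ler_wpM2r ?nrm_ge0// DK.
Qed.

End MeanValue.

Section CauchyEstimate.
Variable R : realType.
Implicit Types (f : R[i] -> R[i]).

Lemma cdiff_shift f (a z d : R[i]) : cdiff f (z + a) d -> cdiff (fun w => f (w + a)) z d.
Proof.
by move=> H e e0; have [r r0 Hr] := H e e0; exists r => // h hr; have := Hr h hr; rewrite addrA.
Qed.

Lemma cdiff_id (z : R[i]) : cdiff (fun w : R[i] => w) z 1.
Proof.
move=> e e0; exists 1 => // h _.
rewrite addrK (_ : h *: (1 : R[i]) = h); last by rewrite /GRing.scale/= mulr1.
by rewrite subrr nrm0 mulr_ge0 ?nrm_ge0// ltW.
Qed.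

Lemma cdiff_inv (z : R[i]) : z != 0 -> cdiff (fun w : R[i] => w^-1) z (- (z ^- 2)).
Proof.
move=> z0; have nz : 0 < nrm z by rewrite nrm_gt0.
move=> e e0; exists (Num.min (nrm z / 2) (e * nrm z ^+ 3 / 2)).
  by rewrite lt_min !divr_gt0// mulr_gt0// exprn_gt0.
move=> h; rewrite lt_min => /andP[h1 h2].
have hz : nrm z / 2 <= nrm (h + z).
  have := ler_nrm_dist z (h + z); rewrite opprD addrCA subrr addr0 nrmN.
  by move: h1; lra.
have hz0 : h + z != 0 by rewrite -nrm_gt0 (lt_le_trans _ hz)// divr_gt0.
have -> : (h + z)^-1 - z^-1 - h *: (- z ^- 2) = h ^+ 2 * ((h + z)^-1 * z ^- 2).
  by rewrite /GRing.scale /=; field; rewrite z0 hz0.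
rewrite !nrmM !nrmV !nrmX expr2 -mulrA mulrC ler_wpM2r ?nrm_ge0//.
have -> : nrm h * ((nrm (h + z))^-1 * (nrm z ^+ 2)^-1) = nrm h / (nrm (h + z) * nrm z ^+ 2).
  by rewrite [in RHS]invfM.
rewrite ler_pdivrMr; last by rewrite mulr_gt0 ?exprn_gt0// nrm_gt0.
apply: le_trans (ltW h2) _; rewrite -mulrA; apply: ler_wpM2l; first exact: ltW.
by rewrite exprS mulrAC; apply: ler_wpM2r => //; rewrite exprn_ge0// ltW.
Qed.

Let ball_segment (z w : R[i]) (r : R) (t : R) :
  nrm (z - w) < r -> 0 <= t <= 1 -> nrm (w + t%:C * (z - w) - w) < r.
Proof.
move=> zr /andP[t0 t1]; rewrite addrC addKr nrmM nrm_real ger0_norm//.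
by apply: le_lt_trans zr; rewrite ler_piMl// nrm_ge0.
Qed.

Lemma mean_value_ball f (D : R[i] -> R[i]) (w : R[i]) (r K : R) :
  (forall z, nrm (z - w) < r -> cdiff f z (D z)) ->
  (forall z, nrm (z - w) < r -> nrm (D z) <= K) ->
  forall z, nrm (z - w) < r -> nrm (f z - f w) <= K * nrm (z - w).
Proof.
move=> df DK z zr; apply: (@mean_value R f D) => t t01.
  by apply: df; exact: ball_segment.
by apply: DK; exact: ball_segment.
Qed.

(* The circle means of the difference quotient at [w] do not depend on the
   radius; letting the radius tend to 0 yields the derivative. *)
Lemma Re_derivative_le f (D : R[i] -> R[i]) (w : R[i]) (r K B : R) : 0 < r ->
  (forall z, nrm (z - w) < r -> cdiff f z (D z)) ->
  (forall z, nrm (z - w) < r -> nrm (D z) <= K) ->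
  (forall z, nrm (z - w) < r -> nrm (f z - f w) <= B) ->
  `|complex.Re (D w)| <= B / r.
Proof.
move=> r0 df DK fB.
have D0 : nrm (w - w) < r by rewrite subrr nrm0.
have B0 : 0 <= B by apply: le_trans (fB w D0); exact: nrm_ge0.
pose q (z : R[i]) := (f (z + w) - f w) * z^-1.
pose q' (z : R[i]) := D (z + w) * z^-1 - (f (z + w) - f w) * z ^- 2.
have inb (z : R[i]) : nrm z < r -> nrm (z + w - w) < r by rewrite addrK.
have dq (z : R[i]) : z != 0 -> nrm z < r -> cdiff q z (q' z).
  move=> z0 zr.
  have d1 : cdiff (fun v => f (v + w) - f w) z (D (z + w)).
    have := cdiffZD 1 (cdiff_shift (df _ (inb _ zr))) (cdiff_cst (- f w) z).
    by rewrite addr0 scale1r; under [fun v : R[i] => _ *: _ + _]eq_fun do rewrite scale1r.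
  have := cdiffM d1 (cdiff_inv z0).
  by rewrite /GRing.scale /= mulrN.
have zq' (z : R[i]) : z != 0 -> z * q' z = D (z + w) - q z.
  by move=> z0; rewrite /q' /q; field.
have qK (z : R[i]) : nrm z < r -> nrm (q z) <= K.
  move=> zr; have [->|z0] := eqVneq z 0.
    rewrite /q add0r subrr mul0r nrm0; apply: le_trans (DK w D0); exact: nrm_ge0.
  rewrite /q nrmM nrmV ler_pdivrMr ?nrm_gt0//.
  by have := mean_value_ball df DK (inb z zr); rewrite addrK.
(* [E s t] is exp (s + i t). With [z = E s t], the partial derivatives of [q (E s t)] are [z * q' z]
   in [s] and i times that in [t], which is the Cauchy-Riemann equation in the form used by
   [circle_mean]. *)
pose E (s t : R) : R[i] := (expR s * cos t) +i* (expR s * sin t).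
have EE (s t : R) : E s t = (expR s)%:C * (cos t +i* sin t).
  by apply/eqP; rewrite eq_complex /= !mul0r subr0 addr0 !eqxx.
have nE (s t : R) : nrm (E s t) = expR s.
  rewrite EE nrmM nrm_real ger0_norm ?expR_ge0// nrmC /= cos2Dsin2 sqrtr1.
  by rewrite mulr1.
have E0 (s t : R) : E s t != 0 by rewrite -nrm_gt0 nE expR_gt0.
pose S := ln r.
have Er (s t : R) : s < S -> nrm (E s t) < r.
  by move=> sS; rewrite nE -(lnK (_ : r \is Num.pos))// ltr_expR.
pose u (s t : R) := complex.Re (q (E s t)).
pose v (s t : R) := complex.Im (q (E s t)).
pose DD (s t : R) := complex.Re (E s t * q' (E s t)).
have dxs (s t : R) : is_derive s (1 : R) (fun s => expR s * cos t) (expR s * cos t).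
  apply: (is_derive_eq (is_deriveM (is_derive_expR s) (is_derive_cst (cos t) s 1))).
  by rewrite /cst /GRing.scale /=; ring.
have dys (s t : R) : is_derive s (1 : R) (fun s => expR s * sin t) (expR s * sin t).
  apply: (is_derive_eq (is_deriveM (is_derive_expR s) (is_derive_cst (sin t) s 1))).
  by rewrite /cst /GRing.scale /=; ring.
have dxt (s t : R) : is_derive t (1 : R) (fun t => expR s * cos t) (- (expR s * sin t)).
  apply: (is_derive_eq (is_deriveM (is_derive_cst (expR s) t 1) (is_derive_cos t))).
  by rewrite /cst /GRing.scale /=; ring.
have dyt (s t : R) : is_derive t (1 : R) (fun t => expR s * sin t) (expR s * cos t).
  apply: (is_derive_eq (is_deriveM (is_derive_cst (expR s) t 1) (is_derive_sin t))).
  by rewrite /cst /GRing.scale /=; ring.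
have iE (s t : R) : - (expR s * sin t) +i* (expR s * cos t) = 'i%C * E s t.
  by apply/eqP; rewrite eq_complex /= !mul0r !mul1r sub0r add0r !eqxx.
have ImRe (z : R[i]) : complex.Im ('i%C * z) = complex.Re z by case: z => a b /=; ring.
have ReIm (z : R[i]) : complex.Re ('i%C * z) = - complex.Im z by case: z => a b /=; ring.
have dv (s t : R) : s < S -> is_derive t (1 : R) (v s) (DD s t).
  move=> sS; have := is_derive_Im_comp (dxt s t) (dyt s t) (dq _ (E0 s t) (Er s t sS)).
  by rewrite iE mulrCA ImRe mulrC.
have du' (s t : R) : s < S -> is_derive t (1 : R) (u s) (- complex.Im (E s t * q' (E s t))).
  move=> sS; have := is_derive_Re_comp (dxt s t) (dyt s t) (dq _ (E0 s t) (Er s t sS)).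
  by rewrite iE mulrCA ReIm mulrC.
have du (s t : R) : s < S -> is_derive s (1 : R) (u ^~ t) (DD s t).
  move=> sS; have := is_derive_Re_comp (dxs s t) (dys s t) (dq _ (E0 s t) (Er s t sS)).
  by rewrite -/(E s t) mulrC.
have T0 : 0 < pi *+ 2 :> R by rewrite mulrn_wgt0// pi_gt0.
have DDK (s t : R) : s < S -> `|DD s t| <= K + K.
  move=> sS; apply: le_trans (Re_le_nrm _) _; rewrite zq'//.
  apply: le_trans (ler_nrmB _ _) _; apply: lerD; last by apply: qK; exact: Er.
  by apply: DK; apply: inb; exact: Er.
have vT (s : R) : s < S -> v s (pi *+ 2) = v s 0.
  by move=> _; rewrite /v /E cos2pi sin2pi cos0 sin0.
have cu (s : R) : s < S -> continuous (u s).
  by move=> sS t; apply: is_derive_continuous (du' s t sS).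
have uc (e : R) : 0 < e -> exists2 s0, s0 < S &
     forall s t, s <= s0 -> `|u s t - complex.Re (D w)| <= e.
  move=> e0; have [r1 r10 H1] := df w D0 e e0.
  pose r2 := Num.min r1 r / 2.
  have m0 : 0 < Num.min r1 r by rewrite lt_min r10.
  have r20 : 0 < r2 by rewrite divr_gt0.
  have r2m : r2 < Num.min r1 r by rewrite /r2 ltr_pdivrMr// mulr_natr mulr2n ltrDl.
  move: (r2m); rewrite lt_min => /andP[r21 r2r].
  exists (ln r2); first by rewrite ltr_ln.
  move=> s t ss; rewrite /u -ReB; apply: le_trans (Re_le_nrm _) _.
  have E1 : nrm (E s t) < r1.
    by rewrite nE (le_lt_trans _ r21)// -(lnK (_ : r2 \is Num.pos))// ler_expR.
  have -> : q (E s t) - D w = (f (E s t + w) - f w - E s t * D w) * (E s t)^-1.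
    by rewrite /q; field.
  by rewrite nrmM nrmV ler_pdivrMr ?nrm_gt0//; exact: H1.
have step (s : R) : s < S -> `|complex.Re (D w)| <= B / expR s.
  move=> sS; apply: (circle_mean T0 du dv DDK vT cu uc sS) => t.
  apply: le_trans (Re_le_nrm _) _; rewrite /q nrmM nrmV nE ler_wpM2r ?invr_ge0 ?expR_ge0//.
  by apply: fB; apply: inb; exact: Er.
(* The bound is known for all radii below [r]. If it failed at [r], it would already fail at the
   midpoint [r'] of [B / c] and [r]. *)
rewrite ler_pdivlMr// leNgt; apply/negP => Bc.
set c := `|complex.Re (D w)| in step Bc.
have c0 : 0 < c.
  by rewrite -(pmulr_lgt0 _ r0); apply: le_lt_trans Bc.
have Bcr : B / c < r by rewrite ltr_pdivrMr// mulrC.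
pose r' := (B / c + r) / 2.
have r'0 : 0 < r' by rewrite /r' divr_gt0// ltr_wpDl// divr_ge0// ltW.
have r'r : r' < r by rewrite /r'; lra.
have := step (ln r'); rewrite ltr_ln// => /(_ r'r).
rewrite lnK// ler_pdivlMr// mulrC -ler_pdivlMr// leNgt => /negP; apply.
by rewrite /r'; lra.
Qed.

Lemma derivative_le f (D : R[i] -> R[i]) (w : R[i]) (r K B : R) : 0 < r ->
  (forall z, nrm (z - w) < r -> cdiff f z (D z)) ->
  (forall z, nrm (z - w) < r -> nrm (D z) <= K) ->
  (forall z, nrm (z - w) < r -> nrm (f z - f w) <= B) ->
  nrm (D w) <= B / r.
Proof.
move=> r0 df DK fB; have [c c1 cE] := phase (D w).
have -> : nrm (D w) = `|complex.Re (c * D w)|.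
  by rewrite cE Re_real ger0_norm ?nrm_ge0.
apply: (@Re_derivative_le (fun z => c * f z) (fun z => c * D z) w r K) => //.
- by move=> z zr; apply: cdiffMl; exact: df.
- by move=> z zr; rewrite nrmM c1 mul1r DK.
- by move=> z zr; rewrite -mulrBr nrmM c1 mul1r fB.
Qed.

(** Cauchy's estimate for [f (z + h) - f z] on the disc of radius [r / 2], where the mean value
    inequality bounds this difference by [K * nrm h]. The computation gives the constant 4, which is
    rounded up to 8. *)
Lemma derivative_lipschitz f (D : R[i] -> R[i]) (w : R[i]) (r K : R) : 0 < r ->
  (forall z, nrm (z - w) < r -> cdiff f z (D z)) ->
  (forall z, nrm (z - w) < r -> nrm (D z) <= K) ->
  forall h, nrm h < r / 2 -> nrm (D (h + w) - D w) <= 8 * K / r * nrm h.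
Proof.
move=> r0 df DK h hr.
have K0 : 0 <= K by apply: le_trans (DK w _); rewrite ?nrm_ge0// subrr nrm0.
pose g (z : R[i]) := f (z + h) - f z.
have r2 : 0 < r / 2 by rewrite divr_gt0.
have half z : nrm (z - w) < r / 2 -> nrm (z - w) < r.
  by move=> zr; apply: lt_trans zr _; lra.
have halfh z : nrm (z - w) < r / 2 -> nrm (z + h - w) < r.
  move=> zr; rewrite addrAC; apply: le_lt_trans (ler_nrmD _ _) _; lra.
have dg z : nrm (z - w) < r / 2 -> cdiff g z (D (z + h) - D z).
  move=> zr; have := cdiffZD (-1) (df z (half z zr)) (cdiff_shift (df _ (halfh z zr))).
  rewrite scaleN1r addrC; under [fun v : R[i] => _ *: _ + _]eq_fun do rewrite scaleN1r addrC.
  by [].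
have gK z : nrm (z - w) < r / 2 -> nrm (D (z + h) - D z) <= K + K.
  move=> zr; apply: le_trans (ler_nrmB _ _) _.
  by apply: lerD; apply: DK; [exact: halfh|exact: half].
have gb z : nrm (z - w) < r / 2 -> nrm (g z) <= K * nrm h.
  move=> zr; rewrite -[nrm h](_ : nrm (z + h - z) = _); last by rewrite addrC addKr.
  apply: (@mean_value R f D) => t t01.
    apply: df; rewrite (_ : z + h - z = h); last by rewrite addrC addKr.
    rewrite addrAC; apply: le_lt_trans (ler_nrmD _ _) _.
    rewrite nrmM nrm_real; case/andP: t01 => t0 t1; rewrite ger0_norm//.
    have : t * nrm h <= nrm h by rewrite ler_piMl// nrm_ge0.
    by lra.
  apply: DK; rewrite (_ : z + h - z = h); last by rewrite addrC addKr.
  rewrite addrAC; apply: le_lt_trans (ler_nrmD _ _) _.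
  rewrite nrmM nrm_real; case/andP: t01 => t0 t1; rewrite ger0_norm//.
  have : t * nrm h <= nrm h by rewrite ler_piMl// nrm_ge0.
  by lra.
have := @derivative_le g (fun z => D (z + h) - D z) w (r / 2) (K + K) (K * nrm h + K * nrm h) r2 dg gK.
rewrite [w + h]addrC => H; apply: le_trans (H _) _.
  move=> z zr; apply: le_trans (ler_nrmB _ _) _; apply: lerD; apply: gb => //.
  by rewrite subrr nrm0.
have -> : (K * nrm h + K * nrm h) / (r / 2) = 4 * (K / r * nrm h) by field; exact: lt0r_neq0.
have -> : 8 * K / r * nrm h = 8 * (K / r * nrm h) by ring.
apply: ler_wpM2r; last by rewrite ler_nat.
by rewrite mulr_ge0 ?nrm_ge0// divr_ge0// ltW.
Qed.

(** The mean value inequality for [f z - z * D w], whose derivative [D z - D w] is of order [nrm h]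
    by [derivative_lipschitz]. *)
Lemma taylor2 f (D : R[i] -> R[i]) (w : R[i]) (r K : R) : 0 < r ->
  (forall z, nrm (z - w) < r -> cdiff f z (D z)) ->
  (forall z, nrm (z - w) < r -> nrm (D z) <= K) ->
  forall h, nrm h < r / 2 ->
    nrm (f (h + w) - f w - h * D w) <= 8 * K / r * nrm h ^+ 2.
Proof.
move=> r0 df DK h hr.
have K0 : 0 <= K by apply: le_trans (DK w _); rewrite ?nrm_ge0// subrr nrm0.
pose g (z : R[i]) := f z - z * D w.
have dg z : nrm (z - w) < r -> cdiff g z (D z - D w).
  move=> zr; have := cdiffZD (- D w) (cdiff_id z) (df z zr).
  rewrite /GRing.scale /= mulr1 addrC.
  by under [fun v : R[i] => _ * _ + _]eq_fun do rewrite mulNr addrC mulrC.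
have -> : f (h + w) - f w - h * D w = g (h + w) - g w by rewrite /g; ring.
rewrite expr2 mulrA -[X in _ <= _ * nrm X](addrK w h).
apply: (@mean_value R g (fun z => D z - D w)) => t t01; rewrite addrK.
  apply: dg; rewrite addrC addKr nrmM nrm_real; case/andP: t01 => t0 t1.
  rewrite ger0_norm//; have : t * nrm h <= nrm h by rewrite ler_piMl// nrm_ge0.
  by lra.
have th : nrm (t%:C * h) <= nrm h.
  rewrite nrmM nrm_real; case/andP: t01 => t0 t1.
  by rewrite ger0_norm// ler_piMl// nrm_ge0.
rewrite [w + _]addrC; apply: le_trans (derivative_lipschitz r0 df DK (le_lt_trans th hr)) _.
by apply: ler_wpM2l th; rewrite divr_ge0 ?mulr_ge0// ltW.
Qed.

End CauchyEstimate.

(** * Hahn-Banach *)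

Section HahnBanach.
Variables (R : realType) (E : lmodType R[i]) (p : E -> R).
Hypothesis pD : forall u v, p (u + v) <= p u + p v.
Hypothesis pZ : forall (a : R[i]) u, p (a *: u) <= nrm a * p u.

Let pZr (r : R) u : 0 <= r -> p (r%:C *: u) <= r * p u.
Proof. by move=> r0; have := pZ r%:C u; rewrite nrm_real ger0_norm. Qed.

Let p0 : p 0 <= 0.
Proof. by have := pZr 0 (lexx 0); rewrite scale0r mul0r. Qed.

(** Partial real-linear functionals as graphs, ordered by inclusion, so that unions of chains are
    again of this kind. Single-valuedness follows from the domination, applied to the difference of
    two pairs over the same vector. *)
Let dominated (G : set (E * R)) :=
  (forall (r : R) x y, G x -> G y -> G (r%:C *: x.1 + y.1, r * x.2 + y.2)) /\
  (forall x, G x -> x.2 <= p x.1).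

(** A value [c] at [u] has to lie above all [x.2 - p (x.1 - u)] and below all [p (y.1 + u) - y.2];
    subadditivity separates the two families, and the supremum of the first one is taken. *)
Let dominated_extend G u : dominated G -> G !=set0 ->
  exists c : R, dominated [set y | exists x (r : R), G x /\ y = (x.1 + r%:C *: u, x.2 + r * c)].
Proof.
move=> [GL Gp] [x0 Gx0].
pose A := [set x.2 - p (x.1 - u) | x in G].
have Gsep x y : G x -> G y -> x.2 - p (x.1 - u) <= p (y.1 + u) - y.2.
  move=> Gx Gy; rewrite lerBlDr addrAC lerBrDr.
  have := Gp _ (GL 1 _ _ Gx Gy); rewrite /= scale1r mul1r => /le_trans; apply.
  by rewrite -{1}(subrK u x.1) -addrA (addrC u) addrC.
have supA : has_sup A.
  split; first by exists (x0.2 - p (x0.1 - u)), x0.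
  by exists (p (x0.1 + u) - x0.2) => _ [x Gx <-]; exact: Gsep.
pose c := sup A.
have c1 x : G x -> x.2 - p (x.1 - u) <= c.
  by move=> Gx; apply: ub_le_sup; [exact: supA.2|exists x].
have c2 y : G y -> c <= p (y.1 + u) - y.2.
  by move=> Gy; apply: ge_sup; [exact: supA.1|move=> _ [x Gx <-]; exact: Gsep].
have G0 : G (0, 0).
  by have := GL (-1) _ _ Gx0 Gx0; rewrite rmorphN1 scaleN1r addNr mulN1r addNr.
have GZ (r : R) x : G x -> G (r%:C *: x.1, r * x.2).
  by move=> Gx; have := GL r _ _ Gx G0; rewrite !addr0.
exists c; split.
  move=> r _ _ [x [s [Gx ->]]] [y [t [Gy ->]]].
  exists (r%:C *: x.1 + y.1, r * x.2 + y.2), (r * s + t); split; first exact: GL.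
  congr pair => /=; last by ring.
  by rewrite scalerDr scalerA -rmorphM rmorphD scalerDl addrACA.
move=> _ [x [r [Gx ->]]] /=.
have [->|r0] := eqVneq r 0; first by rewrite scale0r mul0r !addr0; exact: Gp.
(* Dividing by [s = |r|] reduces the claim to the two constraints on [c], in the directions [u] and
   [- u]. *)
have [s s0 rs] : exists2 s : R, 0 < s & r = s \/ r = - s.
  exists `|r|; rewrite ?normr_gt0//; have [rp|rn] := ltrP 0 r; [left|right].
    by rewrite gtr0_norm.
  by rewrite ler0_norm ?opprK.
have [y Gy [-> ->]] : exists2 y, G y & x.1 = s%:C *: y.1 /\ x.2 = s * y.2.
  exists ((s^-1)%:C *: x.1, s^-1 * x.2); first exact: GZ.
  by rewrite /= scalerA -rmorphM divff ?gt_eqF// scale1r mulVKf// gt_eqF.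
have scale (a : R) v : a <= p v -> s * a <= p (s%:C *: v).
  move=> av; apply: le_trans (ler_wpM2l (ltW s0) av) _.
  rewrite mulrC -ler_pdivlMr// mulrC.
  have := @pZr s^-1 (s%:C *: v); rewrite scalerA -rmorphM mulVf ?gt_eqF// scale1r; apply.
  by rewrite invr_ge0 ltW.
case: rs => ->.
  suff : s * (y.2 + c) <= p (s%:C *: (y.1 + u)) by rewrite mulrDr scalerDr.
  apply: scale.
  by have := c2 y Gy; rewrite lerBrDl.
rewrite rmorphN scaleNr.
suff : s * (y.2 - c) <= p (s%:C *: (y.1 - u)) by rewrite mulrBr mulNr scalerBr.
apply: scale.
by have := c1 y Gy; lra.
Qed.

Let real_extension (G0 : set (E * R)) : dominated G0 -> G0 !=set0 ->
  exists g : E -> R, [/\ forall (r : R) u v, g (r%:C *: u + v) = r * g u + g v,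
    forall u, g u <= p u & forall x, G0 x -> g x.1 = x.2].
Proof.
move=> dG0 nG0.
(* The alternative [G = set0] accounts for the union of the empty chain; the maximal set cannot be
   empty, since [G0] is larger. *)
pose P (G : set (E * R)) := dominated G /\ (G = set0 \/ G0 `<=` G).
have [|A [[dA A0] Amax]] := @Zorn_bigcup _ P.
  move=> F FP Ftot; split; first split.
  - move=> r x y [X FX Xx] [Y FY Yy].
    have [XY|YX] := Ftot _ _ FX FY.
      by exists Y => //; have [[YL _] _] := FP _ FY; apply: YL => //; exact: XY.
    by exists X => //; have [[XL _] _] := FP _ FX; apply: XL => //; exact: YX.
  - by move=> x [X FX Xx]; have [[_ Xp] _] := FP _ FX; exact: Xp.
  have [[X [FX XG0]]|nX] := pselect (exists X, F X /\ G0 `<=` X).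
    by right => x G0x; exists X => //; exact: XG0.
  left; apply/seteqP; split=> // x [X FX Xx].
  have [_ [X0|XG0]] := FP _ FX; first by rewrite X0 in Xx.
  by exfalso; apply: nX; exists X.
have {}A0 : G0 `<=` A.
  case: A0 => // A0; exfalso; apply: (Amax G0); last by split => //; right.
  by rewrite A0; split => // G00; case: nG0 => x /G00.
have nA : A !=set0 by case: nG0 => x /A0; exists x.
have tot u : exists a, A (u, a).
  apply: contrapT => nu; have [c dB] := dominated_extend u dA nA.
  have Azero : A (0, 0).
    case: nA => x Ax.
    by have := dA.1 (-1) _ _ Ax Ax; rewrite rmorphN1 scaleN1r addNr mulN1r addNr.
  set B := (X in dominated X) in dB.
  have AB : A `<=` B.
    by move=> x Ax; exists x, 0; rewrite scale0r mul0r !addr0; split => //; case: (x).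
  apply: (Amax B); last by split => //; right; apply: subset_trans AB.
  split=> // BA; apply: nu; exists c; apply: BA; exists (0, 0), 1.
  by rewrite scale1r mul1r !add0r.
have uniqA u a b : A (u, a) -> A (u, b) -> a <= b.
  move=> Aa Ab; have := dA.2 _ (dA.1 (-1) _ _ Ab Aa).
  by rewrite rmorphN1 scaleN1r addNr mulN1r /= => /le_trans/(_ p0); rewrite addrC subr_le0.
have [g Ag] := choice tot; exists g; split.
- move=> r u v; have := dA.1 r _ _ (Ag u) (Ag v) => /= H.
  by apply/le_anti; rewrite !(uniqA _ _ _ (Ag _) H, uniqA _ _ _ H (Ag _)).
- by move=> u; exact: (dA.2 _ (Ag u)).
- move=> [u a] /A0 Aa /=.
  by apply/le_anti; rewrite !(uniqA _ _ _ (Ag _) Aa, uniqA _ _ _ Aa (Ag _)).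
Qed.

(** The subspace is the range of a linear map [iota], so that lines [a *: x] and graphs [(pi v, v)]
    can be used directly. The bound on [F] makes the functional well defined on that range. *)
Lemma hahn_banach (W : lmodType R[i]) (iota : W -> E) (F : W -> R[i]) :
  linear iota -> linear F -> (forall w, nrm (F w) <= p (iota w)) ->
  exists G : E -> R[i], [/\ linear G, forall v, nrm (G v) <= p v &
    forall w, G (iota w) = F w].
Proof.
move=> iotaL FL Fp.
pose G0 : set (E * R) := [set x | exists w, x = (iota w, complex.Re (F w))].
have dG0 : dominated G0.
  split=> [r _ _ [u ->] [v ->]|_ [w ->] /=].
    exists (r%:C *: u + v); congr pair; first by rewrite iotaL.
    by rewrite FL ReD [r%:C *: _]/(r%:C * _) Re_scale.
  by apply: le_trans (Fp w); apply: le_trans (ler_norm _) (Re_le_nrm _).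
have nG0 : G0 !=set0 by exists (iota 0, complex.Re (F 0)); exists 0.
have [g [gL gp gG0]] := real_extension dG0 nG0.
have gD u v : g (u + v) = g u + g v by have := gL 1 u v; rewrite scale1r mul1r.
have g0 : g 0 = 0 by apply: (addrI (g 0)); rewrite -gD !addr0.
have gZ r u : g (r%:C *: u) = r * g u by have := gL r u 0; rewrite g0 !addr0.
have gN u : g (- u) = - g u.
  by have := gZ (-1) u; rewrite rmorphN1 scaleN1r mulN1r.
(* The complex-linear functional with real part [g]. *)
pose G u : R[i] := g u +i* - g ('i%C *: u).
have GD u v : G (u + v) = G u + G v.
  by apply/eqP; rewrite eq_complex /= scalerDr !gD opprD !eqxx.
have GZr (r : R) u : G (r%:C *: u) = r%:C * G u.
  have sw : 'i%C *: (r%:C *: u) = r%:C *: ('i%C *: u) by rewrite !scalerA mulrC.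
  apply/eqP; rewrite eq_complex /= sw !gZ !mul0r subr0 addr0.
  by rewrite mulrN !eqxx.
have Gi u : G ('i%C *: u) = 'i%C * G u.
  apply/eqP; rewrite eq_complex /= scalerA -expr2 sqr_i scaleN1r gN !opprK.
  by rewrite !mul0r !mul1r sub0r opprK add0r !eqxx.
have GL : linear G.
  move=> a u v; rewrite GD; congr (_ + _).
  rewrite {1}(complexE a) scalerDl GD -scalerA Gi !GZr mulrA -mulrDl -complexE.
  by [].
exists G; split=> // [v|w].
  (* A phase makes [G (c *: v)] real, hence equal to [g (c *: v)], so the bound on the real part
     bounds the modulus. *)
  have [c c1 cE] := phase (G v).
  have GZ : G (c *: v) = c * G v.
    by have := GL c v 0; rewrite (_ : G 0 = 0) ?addr0// /G scaler0 g0 oppr0.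
  have -> : nrm (G v) = g (c *: v).
    by rewrite -[LHS]Re_real -cE -GZ.
  by apply: le_trans (gp _) _; apply: le_trans (pZ _ _) _; rewrite c1 mul1r.
have iotaZ a : iota (a *: w) = a *: iota w.
  have iota0 : iota 0 = 0.
    by have := iotaL (-1) 0 0; rewrite scaler0 addr0 scaleN1r addNr.
  by have := iotaL a w 0; rewrite iota0 !addr0.
have FZ a : F (a *: w) = a * F w.
  have F0 : F 0 = 0.
    by have := FL (-1) 0 0; rewrite scaler0 addr0 scaleN1r addNr.
  by have := FL a w 0; rewrite F0 !addr0.
have gi v : g (iota v) = complex.Re (F v) by rewrite (gG0 (iota v, complex.Re (F v)))//; exists v.
apply/eqP; rewrite eq_complex /= -iotaZ !gi FZ eqxx /=; apply/eqP.
by case: (F w) => a b /=; ring.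
Qed.

End HahnBanach.

(** * Norms of functionals and norming functionals *)

Section DualTheory.
Variables (R : realType) (V : normedModType R[i]).
Implicit Types (L : dual V) (x y : V).

Lemma dual_linear L : linear L.
Proof. by have /dual_predP[] := valP L. Qed.

HB.instance Definition _ L :=
  GRing.isLinear.Build R[i] V R[i] *:%R (L : V -> R[i]) (dual_linear L).

Lemma dualZ L (a : R[i]) x : L (a *: x) = a * L x.
Proof. by rewrite linearZ. Qed.

Lemma mk_dual (f : V -> R[i]) (M : R) : linear f -> (forall x, nrm (f x) <= M * nrm x) ->
  exists L : dual V, forall x, L x = f x.
Proof.
move=> fL fM; have fP : f \in @dual_pred R V by apply/dual_predP; split=> //; exists M.
by exists (Dual fP).
Qed.

Lemma nrm_dual_le L (M : R) : (forall x, nrm x <= 1 -> nrm (L x) <= M) -> nrm L <= M.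
Proof.
move=> LM; rewrite [nrm L]/(dual_norm L); apply: sup_image_le => //.
by exists 0; rewrite /= nrm0.
Qed.

Lemma dual_bounded L : exists2 M : R, 0 <= M & forall x, nrm (L x) <= M * nrm x.
Proof.
have /dual_predP[_ [M bL]] := valP L; exists `|M| => // x.
by apply: le_trans (bL x) _; rewrite ler_wpM2r ?nrm_ge0 ?ler_norm.
Qed.

Lemma le_nrm_dual L x : nrm (L x) <= nrm L * nrm x.
Proof.
have [->|x0] := eqVneq x 0; first by rewrite linear0 !nrm0 mulr0.
have nx : 0 < nrm x by rewrite nrm_gt0.
rewrite -ler_pdivrMr//; have [M M0 bL] := dual_bounded L.
have -> : nrm (L x) / nrm x = nrm (L ((nrm x)^-1%:C *: x)).
  by rewrite dualZ nrmM nrm_real ger0_norm ?invr_ge0 ?nrm_ge0// mulrC.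
rewrite [nrm L]/(dual_norm L); apply: (@le_sup_image _ _ _ (fun x => nrm (L x))).
  exists M => _ [y /= y1 <-]; apply: le_trans (bL y) _.
  by rewrite ler_piMr.
by rewrite /= nrmZ nrm_real ger0_norm ?invr_ge0 ?nrm_ge0// mulVf// gt_eqF.
Qed.

Lemma nrm_dual_approx L (e : R) : 0 < e ->
  exists2 x, nrm x <= 1 & nrm L - e < nrm (L x).
Proof.
move=> e0; apply: contrapT => H.
have : nrm L <= nrm L - e.
  apply: nrm_dual_le => x x1; rewrite leNgt; apply/negP => lt; apply: H.
  by exists x.
by rewrite lerBrDr gerDl leNgt e0.
Qed.

Lemma norming x : exists2 L : dual V, (forall y, nrm (L y) <= nrm y) & L x = (nrm x)%:C.
Proof.
have [|||||G [GL Gn Gx]] := @hahn_banach R V (@nrm R V) _ _ R[i]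
  (fun a => a *: x) (fun a => a * (nrm x)%:C).
- exact: ler_nrmD.
- by move=> a u; rewrite nrmZ.
- by move=> a u v; rewrite scalerDl scalerA.
- by move=> a u v; rewrite mulrDl [in RHS]/GRing.scale /= mulrA.
- by move=> a; rewrite nrmM nrm_real nrmZ ger0_norm// nrm_ge0.
have Gn1 y : nrm (G y) <= 1 * nrm y by rewrite mul1r.
have [L LG] := mk_dual GL Gn1.
exists L => [y|]; first by rewrite LG.
by rewrite LG -[x]scale1r Gx mul1r scale1r.
Qed.

Lemma weakly_cvgP (u : nat -> V) (l : V) : weakly_cvg_to u l <->
  forall L (e : R), 0 < e -> \forall n \near \oo, nrm (L (u n) - L l) < e.
Proof.
by split=> H L; [have /cvg_nrmP := H L|apply/cvg_nrmP; exact: H].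
Qed.

End DualTheory.

(** * Subsequences and limits *)

Section Subsequences.

Definition increasing (s : nat -> nat) := {homo s : m n / (m < n)%N}.

Lemma increasing_step (s : nat -> nat) : (forall n, s n < s n.+1)%N -> increasing s.
Proof. by move=> H; apply: homo_ltn => //; exact: ltn_trans. Qed.

Lemma increasing_ge s n : increasing s -> (n <= s n)%N.
Proof.
by move=> si; elim: n => // n ih; apply: leq_ltn_trans ih (si _ _ (ltnSn n)).
Qed.

Lemma increasing_comp s t : increasing s -> increasing t -> increasing (s \o t).
Proof. by move=> si ti m n mn; apply: si; exact: ti. Qed.

Lemma near_increasing (P : nat -> Prop) s : increasing s ->
  (\forall n \near \oo, P n) -> \forall n \near \oo, P (s n).
Proof.
move=> si [N _ PN]; exists N => // n /= Nn; apply: PN => /=.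
by apply: leq_trans (increasing_ge n si).
Qed.

Lemma not_near_subseq (P : nat -> Prop) : ~ (\forall n \near \oo, P n) ->
  exists2 s, increasing s & forall n, ~ P (s n).
Proof.
move=> nP.
have H N : exists n, (N < n)%N /\ ~ P n.
  apply: contrapT => nH; apply: nP; exists N.+1 => // n /= Nn.
  by apply: contrapT => nPn; apply: nH; exists n.
have [f Hf] := choice H.
exists (fun n => iter n f (f 0%N)).
  by apply: increasing_step => n /=; exact: (Hf _).1.
by case=> [|n] /=; exact: (Hf _).2.
Qed.

(** The diagonal is a subsequence of the [j]-th refinement only from some index on. The second
    hypothesis therefore asks [P j] to pass to any [t] that becomes a subsequence of [s] after
    dropping [N] terms. *)
Lemma diagonal_subsequence (P : nat -> (nat -> nat) -> Prop) :
  (forall j s, increasing s -> exists2 t, increasing t & P j (s \o t)) ->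
  (forall j s t r N, increasing r -> (forall n, t (N + n)%N = s (r n)) ->
    P j s -> P j t) ->
  exists2 s, increasing s & forall j, P j s.
Proof.
move=> Psub Pinh.
have H (x : nat * {s | increasing s}) : exists t, increasing t /\ P x.1 (sval x.2 \o t).
  by case: x => j [s si] /=; have [t ti Pt] := Psub j s si; exists t.
have [f Hf] := choice H.
have id_incr : increasing id by [].
pose next (x : nat * {s | increasing s}) : nat * {s | increasing s} :=
  (x.1.+1, exist _ (sval x.2 \o f x) (increasing_comp (svalP x.2) (Hf x).1)).
pose X n := iter n next (0%N, exist _ id id_incr).
have X1 n : (X n).1 = n by elim: n => //= n ->.
pose S n := sval (X n).2; pose t n := f (X n).
have SS n : S n.+1 = S n \o t n by [].
have ti n : increasing (t n) := (Hf _).1.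
have PS n : P n (S n.+1) by have := (Hf (X n)).2; rewrite X1.
(* [tau j m] composes the [m] refinements made after stage [j], so that [S (j + m)] is [S j]
   reindexed by it. *)
pose tau j := fix tau m := if m is m'.+1 then tau m' \o t (j + m')%N else id.
have tauS j m : tau j m.+1 = tau j m \o t (j + m)%N by [].
have Stau j m : S (j + m)%N = S j \o tau j m.
  by elim: m => [|m ih]; rewrite ?addn0// addnS SS ih tauS.
have taui j m : increasing (tau j m).
  by elim: m => [//|m ih]; rewrite tauS; exact: increasing_comp ih (ti _).
exists (fun n => S n.+1 n) => [|j].
  apply: increasing_step => n; rewrite (SS n.+1) /=; apply: (svalP (X n.+1).2).
  exact: increasing_ge.
apply: (Pinh j (S j.+1) _ (fun m => tau j.+1 m (j + m)%N) j) => //.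
  apply: increasing_step => m; rewrite tauS /=; apply: taui.
  by rewrite addnS; apply: leq_trans (increasing_ge _ (ti _)).
by move=> n; rewrite -addSn Stau.
Qed.

Lemma history_choice (T : Type) (C : seq T -> T -> Prop) :
  (forall l, exists x, C l x) -> exists s : nat -> T, forall J, C (mkseq s J) (s J).
Proof.
move=> H; have [f Hf] := choice H.
pose L := fix L k := if k is k'.+1 then rcons (L k') (f (L k')) else [::].
pose s k := f (L k).
have LE k : L k = mkseq s k.
  by elim: k => // k ih; rewrite /= {1}ih /mkseq -addn1 iotaD map_cat /= cats1.
by exists s => J; rewrite -LE; exact: Hf.
Qed.

(** Conditions that hold eventually can be met one index at a time, each condition depending on all
    indices chosen before; this drives the gliding hump. *)
Lemma selection (C : seq nat -> nat -> Prop) :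
  (forall l, \forall n \near \oo, C l n) ->
  exists2 s, increasing s & forall J, C (mkseq s J) (s J).
Proof.
move=> H.
have H1 l : exists n, C l n /\ all (fun m => m < n)%N l.
  have [N _ HN] := H l.
  exists (maxn N (\max_(m <- l) m).+1); split; first by apply: HN; rewrite /= leq_maxl.
  apply/allP => m ml; apply: leq_trans (leq_maxr _ _); rewrite ltnS.
  by rewrite (big_rem m)//= leq_maxl.
have [s Hs] := history_choice H1.
exists s => [|J]; last exact: (Hs J).1.
apply: increasing_step => n.
have /allP := (Hs n.+1).2; apply.
by apply/mapP; exists n => //; rewrite mem_iota /= add0n.
Qed.

End Subsequences.

Section BolzanoWeierstrass.
Variable R : realType.

Let bw (v : nat -> R) (M : R) : (forall n, `|v n| <= M) ->
  exists s, increasing s /\ exists l, forall e, 0 < e -> \forall n \near \oo, `|v (s n) - l| < e.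
Proof.
move=> vM; have [|s si] := @bolzano_weierstrass R v.
  by exists M; split; [exact: num_real|move=> x Mx n _; apply: le_trans (vM n) (ltW Mx)].
move=> /cvg_ex[l sl]; exists s; split.
  move=> m n mn; have := si n m; rewrite !leEnat => H.
  by rewrite ltnNge H -ltnNge.
exists l => e e0; have /cvgrPdist_lt/(_ e e0) := sl.
by apply: filterS => n /=; rewrite distrC.
Qed.

Lemma bounded_subseq_cvg (u : nat -> R[i]) (M : R) : (forall n, nrm (u n) <= M) ->
  exists2 s, increasing s & exists l, forall e, 0 < e ->
    \forall n \near \oo, nrm (u (s n) - l) < e.
Proof.
move=> uM.
have [|s [si [a sa]]] := @bw (fun n => complex.Re (u n)) M.
  by move=> n; apply: le_trans (Re_le_nrm _) (uM n).
have [|t [ti [b tb]]] := @bw (fun n => complex.Im (u (s n))) M.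
  by move=> n; apply: le_trans (Im_le_nrm _) (uM _).
exists (s \o t); first exact: increasing_comp.
exists (a +i* b) => e e0; have e2 : 0 < e / 2 by rewrite divr_gt0.
near=> n; apply: le_lt_trans (nrm_le_ReIm _) _; rewrite ReB ImB /= (splitr e) ltrD//.
  by near: n; exact: (near_increasing ti (sa _ e2)).
by near: n; exact: tb.
Unshelve. all: by end_near. Qed.

End BolzanoWeierstrass.

Section Limits.
Variable R : realType.
Implicit Types V : normedModType R[i].

(** Norm convergence by [cvg_nrmP], with tolerances in [R] instead of [R[i]]. *)
Definition tends V (u : nat -> V) (l : V) :=
  forall e : R, 0 < e -> \forall n \near \oo, nrm (u n - l) < e.

Lemma tends_unique V (u : nat -> V) (l m : V) : tends u l -> tends u m -> l = m.
Proof.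
move=> ul um; apply/subr0_eq/nrm_eq0/le_anti; rewrite nrm_ge0 andbT.
apply/ler_addgt0Pr => e e0; rewrite add0r.
have e2 : 0 < e / 2 by rewrite divr_gt0.
near \oo => n.
have h1 : nrm (u n - l) < e / 2 by near: n; exact: ul.
have h2 : nrm (u n - m) < e / 2 by near: n; exact: um.
have -> : l - m = (u n - m) - (u n - l) by rewrite opprB [RHS]addrC addrA subrK.
by apply: le_trans (ler_nrmB _ _) _; lra.
Unshelve. all: by end_near. Qed.

Lemma tends_cst V (l : V) : tends (fun=> l) l.
Proof. by move=> e e0; near=> n; rewrite subrr nrm0. Unshelve. all: by end_near. Qed.

Lemma tends_lin V (a : R[i]) (u v : nat -> V) (l m : V) : tends u l -> tends v m ->
  tends (fun n => a *: u n + v n) (a *: l + m).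
Proof.
move=> ul vm e e0; have e2 : 0 < e / 2 by rewrite divr_gt0.
have a1 : 0 < nrm a + 1 by rewrite ltr_wpDl// nrm_ge0.
near=> n; rewrite opprD addrACA -scalerBr (splitr e).
apply: le_lt_trans (ler_nrmD _ _) _; apply: ltrD; last by near: n; exact: vm.
rewrite nrmZ; apply: (@le_lt_trans _ _ ((nrm a + 1) * nrm (u n - l))).
  by rewrite ler_wpM2r ?nrm_ge0// lerDl.
rewrite mulrC -ltr_pdivlMr//; near: n; apply: ul.
by rewrite divr_gt0.
Unshelve. all: by end_near. Qed.

Lemma tends_subseq V (u : nat -> V) (l : V) s : increasing s ->
  tends u l -> tends (u \o s) l.
Proof. by move=> si ul e e0; exact: near_increasing si (ul e e0). Qed.

Lemma tends_le V (u : nat -> V) (l : V) (M : R) : tends u l ->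
  (\forall n \near \oo, nrm (u n) <= M) -> nrm l <= M.
Proof.
move=> ul uM; apply/ler_addgt0Pr => e e0; near \oo => n.
apply: le_trans (ler_nrm_dist l (u n)) _; apply: lerD; first by near: n; exact: uM.
by rewrite nrm_distC; apply: ltW; near: n; exact: ul.
Unshelve. all: by end_near. Qed.

Lemma tends_tail V (u v : nat -> V) (l : V) r N : increasing r ->
  (forall n, v (N + n)%N = u (r n)) -> tends u l -> tends v l.
Proof.
move=> ri vE ul e e0; have [K _ HK] := near_increasing ri (ul e e0).
exists (N + K)%N => // n /= Kn.
have -> : n = (N + (n - N))%N by rewrite subnKC// (leq_trans _ Kn)// leq_addr.
by rewrite vE; apply: HK; rewrite /= leq_subRL// (leq_trans _ Kn)// leq_addr.
Qed.

Definition cauchy_seq V (u : nat -> V) := forall e : R, 0 < e ->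
  exists N, forall m n, (N <= m)%N -> (N <= n)%N -> nrm (u m - u n) < e.

Lemma tends_cauchy V (u : nat -> V) l : tends u l -> cauchy_seq u.
Proof.
move=> ul e e0; have e2 : 0 < e / 2 by rewrite divr_gt0.
have [N _ HN] := ul _ e2; exists N => m n Nm Nn.
have -> : u m - u n = (u m - l) - (u n - l) by rewrite opprB addrA subrK.
apply: le_lt_trans (ler_nrmB _ _) _.
by rewrite (splitr e) ltrD//; exact: HN.
Qed.

Lemma complex_complete (u : nat -> R[i]) : cauchy_seq u -> exists l, tends u l.
Proof.
move=> cu; have [N1 H1] := cu 1 ltr01.
pose M := \sum_(i < N1) nrm (u i) + nrm (u N1) + 1.
have uM n : nrm (u n) <= M.
  have S0 : 0 <= \sum_(i < N1) nrm (u i) by apply: sumr_ge0 => i _; exact: nrm_ge0.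
  rewrite /M; have [nN|Nn] := ltnP n N1.
    rewrite -addrA (bigD1 (Ordinal nN))//= -addrA lerDl addr_ge0 ?addr_ge0 ?nrm_ge0//.
    by apply: sumr_ge0 => i _; exact: nrm_ge0.
  apply: le_trans (ler_nrm_dist _ (u N1)) _.
  by have := H1 _ _ Nn (leqnn N1); lra.
have [s si [l sl]] := bounded_subseq_cvg uM.
exists l => e e0; have e2 : 0 < e / 2 by rewrite divr_gt0.
have [N HN] := cu _ e2; have [K _ HK] := sl _ e2.
exists N => // n /= Nn.
have -> : u n - l = (u n - u (s (maxn N K))) + (u (s (maxn N K)) - l) by rewrite addrA subrK.
apply: le_lt_trans (ler_nrmD _ _) _; rewrite (splitr e) ltrD//.
  by apply: HN => //; apply: leq_trans (increasing_ge _ si); rewrite leq_maxl.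
by apply: HK; rewrite /= leq_maxr.
Qed.

Lemma weakly_cvg_tends V (u : nat -> V) (l : V) :
  weakly_cvg_to u l <-> forall L : dual V, tends (fun n => L (u n) : R[i]) (L l).
Proof. exact: weakly_cvgP. Qed.

End Limits.

(** * Closures of subspaces and splitting of dominated functionals *)

Section HahnBanachCorollaries.
Variable R : realType.

(** The distance [p] to [Y] is a seminorm vanishing on [Y]. A functional dominated by [p] with value
    [p x] at [x] annihilates [Y], so [p x = 0]. *)
Lemma annihilator_closure (V : normedModType R[i]) (Y : set V) (x : V) :
  Y 0 -> (forall (a : R[i]) u w, Y u -> Y w -> Y (a *: u + w)) ->
  (forall L : dual V, (forall w, Y w -> L w = 0) -> L x = 0) ->
  forall e, 0 < e -> exists2 w, Y w & nrm (x - w) < e.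
Proof.
move=> Y0 YL Yx.
pose S u := [set nrm (u - w) | w in Y].
have S0 u : S u !=set0 by exists (nrm (u - 0)), 0.
have Slb u : has_lbound (S u) by exists 0 => _ [w _ <-]; exact: nrm_ge0.
pose p u := inf (S u).
have pS u w : Y w -> p u <= nrm (u - w) by move=> Yw; apply: ge_inf => //; exists w.
have padh u e : 0 < e -> exists2 w, Y w & nrm (u - w) < p u + e.
  by move=> e0; have [|_ [w Yw <-] H] := @inf_adherent R (S u) e e0; [split|exists w].
have p0 u : 0 <= p u by apply: lb_le_inf => // _ [w _ <-]; exact: nrm_ge0.
have pn u : p u <= nrm u by have := pS u 0 Y0; rewrite subr0.
have pD u w : p (u + w) <= p u + p w.
  apply/ler_addgt0Pr => e e0; have e2 : 0 < e / 2 by rewrite divr_gt0.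
  have [u' Yu hu] := padh u _ e2; have [w' Yw hw] := padh w _ e2.
  have Yuw : Y (u' + w') by rewrite -[u']scale1r; exact: YL.
  apply: le_trans (pS _ _ Yuw) _; rewrite opprD addrACA.
  by apply: le_trans (ler_nrmD _ _) _; lra.
have pZ (a : R[i]) u : p (a *: u) <= nrm a * p u.
  apply/ler_addgt0Pr => e e0.
  have a1 : 0 < nrm a + 1 by rewrite ltr_wpDl// nrm_ge0.
  have [w Yw hw] := padh u _ (divr_gt0 e0 a1).
  have Yaw : Y (a *: w) by rewrite -[_ *: _]addr0; exact: YL.
  apply: le_trans (pS _ _ Yaw) _; rewrite -scalerBr nrmZ.
  apply: le_trans (ler_wpM2l (nrm_ge0 _) (ltW hw)) _; rewrite mulrDr lerD2l.
  rewrite mulrCA ger_pMr// ler_pdivrMr// mul1r lerDl//.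
have [|||G [GL Gp Gx]] := @hahn_banach R V p pD pZ R[i]
  (fun a => a *: x) (fun a => a * (p x)%:C).
- by move=> a u w; rewrite scalerDl scalerA.
- by move=> a u w; rewrite mulrDl [in RHS]/GRing.scale /= mulrA.
- move=> a; rewrite nrmM nrm_real ger0_norm//.
  have [->|a0] := eqVneq a 0; first by rewrite nrm0 mul0r.
  have na : 0 < nrm a by rewrite nrm_gt0.
  rewrite mulrC -ler_pdivlMr// mulrC -nrmV -{1}[x](scalerK a0).
  exact: pZ.
move=> e e0.
have Gn y : nrm (G y) <= 1 * nrm y by rewrite mul1r; apply: le_trans (Gp _) (pn _).
have [L LG] := mk_dual GL Gn.
have Lx : L x = 0.
  apply: Yx => w Yw; apply/nrm_eq0/le_anti; rewrite nrm_ge0 andbT LG.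
  by apply: le_trans (Gp _) _; have := pS w _ Yw; rewrite subrr nrm0.
have px : p x = 0.
  by have := Gx 1; rewrite scale1r mul1r -LG Lx => /complexI.
by have [w Yw hw] := padh x e e0; exists w => //; rewrite px add0r in hw.
Qed.

Lemma mazur (V : normedModType R[i]) (Y : set V) (v : nat -> V) (x : V) :
  Y 0 -> (forall (a : R[i]) u w, Y u -> Y w -> Y (a *: u + w)) ->
  (forall n, Y (v n)) -> weakly_cvg_to v x ->
  forall e, 0 < e -> exists2 w, Y w & nrm (x - w) < e.
Proof.
move=> Y0 YL Yv /weakly_cvgP vx; apply: annihilator_closure => // L LY.
apply/nrm_eq0/le_anti; rewrite nrm_ge0 andbT; apply/ler_addgt0Pr => e e0.
have [N _ /(_ N (leqnn N))] := vx L e e0.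
by rewrite /= LY// sub0r nrmN add0r => /ltW.
Qed.

(** Transported to the graph of [pi m] in [X * V], the functional [F] is dominated by a seminorm of
    the product. An extension to the product restricts on [X] to the functional with index [m], and
    on [V] to a functional bounded with one term less: induction on [m]. *)
Lemma split_dominated (V : lmodType R[i]) (X : normedModType R[i]) (m : nat)
    (pi : nat -> V -> X) (F : V -> R[i]) (C : R) (q : V -> R) :
  (forall i, linear (pi i)) -> linear F -> 0 <= C ->
  (forall u v, q (u + v) <= q u + q v) ->
  (forall (a : R[i]) u, q (a *: u) <= nrm a * q u) ->
  (forall v, nrm (F v) <= C * (\sum_(i < m) nrm (pi i v)) + q v) ->
  exists (L : nat -> dual X) (F2 : V -> R[i]),
    (forall v, F v = \sum_(i < m) L i (pi i v) + F2 v) /\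
    (forall v, nrm (F2 v) <= q v).
Proof.
move=> piL + C0 qD qZ.
elim: m F => [|m ih] F FL Fb.
  exists (fun=> 0), F; split=> v; first by rewrite big_ord0 add0r.
  by have := Fb v; rewrite big_ord0 mulr0 add0r.
pose q' v := C * (\sum_(i < m) nrm (pi i v)) + q v.
pose P (y : X * V) := C * nrm y.1 + q' y.2.
have PD u v : P (u + v) <= P u + P v.
  rewrite /P /q' /=; have := qD u.2 v.2; have := ler_wpM2l C0 (ler_nrmD u.1 v.1).
  have : C * (\sum_(i < m) nrm (pi i (u.2 + v.2))) <=
     C * (\sum_(i < m) nrm (pi i u.2)) + C * (\sum_(i < m) nrm (pi i v.2)).
    rewrite -mulrDr; apply: ler_wpM2l => //; rewrite -big_split /=.
    apply: ler_sum => i _; have := piL i 1 u.2 v.2; rewrite !scale1r => ->.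
    exact: ler_nrmD.
  by lra.
have PZ (a : R[i]) u : P (a *: u) <= nrm a * P u.
  rewrite /P /q' /= !mulrDr nrmZ; apply: lerD; first by rewrite mulrCA.
  apply: lerD; last exact: qZ.
  rewrite mulrCA ler_wpM2l// mulr_sumr; apply: ler_sum => i _.
  have pi0 : pi i 0 = 0 by have := piL i (-1) 0 0; rewrite scaler0 addr0 scaleN1r addNr.
  by have := piL i a u.2 0; rewrite pi0 !addr0 => ->; rewrite nrmZ.
have [|w|G [GL Gp GF]] := @hahn_banach R (X * V)%type P PD PZ V
  (fun v => (pi m v, v)) F _ FL.
- by move=> a u v; rewrite piL.
- by apply: le_trans (Fb w) _; rewrite /P /q' /= big_ord_recr /= mulrDr; lra.
have G0 : G 0 = 0 by have := GL (-1) 0 0; rewrite scaler0 addr0 scaleN1r addNr.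
have q0 : q' 0 = 0.
  have qq : q 0 = 0.
    apply/le_anti/andP; split; first by have := qZ 0 0; rewrite scaler0 nrm0 mul0r.
    by have := qD 0 0; rewrite addr0; lra.
  rewrite /q' qq addr0 big1 ?mulr0// => i _.
  have -> : pi i 0 = 0 by have := piL i (-1) 0 0; rewrite scaler0 addr0 scaleN1r addNr.
  exact: nrm0.
have [||Lm LmE] := @mk_dual R X (fun x => G (x, 0)) C.
- move=> a x y; have := GL a (x, 0) (y, 0).
  by rewrite (_ : a *: (x, 0) + (y, 0) = (a *: x + y, 0))//; congr pair; rewrite /= scaler0 addr0.
- by move=> x; apply: le_trans (Gp _) _; rewrite /P /= q0 addr0.
have [||L [F2 [FE F2q]]] := ih (fun v => G (0, v)).
- move=> a x y; have := GL a (0, x) (0, y).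
  by rewrite (_ : a *: (0, x) + (0, y) = (0, a *: x + y))//; congr pair; rewrite /= scaler0 addr0.
- by move=> v; apply: le_trans (Gp _) _; rewrite /P /= nrm0 mulr0 add0r.
exists (fun i => if i == m then Lm else L i), F2; split=> // v.
rewrite big_ord_recr /= eqxx -GF.
have -> : (pi m v, v) = 1 *: (pi m v, 0) + (0, v).
  by rewrite scale1r; congr pair; rewrite /= ?addr0 ?add0r.
rewrite GL scale1r LmE FE addrCA addrA; congr (_ + _ + _).
by apply: eq_bigr => i _; rewrite ltn_eqF.
Qed.

End HahnBanachCorollaries.

(** * Reflexivity by sequences *)

Section Bidual.
Variable R : realType.
Implicit Types V : normedModType R[i].

Lemma dual_ext V (L K : dual V) : (forall x, L x = K x) -> L = K.
Proof. by move=> LK; apply: val_inj; apply/funext. Qed.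

Lemma dual0 V (L : dual V) : L 0 = 0. Proof. exact: linear0. Qed.

Lemma dualD V (L : dual V) x y : L (x + y) = L x + L y. Proof. exact: linearD. Qed.

Lemma dualB V (L : dual V) x y : L (x - y) = L x - L y. Proof. exact: linearB. Qed.

Lemma dual_sum V (L : dual V) (I : Type) (r : seq I) (P : pred I) (F : I -> V) :
  L (\sum_(i <- r | P i) F i) = \sum_(i <- r | P i) L (F i).
Proof. exact: linear_sum. Qed.

Lemma near_invn (e : R) : 0 < e -> \forall n \near \oo, n.+1%:R^-1 < e.
Proof.
move=> e0; near=> n; rewrite invf_plt ?posrE//.
apply: lt_trans (_ : n%:R < _); last by rewrite ltr_nat.
by near: n; exact: nbhs_infty_gtr.
Unshelve. all: by end_near. Qed.

Lemma dual_sumE V (n : nat) (b : nat -> R[i]) (phi : nat -> dual V) x :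
  (\sum_(i < n) b i *: phi i : dual V) x = \sum_(i < n) b i * phi i x.
Proof. by elim: n => [|n ih]; rewrite ?big_ord0// !big_ord_recr /= -ih. Qed.

Lemma evaluation V : exists ev : V -> dual (dual V), forall x L, ev x L = L x.
Proof.
have H x : exists E : dual (dual V), forall L : dual V, E L = L x.
  apply: (@mk_dual R (dual V) (fun L => L x) (nrm x)) => [a L K //|L].
  by rewrite mulrC; exact: le_nrm_dual.
by have [ev evE] := choice H; exists ev.
Qed.

Lemma sqr_nrm (z : R[i]) : nrm z ^+ 2 = complex.Re z ^+ 2 + complex.Im z ^+ 2.
Proof. by rewrite nrmC sqr_sqrtr// addr_ge0 ?sqr_ge0. Qed.

Lemma sqr_nrmB (z c : R[i]) :
  nrm (z - c) ^+ 2 = nrm z ^+ 2 - complex.Re ((z^*)%C * c) *+ 2 + nrm c ^+ 2.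
Proof. by rewrite !sqr_nrm; case: z => a b; case: c => a' b' /=; ring. Qed.

(* A near-minimiser [v] over the ball of radius [M] of the distance from [a] to
   [phi v] in the Euclidean norm of C^n: the first-order condition together with
   the hypothesis on linear combinations bounds the distance. *)
Lemma goldstine V (n : nat) (phi : nat -> dual V) (a : nat -> R[i]) (M : R) :
  0 <= M ->
  (forall b : nat -> R[i],
    nrm (\sum_(i < n) b i * a i) <= M * nrm (\sum_(i < n) b i *: phi i : dual V)) ->
  forall e, 0 < e -> exists2 v, nrm v <= M &
    forall i, (i < n)%N -> nrm (phi i v - a i) < e.
Proof.
move=> M0 Hb e e0.
pose Q v := \sum_(i < n) nrm (a i - phi i v) ^+ 2.
have Q0 v : 0 <= Q v by apply: sumr_ge0 => i _; rewrite exprn_ge0// nrm_ge0.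
suff [v vM Qv] : exists2 v, nrm v <= M & Q v < e ^+ 2.
  exists v => // i ni; rewrite nrm_distC -(ltr_pXn2r (_ : (0 < 2)%N)) ?nnegrE ?nrm_ge0 ?ltW//.
  apply: le_lt_trans Qv; rewrite /Q (bigD1 (Ordinal ni))//= lerDl.
  by apply: sumr_ge0 => j _; rewrite exprn_ge0// nrm_ge0.
apply: contrapT => nQ.
have eQ v : nrm v <= M -> e ^+ 2 <= Q v.
  by move=> vM; rewrite leNgt; apply/negP => Qv; apply: nQ; exists v.
pose B := \sum_(i < n) (nrm (phi i) * (M + M)) ^+ 2.
have B0 : 0 <= B by apply: sumr_ge0 => i _; rewrite sqr_ge0.
have e20 : 0 < e ^+ 2 by rewrite exprn_gt0.
have D0 : 0 < 1 + B + M by lra.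
(* The first-order condition will give [Q v <= t * (1 + B + M)], which for this [t] is below
   [e ^+ 2]. *)
pose t := Num.min 1 (e ^+ 2 / (2 * (1 + B + M))).
have t0 : 0 < t by rewrite lt_min ltr01 divr_gt0// mulr_gt0.
have t1 : t <= 1 by rewrite ge_min lexx.
have tS : t * (1 + B + M) < e ^+ 2.
  have : t <= e ^+ 2 / (2 * (1 + B + M)) by rewrite ge_min lexx orbT.
  rewrite ler_pdivlMr ?mulr_gt0// => H.
  by move: H e20; rewrite mulrCA; lra.
pose S := [set Q v | v in [set v | nrm v <= M]].
have Sn : S !=set0 by exists (Q 0), 0 => //=; rewrite nrm0.
have Slb : has_lbound S by exists 0 => _ [v _ <-].
(* With slack [t ^+ 2] in the minimum, dividing the inequality for a step of length [t] by [t]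
   leaves an error of order [t]. *)
have [|_ [v /= vM <-] Qv] := @inf_adherent R S (t ^+ 2) _ (conj Sn Slb).
  by rewrite exprn_gt0.
pose r i := a i - phi i v.
(* Up to the factor -2, the real part of [psi] is the derivative of [Q] at [v]; the vector [w] below
   nearly maximises it over the ball. *)
pose psi : dual V := \sum_(i < n) (r i)^*%C *: phi i.
have [x x1 psix] := nrm_dual_approx psi t0.
have [c c1 cE] := phase (psi x).
pose w := (M%:C * c) *: x.
have wM : nrm w <= M.
  by rewrite nrmZ nrmM c1 mulr1 nrm_real ger0_norm// ler_piMr.
have psiw : complex.Re (psi w) = M * nrm (psi x).
  by rewrite /w dualZ -mulrA cE Re_scale Re_real.
pose k i := phi i (w - v).
have QE : Q (v + t%:C *: (w - v)) =
    Q v - t * (complex.Re (\sum_(i < n) (r i)^*%C * k i) *+ 2) + t ^+ 2 * \sum_(i < n) nrm (k i) ^+ 2.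
  rewrite (_ : complex.Re _ = \sum_(i < n) complex.Re ((r i)^*%C * k i)); last first.
    by apply: (big_morph (fun z : R[i] => complex.Re z)) => // z z'; rewrite ReD.
  rewrite -sumrMnl !mulr_sumr -sumrB -big_split /=; apply: eq_bigr => i _.
  rewrite dualD dualZ opprD addrA -/(r i) -/(k i) sqr_nrmB nrmM nrm_real.
  rewrite exprMn real_normK ?num_real// mulrCA Re_scale.
  by rewrite -mulrnAr.
have inball : nrm (v + t%:C *: (w - v)) <= M.
  have -> : v + t%:C *: (w - v) = (1 - t)%:C *: v + t%:C *: w.
    by rewrite scalerBr rmorphB scalerBl scale1r addrCA addrC.
  apply: le_trans (ler_nrmD _ _) _; rewrite (nrmZ _ v) (nrmZ _ w) !nrm_real.
  rewrite !ger0_norm ?subr_ge0// ?(ltW t0)//.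
  apply: (@le_trans _ _ ((1 - t) * M + t * M)); last by lra.
  by apply: lerD; apply: ler_wpM2l => //; rewrite ?subr_ge0// ltW.
have Qlb : inf S <= Q (v + t%:C *: (w - v)).
  by apply: ge_inf => //; exists (v + t%:C *: (w - v)).
have kB : \sum_(i < n) nrm (k i) ^+ 2 <= B.
  apply: ler_sum => i _; rewrite ler_pXn2r ?nnegrE ?mulr_ge0 ?nrm_ge0 ?addr_ge0//.
  apply: le_trans (le_nrm_dual _ _) _; rewrite ler_wpM2l ?nrm_ge0//.
  by apply: le_trans (ler_nrmB _ _) _; rewrite lerD.
have SE : complex.Re (\sum_(i < n) (r i)^*%C * k i) =
    complex.Re (psi w) - complex.Re (\sum_(i < n) (r i)^*%C * a i) + Q v.
  have QvE : Q v = complex.Re (\sum_(i < n) (r i)^*%C * r i).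
    rewrite (big_morph (fun z : R[i] => complex.Re z) (id1 := 0) (op1 := +%R))//; last exact: ReD.
    by apply: eq_bigr => i _; rewrite mulrC mul_conjc.
  have psiE : psi w = \sum_(i < n) (r i)^*%C * phi i w.
    exact: (dual_sumE n (fun i => (r i)^*%C) phi w).
  rewrite psiE QvE -ReB -ReD; congr complex.Re.
  rewrite -sumrB -big_split /=; apply: eq_bigr => i _.
  by rewrite /k dualB /r; ring.
have aM : complex.Re (\sum_(i < n) (r i)^*%C * a i) <= M * nrm psi.
  apply: le_trans (ler_norm _) _; apply: le_trans (Re_le_nrm _) _.
  exact: (Hb (fun i => (r i)^*%C)).
have Mpsi : M * nrm psi - M * t <= complex.Re (psi w).
  by rewrite psiw -mulrBr ler_wpM2l// ltW.
have := eQ v vM.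
set X := complex.Re (\sum_(i < n) (r i)^*%C * k i) in QE SE.
have X1 : Q v - M * t <= X by rewrite SE; lra.
have X2 : t * (X *+ 2) <= t ^+ 2 * (1 + B).
  have : t ^+ 2 * \sum_(i < n) nrm (k i) ^+ 2 <= t ^+ 2 * B by rewrite ler_wpM2l// sqr_ge0.
  by move: Qlb Qv; rewrite QE; lra.
have {}X2 : X *+ 2 <= t * (1 + B) by rewrite -(ler_pM2l t0) mulrA -expr2.
have MtB : 0 <= t * (1 + B) by rewrite mulr_ge0 ?ltW//; lra.
have Mt : 0 <= M * t by rewrite mulr_ge0// ltW.
by lra.
Qed.

End Bidual.

(** * Weakly convergent subsequences imply reflexivity *)

Section SequentialToReflexive.
Variables (R : realType) (V : normedModType R[i]).

(** A functional [Phi] that is no evaluation yields, by two uses of [goldstine] per step, vectors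
    [x n] and functionals [L n] forming a triangular array that is incompatible with a weak limit of
    a subsequence of [x]. *)
Lemma subsequences_reflexive :
  (forall u : nat -> V, bounded_seq u ->
    exists2 s, increasing s & exists l, weakly_cvg_to (u \o s) l) ->
  reflexive_space V.
Proof.
move=> Vsub Phi; apply: contrapT => nx.
have [ev evE] := evaluation V.
have evn x : nrm x <= nrm (ev x).
  have [L Ln Lx] := norming x.
  have L1 : nrm L <= 1 by apply: nrm_dual_le => y y1; apply: le_trans (Ln y) y1.
  have := le_nrm_dual (ev x) L; rewrite evE Lx nrm_real ger0_norm ?nrm_ge0// => /le_trans; apply.
  by rewrite ler_piMr// nrm_ge0.
(* If [Phi] had distance 0 from the evaluations, approximating vectors [y n] would be bounded, and a
   weak limit of a subsequence of them would represent [Phi]. *)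
have [th th0 Hth] : exists2 th : R, 0 < th & forall y, th <= nrm (Phi - ev y).
  apply: contrapT => nth0.
  have H n : exists y, nrm (Phi - ev y) < n.+1%:R^-1.
    apply: contrapT => ny; apply: nth0; exists n.+1%:R^-1; first by rewrite invr_gt0.
    by move=> y; rewrite leNgt; apply/negP => lt; apply: ny; exists y.
  have [y Hy] := choice H.
  have [|s si [l /weakly_cvg_tends sl]] := Vsub y.
    exists (nrm Phi + 1) => n; apply: le_trans (evn _) _.
    apply: le_trans (ler_nrm_dist _ Phi) _; rewrite nrm_distC lerD2l.
    by apply: le_trans (ltW (Hy n)) _; rewrite invf_le1// ler1n.
  apply: nx; exists l => L; apply: (tends_unique (u := fun n => L (y (s n)))); last exact: sl.
  have : tends (fun n => L (y n) : R[i]) (Phi L).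
    move=> e e0; near=> n; rewrite nrm_distC -evE.
    apply: le_lt_trans (_ : nrm ((Phi - ev (y n)) L) < e) => //.
    apply: le_lt_trans (le_nrm_dual _ _) _.
    apply: (@le_lt_trans _ _ (n.+1%:R^-1 * (nrm L + 1))).
      by apply: ler_pM; rewrite ?nrm_ge0 ?lerDl// ltW.
    rewrite -ltr_pdivlMr ?ltr_wpDl ?nrm_ge0//; near: n; apply: near_invn.
    by rewrite divr_gt0// ltr_wpDl ?nrm_ge0.
  by move/(tends_subseq si).
pose eta n : R := n.+1%:R^-1.
pose M := nrm Phi.
(* The triangular array: [L n] is small at the earlier [x i], while [L i (x n)] for [i <= n] is
   close to [Phi (L i)], hence to [th]. *)
pose C (l : seq (V * dual V)) (y : V * dual V) :=
  [/\ nrm y.2 <= 1, forall x, x \in l -> nrm (y.2 x.1) < eta (size l),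
    nrm (Phi y.2 - th%:C) < th / 4, nrm y.1 <= M &
    forall x, x \in y :: l -> nrm (x.2 y.1 - Phi x.2) < th / 4].
have th4 : 0 < th / 4 by rewrite divr_gt0.
have [l|s Hs] := @history_choice _ C.
  pose n := size l; pose x0 : V * dual V := (0, 0).
  have e0 : 0 < Num.min (eta n) (th / 4) by rewrite lt_min th4 invr_gt0 ltr0Sn.
  (* [L] has to be small at the old vectors with [Phi L] close to [th]. The condition on linear
     combinations holds because [Phi] keeps the distance [th] from every evaluation. *)
  have [|b|L L1 HL] := @goldstine R (dual V) n.+1
    (fun i => if (i < n)%N then ev (nth x0 l i).1 else Phi)
    (fun i => if (i < n)%N then 0 else th%:C) 1 _ _ _ e0.
  - exact: ler01.
  - rewrite mul1r big_ord_recr /= ltnn big1 ?add0r; last first.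
      by move=> i _; rewrite ltn_ord mulr0.
    rewrite big_ord_recr /= ltnn.
    have [->|bn0] := eqVneq (b n) 0; first by rewrite mul0r nrm0 nrm_ge0.
    set A := (\sum_(i < n) _ : dual (dual V)).
    pose y := - (b n)^-1 *: \sum_(i < n) b i *: (nth x0 l i).1.
    have -> : A + b n *: Phi = b n *: (Phi - ev y).
      apply: dual_ext => L; rewrite -[LHS]/(A L + b n * Phi L) -[RHS]/(b n * (Phi L - ev y L)).
      rewrite evE /y dualZ mulrBr addrC mulNr mulrN opprK mulrA divff// mul1r.
      congr (_ + _); rewrite dual_sum /A.
      rewrite (dual_sumE n b (fun i => if (i < n)%N then ev (nth x0 l i).1 else Phi)).
      by apply: eq_bigr => i _; rewrite ltn_ord dualZ evE.
    rewrite nrmM nrmZ nrm_real gtr0_norm// ler_wpM2l ?nrm_ge0//.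
  have Ln1 : nrm (Phi L - th%:C) < th / 4.
    have := HL n (ltnSn n); rewrite ltnn => /lt_le_trans; apply.
    by rewrite ge_min lexx orbT.
  (* The new functional joins the old ones with a dummy vector, so that a single [x] serves them
     all. *)
  pose l' := rcons l (0, L).
  have [|b|x xM Hx] := @goldstine R V n.+1 (fun i => (nth x0 l' i).2)
    (fun i => Phi (nth x0 l' i).2) M _ _ _ th4.
  - exact: nrm_ge0.
  - apply: le_trans (le_nrm_dual Phi _).
    by rewrite dual_sum; under [X in _ <= nrm X]eq_bigr do rewrite dualZ.
  exists (x, L); split=> //= [y yl|y].
    have := HL (index y l); rewrite index_mem yl nth_index// subr0 evE => H.
    by apply: lt_le_trans (H _) _; rewrite ?ge_min ?lexx// ltnS index_size.
  rewrite in_cons => /predU1P[-> /=|yl].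
    by have := Hx n (ltnSn n); rewrite /l' nth_rcons ltnn eqxx.
  have := Hx (index y l); rewrite /l' nth_rcons index_mem yl nth_index//; apply.
  by rewrite ltnS index_size.
pose x n := (s n).1; pose L n := (s n).2.
have Lx i n : (i < n)%N -> nrm (L n (x i)) < eta n.
  move=> ni; have [_ H _ _ _] := Hs n.
  have := H (s i); rewrite size_mkseq; apply.
  by apply/mapP; exists i => //; rewrite mem_iota /= add0n.
have PhiL n : nrm (Phi (L n) - th%:C) < th / 4 by have [] := Hs n.
have xM n : nrm (x n) <= M by have [] := Hs n.
have LxPhi i n : (i <= n)%N -> nrm (L i (x n) - Phi (L i)) < th / 4.
  rewrite leq_eqVlt => ni; have [_ _ _ _ H] := Hs n; apply: (H (s i)).
  rewrite in_cons; case/predU1P: ni => [->|ni]; first by rewrite eqxx.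
  by apply/orP; right; apply/mapP; exists i => //; rewrite mem_iota /= add0n.
have L1 n : nrm (L n) <= 1 by have [] := Hs n.
have [|t ti [l tl]] := Vsub x; first by exists M.
(* Two errors [th / 4] from the array and one error [th / 8] from the weak limit are lost. *)
have Ll k : 3 / 8 * th <= nrm (L k l).
  have th8 : 0 < th / 8 by rewrite divr_gt0.
  have /weakly_cvgP/(_ (L k) _ th8) := tl.
  move=> [N _ /(_ (maxn N k)) /=]; rewrite leq_maxl => /(_ isT) H1.
  have /LxPhi H2 : (k <= t (maxn N k))%N.
    by apply: leq_trans (increasing_ge _ ti); rewrite leq_maxr.
  set y := L k (x _) in H1 H2.
  have H3 := PhiL k; set z := Phi (L k) in H2 H3.
  have : th <= nrm (L k l) + nrm (y - L k l) + nrm (y - z) + nrm (z - th%:C).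
    rewrite -{1}(gtr0_norm th0) -nrm_real.
    have E : th%:C = (L k l + (y - L k l)) - (y - z) - (z - th%:C) :> R[i] by ring.
    rewrite {1}E.
    apply: le_trans (ler_nrmB _ _) _; rewrite lerD2r.
    apply: le_trans (ler_nrmB _ _) _; rewrite lerD2r.
    exact: ler_nrmD.
  by lra.
(* The [L n] tend to 0 on this subspace, which contains all [x i] and thus, by Mazur's theorem,
   comes within [th / 8] of the weak limit [l]. *)
pose Y : set V := [set w | tends (fun n => L n w : R[i]) 0].
have Y0 : Y 0 by move=> e e0; near=> n; rewrite dual0 subrr nrm0.
have YL (a : R[i]) u w : Y u -> Y w -> Y (a *: u + w).
  move=> Yu Yw; rewrite /Y /=; have := tends_lin a Yu Yw.
  rewrite /GRing.scale /= mulr0 addr0.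
  by under [fun n : nat => _ * _ + _]eq_fun do rewrite -dualZ -dualD.
have Yx n : Y ((x \o t) n).
  move=> e e0; near=> m; rewrite subr0; apply: lt_trans (Lx (t n) m _) _.
    by near: m; exact: nbhs_infty_gt.
  by near: m; exact: near_invn e0.
have [w Yw lw] := mazur Y0 YL Yx tl (divr_gt0 th0 (ltr0Sn R 7)).
have th8 : 0 < th / 8 by rewrite divr_gt0.
have [N _ /(_ N (leqnn N)) /=] := Yw _ th8; rewrite subr0 => LNw.
have := Ll N.
have : nrm (L N l) <= nrm (L N w) + nrm (l - w).
  apply: le_trans (ler_nrm_dist _ (L N w)) _; rewrite lerD2l -dualB.
  by apply: le_trans (le_nrm_dual _ _) _; rewrite ler_piMl// nrm_ge0.
by lra.
Unshelve. all: by end_near. Qed.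

End SequentialToReflexive.

(** * Reflexivity gives weakly convergent subsequences *)

Section ReflexiveToSequential.
Variables (R : realType) (V : normedModType R[i]).

Lemma rational_approx (a : R[i]) (e : R) : 0 < e ->
  exists q : rat * rat, nrm (a - (ratr q.1 +i* ratr q.2)) < e.
Proof.
move=> e0; have e2 : 0 < e / 2 by rewrite divr_gt0.
have H (x : R) : exists q : rat, `|x - ratr q| < e / 2.
  have [|q] := @rat_in_itvoo R (x - e / 2) (x + e / 2); first by lra.
  rewrite in_itv /= => /andP[q1 q2]; exists q; rewrite ltr_norml; lra.
have [p hp] := H (complex.Re a); have [q hq] := H (complex.Im a).
exists (p, q); apply: le_lt_trans (nrm_le_ReIm _) _.
by rewrite ReB ImB /= (splitr e) ltrD.
Qed.

(** [v] enumerates the combinations of the [u n] with Gaussian rational coefficients, and [Y] is the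
    closure of its values. *)
Lemma countable_span (u : nat -> V) : exists v : nat -> V,
  let Y := [set y | forall e, 0 < e -> exists k, nrm (y - v k) < e] in
  [/\ Y 0, forall (a : R[i]) y w, Y y -> Y w -> Y (a *: y + w),
     forall k, Y (v k) & forall n, Y (u n)].
Proof.
pose rc (q : rat * rat) : R[i] := ratr q.1 +i* ratr q.2.
pose T := seq (seq (rat * rat) * nat).
(* A coefficient is a list of Gaussian rationals standing for their product, so scaling by [rc q]
   just prepends [q]. *)
pose comb (c : T) := \sum_(x <- c) (\prod_(q <- x.1) rc q) *: u x.2.
have combZD q (c d : T) : comb ([seq (q :: x.1, x.2) | x <- c] ++ d) = rc q *: comb c + comb d.
  rewrite /comb big_cat big_map scaler_sumr; congr (_ + _).
  by apply: eq_bigr => x _; rewrite big_cons scalerA.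
pose v k := comb (odflt [::] (unpickle k)).
have vP c : v (pickle c) = comb c by rewrite /v pickleK.
have vE k : exists c, v k = comb c by exists (odflt [::] (unpickle k)).
have Yc y : (exists c, y = comb c) -> forall e, 0 < e -> exists k, nrm (y - v k) < e.
  by move=> [c ->] e e0; exists (pickle c); rewrite vP subrr nrm0.
exists v; split=> [|a y w Yy Yw e e0|k|n].
- by apply: Yc; exists [::]; rewrite /comb big_nil.
- have e3 : 0 < e / 3 by rewrite divr_gt0.
  have a1 : 0 < nrm a + 1 by rewrite ltr_wpDl ?nrm_ge0.
  have [k hk] := Yy _ (divr_gt0 e3 a1); have [l hl] := Yw _ e3.
  have [c vk] := vE k; have [d vl] := vE l.
  have v1 : 0 < nrm (v k) + 1 by rewrite ltr_wpDl ?nrm_ge0.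
  have [q hq] := rational_approx a (divr_gt0 e3 v1).
  exists (pickle ([seq (q :: x.1, x.2) | x <- c] ++ d)).
  rewrite vP combZD -vk -vl opprD addrACA.
  have -> : a *: y - rc q *: v k = a *: (y - v k) + (a - rc q) *: v k.
    by rewrite scalerBr scalerBl addrA subrK.
  apply: le_lt_trans (ler_nrmD _ _) _.
  apply: le_lt_trans (lerD (ler_nrmD _ _) (lexx _)) _; rewrite !nrmZ.
  have h1 : nrm a * nrm (y - v k) <= e / 3.
    apply: le_trans (_ : (nrm a + 1) * nrm (y - v k) <= _).
      by rewrite ler_wpM2r ?nrm_ge0// lerDl.
    by rewrite mulrC -ler_pdivlMr// ltW.
  have h2 : nrm (a - rc q) * nrm (v k) <= e / 3.
    apply: le_trans (_ : nrm (a - rc q) * (nrm (v k) + 1) <= _).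
      by rewrite ler_wpM2l ?nrm_ge0// lerDl.
    by rewrite -ler_pdivlMr// ltW.
  by lra.
- by apply: Yc; exact: vE.
- apply: Yc; exists [:: ([::], n)]; rewrite /comb big_cons !big_nil addr0.
  by rewrite scale1r.
Qed.

(* The seminorm [limsup_n nrm (L (d n))] on the dual, dominated extension and
   reflexivity give [x] with [nrm (L x) <= limsup_n nrm (L (d n))] and equality at
   [L0]. *)
Lemma reflexive_limsup (d : nat -> V) (M : R) (L0 : dual V) (e : R) :
  reflexive_space V -> (forall n, nrm (d n) <= M) ->
  0 < e -> (forall n, e <= nrm (L0 (d n))) ->
  exists2 x : V, L0 x != 0 &
    forall L : dual V, tends (fun n => L (d n) : R[i]) 0 -> L x = 0.
Proof.
move=> Vr dM e0 Le.
(* The infimum of the eventual bounds is the limsup. *)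
pose S (L : dual V) := [set c : R | \forall n \near \oo, nrm (L (d n)) <= c].
have SM L : S L (nrm L * M).
  near=> n; apply: le_trans (le_nrm_dual _ _) _.
  by rewrite ler_wpM2l ?nrm_ge0.
have S0 L c : S L c -> 0 <= c.
  by move=> [N _ /(_ N (leqnn N))]; apply: le_trans; exact: nrm_ge0.
have Sn L : S L !=set0 by exists (nrm L * M).
have Slb L : has_lbound (S L) by exists 0 => c; exact: S0.
pose p L := inf (S L).
have pS L c : S L c -> p L <= c by move=> Sc; exact: ge_inf.
have padh L r : 0 < r -> S L (p L + r).
  move=> r0; have [|c Sc cp] := @inf_adherent R (S L) r r0; first by split.
  by move: Sc; apply: filterS => n /le_trans; apply; exact: ltW.
have p0 L : 0 <= p L by apply: lb_le_inf => // c; exact: S0.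
have pD L K : p (L + K) <= p L + p K.
  apply/ler_addgt0Pr => r r0; have r2 : 0 < r / 2 by rewrite divr_gt0.
  apply: pS; near=> n.
  have h1 : nrm (L (d n)) <= p L + r / 2 by near: n; exact: padh.
  have h2 : nrm (K (d n)) <= p K + r / 2 by near: n; exact: padh.
  apply: le_trans (_ : nrm (L (d n) + K (d n)) <= _) => //.
  by apply: le_trans (ler_nrmD _ _) _; lra.
have pZ (a : R[i]) L : p (a *: L) <= nrm a * p L.
  apply/ler_addgt0Pr => r r0.
  have a1 : 0 < nrm a + 1 by rewrite ltr_wpDl ?nrm_ge0.
  apply: pS; near=> n.
  have h : nrm (L (d n)) <= p L + r / (nrm a + 1).
    by near: n; apply: padh; rewrite divr_gt0.
  apply: le_trans (_ : nrm (a * L (d n)) <= _) => //; rewrite nrmM.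
  apply: le_trans (ler_wpM2l (nrm_ge0 _) h) _; rewrite mulrDr lerD2l.
  by rewrite mulrCA ger_pMr// ler_pdivrMr// mul1r lerDl.
have [|||G [GL Gp Gx]] := @hahn_banach R (dual V) p pD pZ R[i]
  (fun a => a *: L0) (fun a => a * (p L0)%:C).
- by move=> a u w; rewrite scalerDl scalerA.
- by move=> a u w; rewrite mulrDl [in RHS]/GRing.scale /= mulrA.
- move=> a; rewrite nrmM nrm_real ger0_norm//.
  have [->|a0] := eqVneq a 0; first by rewrite nrm0 mul0r.
  have na : 0 < nrm a by rewrite nrm_gt0.
  rewrite mulrC -ler_pdivlMr// mulrC -nrmV -{1}[L0](scalerK a0).
  exact: pZ.
have [|Phi PhiE] := @mk_dual R (dual V) G M GL.
  by move=> L; rewrite mulrC; apply: le_trans (Gp _) (pS _ _ (SM L)).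
have [x xE] := Vr Phi.
exists x => [|L Ld].
  rewrite -xE PhiE -[L0]scale1r Gx mul1r -nrm_gt0 nrm_real normr_gt0 gt_eqF//.
  apply: lt_le_trans e0 _; apply: lb_le_inf => // c [N _ /(_ N (leqnn N))].
  exact: le_trans (Le N).
rewrite -xE PhiE; apply/nrm_eq0/le_anti; rewrite nrm_ge0 andbT.
apply/ler_addgt0Pr => r r0; rewrite add0r; apply: le_trans (Gp _) _.
by apply: pS; have := Ld r r0; apply: filterS => n; rewrite subr0 => /ltW.
Unshelve. all: by end_near. Qed.

(** A diagonal extraction makes countably many functionals [N k], norming the vectors [v k],
    converge along [u]. Then every [L] converges: otherwise differences [d] of far terms with
    [L (d n)] bounded below produce an [x] with [L x != 0], annihilated by every functional tending
    to 0 along [d]. The limits of all [L] form an element of the bidual, hence a vector. *)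
Lemma reflexive_subsequences (u : nat -> V) :
  reflexive_space V -> bounded_seq u ->
  exists2 s, increasing s & exists l, weakly_cvg_to (u \o s) l.
Proof.
move=> Vr [M uM].
have [v [Y0 YL Yv Yu]] := countable_span u.
set Y := (X in X 0) in Y0 YL Yv Yu.
have normk k : exists L : dual V, (forall y, nrm (L y) <= nrm y) /\ L (v k) = (nrm (v k))%:C.
  by have [L Ln Lv] := norming (v k); exists L.
have [N HN] := choice normk.
pose P (j : nat) (s : nat -> nat) := exists l : R[i], tends (fun n => N j (u (s n)) : R[i]) l.
have [||s si sN] := @diagonal_subsequence P.
- move=> j s _; have [|t ti [l tl]] := @bounded_subseq_cvg R (fun n => N j (u (s n))) M.
    by move=> n; apply: le_trans ((HN j).1 _) (uM _).
  by exists t => //; exists l.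
- move=> j s t r K ri tr [l sl]; exists l.
  by apply: (@tends_tail R R[i] (fun n => N j (u (s n))) _ l r K ri) => // n; rewrite tr.
have cauchyL (L : dual V) : cauchy_seq (fun n => L (u (s n)) : R[i]).
  move=> e e0; apply: contrapT => nc.
  have H K : exists mn : nat * nat, [/\ (K <= mn.1)%N, (K <= mn.2)%N &
      e <= nrm (L (u (s mn.1)) - L (u (s mn.2)))].
    apply: contrapT => nH; apply: nc; exists K => m n Km Kn.
    by rewrite ltNge; apply/negP => le; apply: nH; exists (m, n).
  have [f Hf] := choice H.
  pose d K := u (s (f K).1) - u (s (f K).2).
  have dM K : nrm (d K) <= M + M.
    by apply: le_trans (ler_nrmB _ _) _; apply: lerD.
  have Ld K : e <= nrm (L (d K)) by rewrite dualB; have [] := Hf K.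
  have [x Lx xd] := reflexive_limsup Vr dM e0 Ld.
  have Nx k : N k x = 0.
    apply: xd => r r0; have [l /tends_cauchy/(_ r r0)[K HK]] := sN k.
    exists K => // n /= Kn; rewrite subr0 dualB.
    have [Kn1 Kn2 _] := Hf n.
    by apply: HK; [apply: leq_trans Kn1|apply: leq_trans Kn2].
  have x0 : 0 < nrm x.
    by rewrite nrm_gt0; apply: contra Lx => /eqP ->; rewrite dual0.
  (* This puts [x] in the closure of [Y]. Some [v k] is then close to [x], and since [N k x = 0]
     while [N k] norms [v k], both would be too small. *)
  have xY (K : dual V) : (forall w, Y w -> K w = 0) -> K x = 0.
    move=> KY; apply: xd => r r0; near=> n.
    by rewrite /d dualB (KY _ (Yu _)) (KY _ (Yu _)) !subr0 nrm0.
  have [y Yy hy] := annihilator_closure Y0 YL xY (divr_gt0 x0 (ltr0Sn R 3)).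
  have [k hk] := Yy (nrm x / 4) ltac:(by rewrite divr_gt0).
  have : nrm (x - v k) < nrm x / 2.
    have -> : x - v k = (x - y) + (y - v k) by rewrite addrA subrK.
    by apply: le_lt_trans (ler_nrmD _ _) _; lra.
  have := (HN k).1 (x - v k); rewrite dualB Nx sub0r nrmN (HN k).2 nrm_real.
  rewrite ger0_norm ?nrm_ge0//.
  by have := ler_nrm_dist x (v k); lra.
have [Lam HLam] := choice (fun L => complex_complete (cauchyL L)).
have [||Phi PhiE] := @mk_dual R (dual V) Lam M.
- move=> a L K; apply: (tends_unique (HLam _)).
  exact: tends_lin (HLam L) (HLam K).
- move=> L; apply: tends_le (HLam L) _; near=> n.
  by apply: le_trans (le_nrm_dual _ _) _; rewrite mulrC ler_wpM2r ?nrm_ge0.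
have [x xE] := Vr Phi.
exists s => //; exists x; apply/weakly_cvg_tends => L.
by rewrite -xE PhiE; exact: HLam.
Unshelve. all: by end_near. Qed.

End ReflexiveToSequential.

(** * Bloch spaces *)

Section BlochSpace.
Variables (R : realType) (alpha : R).
Implicit Types (X : normedModType R[i]) (z w : R[i]) (rho : R).

Definition wgt (z : R[i]) : R := (1 - nrm z ^+ 2) `^ alpha.

Lemma wgt_ge0 z : 0 <= wgt z. Proof. exact: powR_ge0. Qed.

Lemma disc_sqr (z : R[i]) : disc R z -> 0 < 1 - nrm z ^+ 2.
Proof. by move=> /discE z1; rewrite subr_gt0 expr_lt1// nrm_ge0. Qed.

Lemma wgt_gt0 z : disc R z -> 0 < wgt z.
Proof. by move=> /disc_sqr; exact: powR_gt0. Qed.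

Lemma bloch_out X (f : bloch alpha X) z : ~ disc R z -> f z = 0.
Proof. by have /bloch_predP[+ _ _] := valP f; exact. Qed.

Lemma bloch_cdiff X (f : bloch alpha X) z : disc R z -> cdiff f z (derive1 f z).
Proof.
by move=> zD; apply: derivable_cdiff; have /bloch_predP[_ + _] := valP f; exact.
Qed.

Lemma bloch_ext X (f g : bloch alpha X) : (forall z, disc R z -> f z = g z) -> f = g.
Proof.
move=> fg; apply: val_inj; apply/funext => z.
by have [zD|zD] := pselect (disc R z); [exact: fg|rewrite /= !bloch_out].
Qed.

Lemma le_bloch_weight X (f : bloch alpha X) z : disc R z ->
  nrm (derive1 f z) * wgt z + nrm (f 0) <= nrm f.
Proof.
move=> zD; rewrite [nrm f]/(bloch_norm f) /bloch_norm addrC lerD2l.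
apply: (@le_sup_image _ _ _ (bloch_weight alpha f)) => //.
by have /bloch_predP[] := valP f.
Qed.

Lemma bloch_norm_le X (f : bloch alpha X) (M : R) :
  (forall z, disc R z -> nrm (derive1 f z) * wgt z <= M) -> nrm f <= nrm (f 0) + M.
Proof.
move=> fM; rewrite [nrm f]/(bloch_norm f) /bloch_norm lerD2l.
apply: sup_image_le => //; exists 0; apply/discE; rewrite nrm0//.
Qed.

Lemma le_bloch0 X (f : bloch alpha X) : nrm (f 0) <= nrm f.
Proof.
have D0 : disc R 0 by apply/discE; rewrite nrm0.
apply: le_trans (le_bloch_weight f D0); rewrite lerDr mulr_ge0 ?nrm_ge0//.
exact: wgt_ge0.
Qed.

Lemma le_bloch_derive X (f : bloch alpha X) z : disc R z ->
  nrm (derive1 f z) * wgt z <= nrm f.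
Proof.
by move=> zD; apply: le_trans (le_bloch_weight f zD); rewrite lerDl nrm_ge0.
Qed.

Lemma disc_ball (z : R[i]) : disc R z -> exists2 r : R, 0 < r &
  forall h : R[i], nrm h < r -> disc R (h + z).
Proof.
move=> /discE z1; exists (1 - nrm z) => [|h hr]; first by rewrite subr_gt0.
by apply/discE; apply: le_lt_trans (ler_nrmD _ _) _; rewrite -ltrBrDr.
Qed.

(** The disc is open, so cutting [g] off by 0 outside it leaves the derivatives inside unchanged. *)
Lemma mk_bloch X (g D : R[i] -> X) (M : R) :
  (forall z, disc R z -> cdiff g z (D z)) ->
  (forall z, disc R z -> nrm (D z) * wgt z <= M) ->
  exists f : bloch alpha X,
    [/\ forall z, disc R z -> f z = g z,
        forall z, disc R z -> derive1 f z = D z & nrm f <= nrm (g 0) + M].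
Proof.
move=> dg gM; pose f z := if `[< disc R z >] then g z else 0.
have fg z : disc R z -> f z = g z by rewrite /f => /asboolP ->.
have df z : disc R z -> cdiff f z (D z).
  move=> zD; have [r r0 Hr] := disc_ball zD.
  by apply: (@cdiff_local _ _ g f z (D z) r) (dg z zD) => // h /Hr hD; rewrite fg.
have fP : f \in @bloch_pred R alpha X.
  apply/bloch_predP; split=> [z zD|z zD|].
  - by rewrite /f; case: asboolP.
  - exact: cdiff_derivable (df z zD).
  - exists M => _ [z zD <-]; rewrite /bloch_weight (cdiff_derive1 (df z zD)).
    exact: gM.
exists (Bloch fP); split=> //= [z zD|]; first exact: cdiff_derive1 (df z zD).
have D0 : disc R 0 by apply/discE; rewrite nrm0.
rewrite -(fg 0 D0); apply: (@bloch_norm_le X (Bloch fP)) => z zD /=.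
by rewrite (cdiff_derive1 (df z zD)); exact: gM.
Qed.

Lemma bloch_linE X (a : R[i]) (f g : bloch alpha X) z :
  (a *: f + g) z = a *: f z + g z.
Proof. by []. Qed.

Lemma bloch_scaleE X (a : R[i]) (f : bloch alpha X) z : (a *: f) z = a *: f z.
Proof. by []. Qed.

Lemma bloch_subE X (f g : bloch alpha X) z : (f - g) z = f z - g z.
Proof. by []. Qed.

Lemma bloch_sumE X (I : Type) (r : seq I) (P : pred I) (F : I -> bloch alpha X) z :
  (\sum_(i <- r | P i) F i) z = \sum_(i <- r | P i) F i z.
Proof. by elim/big_rec2: _ => // i y x _ <-. Qed.

Lemma bloch_derive_lin X (a : R[i]) (f g : bloch alpha X) z : disc R z ->
  derive1 (a *: f + g : bloch alpha X) z = a *: derive1 f z + derive1 g z.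
Proof.
move=> zD; apply: cdiff_derive1.
exact: cdiffZD (bloch_cdiff f zD) (bloch_cdiff g zD).
Qed.

(** For [0 <= rho < 1], the reciprocal of the least value of the weight on the closed disc of radius
    [rho]. *)
Definition loc_bound (rho : R) : R := ((1 - rho ^+ 2) `^ alpha)^-1.

Lemma loc_bound_ge0 rho : 0 <= loc_bound rho.
Proof. by rewrite invr_ge0 powR_ge0. Qed.

Hypothesis alpha_gt0 : 0 < alpha.

Lemma le_wgt_ball (rho : R) z : 0 <= rho -> nrm z <= rho -> rho < 1 ->
  (1 - rho ^+ 2) `^ alpha <= wgt z.
Proof.
move=> rho0 zr rho1; apply: ge0_ler_powR; rewrite ?nnegrE ?(ltW alpha_gt0)//.
- by rewrite subr_ge0 expr_le1// ltW.
- by rewrite subr_ge0 expr_le1 ?nrm_ge0// (le_trans zr)// ltW.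
- by rewrite lerD2l lerN2 lerXn2r// ?nnegrE// nrm_ge0.
Qed.

Lemma le_bloch_derive_ball X (f : bloch alpha X) (rho : R) z :
  nrm z <= rho -> rho < 1 -> nrm (derive1 f z) <= loc_bound rho * nrm f.
Proof.
move=> zr rho1; have zD : disc R z by apply/discE; exact: le_lt_trans zr rho1.
have rho0 : 0 <= rho by apply: le_trans zr; exact: nrm_ge0.
have c0 : 0 < (1 - rho ^+ 2) `^ alpha by rewrite powR_gt0// subr_gt0 expr_lt1.
rewrite /loc_bound mulrC ler_pdivlMr//; apply: le_trans (le_bloch_derive f zD).
by apply: ler_wpM2l; [exact: nrm_ge0|exact: le_wgt_ball].
Qed.

Lemma ball_convex (z w : R[i]) (rho t : R) : nrm z <= rho -> nrm w <= rho ->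
  0 <= t <= 1 -> nrm (w + t%:C * (z - w)) <= rho.
Proof.
move=> zr wr /andP[t0 t1].
have -> : w + t%:C * (z - w) = (1 - t)%:C * w + t%:C * z by rewrite rmorphB; ring.
apply: le_trans (ler_nrmD _ _) _; rewrite !nrmM !nrm_real !ger0_norm ?subr_ge0//.
apply: (@le_trans _ _ ((1 - t) * rho + t * rho)); last by lra.
by apply: lerD; apply: ler_wpM2l => //; rewrite subr_ge0.
Qed.

Lemma cdiff_dual X (L : dual X) (f : R[i] -> X) z d :
  cdiff f z d -> cdiff (fun w => L (f w) : R[i]) z (L d).
Proof.
have [M M0 LM] := dual_bounded L.
have M1 : 0 < M + 1 by rewrite ltr_wpDl.
move=> df e e0; have [r r0 H] := df (e / (M + 1)) (divr_gt0 e0 M1).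
exists r => // h hr; rewrite (_ : _ - _ = L (f (h + z) - f z - h *: d)); last first.
  by rewrite !dualB dualZ.
apply: le_trans (LM _) _; apply: (@le_trans _ _ ((M + 1) * nrm (f (h + z) - f z - h *: d))).
  by rewrite ler_wpM2r ?nrm_ge0// lerDl.
by rewrite mulrC -ler_pdivlMr// mulrAC; exact: H.
Qed.

Lemma bloch_lipschitz X (f : bloch alpha X) (rho : R) z w :
  nrm z <= rho -> nrm w <= rho -> rho < 1 ->
  nrm (f z - f w) <= loc_bound rho * nrm f * nrm (z - w).
Proof.
move=> zr wr rho1; have [L Ln LE] := norming (f z - f w).
have -> : nrm (f z - f w) = nrm (L (f z) - L (f w) : R[i]).
  by rewrite -dualB LE nrm_real ger0_norm ?nrm_ge0.
apply: (@mean_value R (fun v => L (f v)) (fun v => L (derive1 f v))) => t t01.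
  apply: cdiff_dual; apply: bloch_cdiff; apply/discE.
  exact: le_lt_trans (ball_convex zr wr t01) rho1.
apply: le_trans (Ln _) _; apply: le_bloch_derive_ball => //.
exact: ball_convex.
Qed.

Lemma le_bloch_ball X (f : bloch alpha X) (rho : R) z :
  nrm z <= rho -> rho < 1 -> nrm (f z) <= (1 + loc_bound rho) * nrm f.
Proof.
move=> zr rho1; have rho0 : 0 <= rho by apply: le_trans zr; exact: nrm_ge0.
apply: le_trans (ler_nrm_dist _ (f 0)) _; rewrite mulrDl mul1r lerD ?le_bloch0//.
apply: le_trans (bloch_lipschitz f zr _ rho1) _; first by rewrite nrm0.
rewrite subr0 ler_piMr ?mulr_ge0 ?nrm_ge0 ?loc_bound_ge0//.
by rewrite (le_trans zr)// ltW.
Qed.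

(* The constant of [derivative_lipschitz] on discs of radius [(1 - rho) / 2]. *)
Definition snd_bound (rho : R) : R := 8 * loc_bound ((1 + rho) / 2) / ((1 - rho) / 2).

Let half_ball (rho : R) (w z : R[i]) : rho < 1 -> nrm w <= rho ->
  nrm (z - w) < (1 - rho) / 2 -> nrm z <= (1 + rho) / 2.
Proof.
by move=> rho1 wr zw; have := ler_nrm_dist z w; lra.
Qed.

Let half_lt1 (rho : R) : rho < 1 -> (1 + rho) / 2 < 1.
Proof. lra. Qed.

Lemma bloch_derive_lipschitz (f : bloch alpha R[i]) (rho : R) (w h : R[i]) :
  rho < 1 -> nrm w <= rho -> nrm h < (1 - rho) / 4 ->
  nrm (derive1 f (h + w) - derive1 f w) <= snd_bound rho * nrm f * nrm h.
Proof.
move=> rho1 wr hr; rewrite /snd_bound.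
have -> : 8 * loc_bound ((1 + rho) / 2) / ((1 - rho) / 2) * nrm f =
    8 * (loc_bound ((1 + rho) / 2) * nrm f) / ((1 - rho) / 2) by rewrite mulrAC mulrA.
apply: (@derivative_lipschitz R f (derive1 f)) => [|z zw|z zw|].
- by rewrite divr_gt0// subr_gt0.
- apply: bloch_cdiff; apply/discE.
  exact: le_lt_trans (half_ball rho1 wr zw) (half_lt1 rho1).
- exact: le_bloch_derive_ball (half_ball rho1 wr zw) (half_lt1 rho1).
- by move: hr; lra.
Qed.

Lemma bloch_taylor2 (f : bloch alpha R[i]) (rho : R) (w h : R[i]) :
  rho < 1 -> nrm w <= rho -> nrm h < (1 - rho) / 4 ->
  nrm (f (h + w) - f w - h * derive1 f w) <= snd_bound rho * nrm f * nrm h ^+ 2.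
Proof.
move=> rho1 wr hr; rewrite /snd_bound.
have -> : 8 * loc_bound ((1 + rho) / 2) / ((1 - rho) / 2) * nrm f =
    8 * (loc_bound ((1 + rho) / 2) * nrm f) / ((1 - rho) / 2) by rewrite mulrAC mulrA.
apply: (@taylor2 R f (derive1 f)) => [|z zw|z zw|].
- by rewrite divr_gt0// subr_gt0.
- apply: bloch_cdiff; apply/discE.
  exact: le_lt_trans (half_ball rho1 wr zw) (half_lt1 rho1).
- exact: le_bloch_derive_ball (half_ball rho1 wr zw) (half_lt1 rho1).
- by move: hr; lra.
Qed.

Lemma snd_bound_ge0 rho : rho < 1 -> 0 <= snd_bound rho.
Proof.
move=> rho1; rewrite /snd_bound divr_ge0 ?mulr_ge0 ?loc_bound_ge0//.
by rewrite subr_ge0 ltW.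
Qed.

Lemma bloch_push X (L : dual X) (f : bloch alpha X) :
  exists g : bloch alpha R[i],
    [/\ forall z, g z = L (f z), forall z, disc R z -> derive1 g z = L (derive1 f z)
      & nrm g <= nrm L * nrm f].
Proof.
(* The derivative part is bounded by [nrm f - nrm (f 0)] rather than [nrm f], so that adding the
   value at 0 gives exactly [nrm L * nrm f]. *)
have [||g [gE g'E gn]] := @mk_bloch R[i] (fun z => L (f z)) (fun z => L (derive1 f z))
  (nrm L * (nrm f - nrm (f 0))).
- by move=> z zD; apply: cdiff_dual; exact: bloch_cdiff.
- move=> z zD; apply: le_trans (ler_wpM2r (wgt_ge0 z) (le_nrm_dual _ _)) _.
  rewrite -mulrA ler_wpM2l ?nrm_ge0// lerBrDr; exact: le_bloch_weight.
exists g; split=> // [z|].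
  have [zD|zD] := pselect (disc R z); first exact: gE.
  by rewrite !bloch_out// dual0.
apply: le_trans gn _; rewrite mulrBr addrCA gerDl subr_le0; exact: le_nrm_dual.
Qed.

Lemma bloch_tensor X (f : bloch alpha R[i]) (x : X) :
  exists g : bloch alpha X,
    [/\ forall z, g z = f z *: x, forall z, disc R z -> derive1 g z = derive1 f z *: x
      & nrm g <= nrm f * nrm x].
Proof.
have [||g [gE g'E gn]] := @mk_bloch X (fun z => f z *: x) (fun z => derive1 f z *: x)
  ((nrm f - nrm (f 0)) * nrm x).
- move=> z zD; have := cdiffM (bloch_cdiff f zD) (cdiff_cst x z).
  by rewrite scaler0 addr0.
- move=> z zD; rewrite nrmZ mulrAC ler_wpM2r ?nrm_ge0// lerBrDr.
  exact: le_bloch_weight.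
exists g; split=> // [z|].
  have [zD|zD] := pselect (disc R z); first exact: gE.
  by rewrite !bloch_out// scale0r.
by apply: le_trans gn _; rewrite nrmZ -mulrDl addrC subrK.
Qed.

Lemma bloch_derive_eval z : disc R z -> exists2 L : dual (bloch alpha R[i]),
  (forall f, L f = (wgt z)%:C * derive1 f z) & nrm L <= 1.
Proof.
move=> zD.
have b (f : bloch alpha R[i]) : nrm ((wgt z)%:C * derive1 f z) <= 1 * nrm f.
  by rewrite nrmM nrm_real ger0_norm ?wgt_ge0// mulrC mul1r; exact: le_bloch_derive.
have [|L LE] := mk_dual _ b.
  by move=> a f g; rewrite bloch_derive_lin// mulrDr [_ *: derive1 f z]/(_ * _) mulrCA.
exists L => //; apply: nrm_dual_le => f f1; rewrite LE.
by apply: le_trans (b f) _; rewrite mul1r.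
Qed.

End BlochSpace.

(** * Pointwise null sequences and weak compactness of balls *)

Section NullSequences.
Variables (R : realType) (alpha : R).
Hypothesis alpha_gt0 : 0 < alpha.
Implicit Types (z w : R[i]).

(** By the Taylor bound, a difference quotient with one fixed step [eta] approximates all
    derivatives [derive1 (f n) z] up to [C * eta], uniformly in [n]. *)
Lemma null_derive (f : nat -> bloch alpha R[i]) (M : R) :
  (forall n, nrm (f n) <= M) ->
  (forall z, disc R z -> tends (fun n => f n z) 0) ->
  forall z, disc R z -> tends (fun n => derive1 (f n) z) 0.
Proof.
move=> fM f0 z zD e e0; have /discE z1 := zD.
have M0 : 0 <= M by apply: le_trans (fM 0%N); exact: nrm_ge0.
pose C := snd_bound alpha (nrm z) * M + 1.
have C0 : 0 < C by rewrite ltr_wpDl// mulr_ge0// snd_bound_ge0.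
pose eta := Num.min ((1 - nrm z) / 8) (e / 2 / C).
have eta0 : 0 < eta by rewrite lt_min !divr_gt0// subr_gt0.
have eta1 : eta < (1 - nrm z) / 4.
  have : eta <= (1 - nrm z) / 8 by rewrite ge_min lexx.
  by move: z1; lra.
have eta2 : C * eta <= e / 2.
  by rewrite mulrC -ler_pdivlMr// ge_min lexx orbT.
pose h : R[i] := eta%:C.
have nh : nrm h = eta by rewrite nrm_real gtr0_norm.
have hzD : disc R (h + z).
  by apply/discE; apply: le_lt_trans (ler_nrmD _ _) _; rewrite nh; move: eta1 z1; lra.
have d0 : 0 < e * eta / 8 by rewrite divr_gt0// mulr_gt0.
near=> n; rewrite subr0.
have a1 : nrm (f n (h + z)) < e * eta / 8.
  by rewrite -[f n _]subr0; near: n; exact: f0.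
have a2 : nrm (f n z) < e * eta / 8.
  by rewrite -[f n _]subr0; near: n; exact: f0.
have a3 : nrm (f n (h + z) - f n z - h * derive1 (f n) z) <= C * eta ^+ 2.
  apply: le_trans (bloch_taylor2 alpha_gt0 (f n) z1 (lexx _) _) _; first by rewrite nh.
  rewrite nh ler_wpM2r ?sqr_ge0// /C.
  apply: le_trans (ler_wpM2l _ (fM n)) _; first exact: snd_bound_ge0.
  by rewrite lerDl.
rewrite -(ltr_pM2l eta0) -nh -nrmM nh.
have -> : h * derive1 (f n) z =
    (f n (h + z) - f n z) - (f n (h + z) - f n z - h * derive1 (f n) z) by ring.
apply: le_lt_trans (ler_nrmB _ _) _.
have := ler_nrmB (f n (h + z)) (f n z).
have : C * eta ^+ 2 <= eta * (e / 2) by rewrite expr2 mulrCA ler_wpM2l// ltW.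
have : 0 < e * eta by rewrite mulr_gt0.
by lra.
Unshelve. all: by end_near. Qed.

(** Points where the derivatives stay large would accumulate at some [l]; the common Lipschitz
    constant of the derivatives carries largeness over to [l], against [null_derive]. *)
Lemma null_derive_unif (f : nat -> bloch alpha R[i]) (M rho : R) : rho < 1 ->
  (forall n, nrm (f n) <= M) ->
  (forall z, disc R z -> tends (fun n => f n z) 0) ->
  forall e, 0 < e -> \forall n \near \oo,
    forall z, nrm z <= rho -> nrm (derive1 (f n) z) <= e.
Proof.
move=> rho1 fM f0 e e0; apply: contrapT => /not_near_subseq[s si ns].
have H n : exists z : R[i], nrm z <= rho /\ e < nrm (derive1 (f (s n)) z).
  apply: contrapT => nH; apply: (ns n) => z zr; rewrite leNgt; apply/negP => lt.
  by apply: nH; exists z.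
have [z Hz] := choice H.
have [t ti [l tl]] := bounded_subseq_cvg (fun n => (Hz n).1).
have lr : nrm l <= rho.
  apply: (tends_le (u := fun n => z (t n))); first exact: tl.
  by near=> n; exact: (Hz _).1.
have lD : disc R l by apply/discE; exact: le_lt_trans lr rho1.
have M0 : 0 <= M by apply: le_trans (fM 0%N); exact: nrm_ge0.
pose C := snd_bound alpha rho * M + 1.
have C0 : 0 < C by rewrite ltr_wpDl// mulr_ge0// snd_bound_ge0.
have e2 : 0 < e / 2 by rewrite divr_gt0.
have r4 : 0 < (1 - rho) / 4 by rewrite divr_gt0// subr_gt0.
near \oo => n.
have a1 : nrm (derive1 (f (s (t n))) l) < e / 2.
  rewrite -[derive1 _ _]subr0; near: n.
  exact: near_increasing (increasing_comp si ti) (null_derive fM f0 lD e2).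
have a2 : nrm (z (t n) - l) < (1 - rho) / 4 by near: n; exact: tl.
have a3 : nrm (z (t n) - l) < e / 2 / C by near: n; apply: tl; rewrite divr_gt0.
have a4 := (Hz (t n)).2.
have := bloch_derive_lipschitz alpha_gt0 (f (s (t n))) rho1 lr a2.
rewrite subrK => a5.
have a6 : snd_bound alpha rho * nrm (f (s (t n))) * nrm (z (t n) - l) <= e / 2.
  apply: (@le_trans _ _ (C * nrm (z (t n) - l))).
    apply: ler_wpM2r; first exact: nrm_ge0.
    apply: le_trans (ler_wpM2l _ (fM _)) _; first exact: snd_bound_ge0.
    by rewrite lerDl.
  by rewrite mulrC -ler_pdivlMr// ltW.
have := lt_le_trans a4 (ler_nrm_dist _ (derive1 (f (s (t n))) l)).
rewrite {1}(splitr e) ltNge => /negP; apply; apply: lerD; first exact: ltW.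
exact: le_trans a5 a6.
Unshelve. all: by end_near. Qed.

End NullSequences.

(** * A weak Montel theorem for bounded sequences of Bloch functions *)

Section WeakMontel.
Variable R : realType.

Lemma dense_disc : exists q : nat -> R[i], (forall j, disc R (q j)) /\
  forall z, disc R z -> forall e : R, 0 < e -> exists j, nrm (z - q j) < e.
Proof.
pose rc (x : rat * rat) : R[i] := ratr x.1 +i* ratr x.2.
pose q j := let w := rc (odflt (0, 0) (unpickle j)) in if `[< disc R w >] then w else 0.
exists q; split=> [j|z /discE zD e e0].
  by rewrite /q; case: asboolP => // _; apply/discE; rewrite nrm0.
have m0 : 0 < Num.min e (1 - nrm z) by rewrite lt_min e0 subr_gt0.
have [x] := rational_approx z m0; rewrite lt_min => /andP[x1 x2].
exists (pickle x); rewrite /q pickleK /=; case: asboolP => //.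
case; apply/discE; apply: le_lt_trans (ler_nrm_dist _ z) _.
by rewrite nrm_distC; move: x2; rewrite -/(rc x); lra.
Qed.

Lemma complete_cauchy (X : completeNormedModType R[i]) (u : nat -> X) :
  cauchy_seq u -> exists l, tends u l.
Proof.
move=> cu; have : cvg (u @ \oo).
  apply/cauchy_cvgP/cauchy_ballP => -[a b]; rewrite ltcE /= => /andP[/eqP -> a0].
  have [N HN] := cu a a0.
  exists ([set x | exists2 n, (N <= n)%N & x = u n], [set x | exists2 n, (N <= n)%N & x = u n]).
    by split; exists N => // n; exists n.
  move=> [_ _] /= [[m Nm ->] [n Nn ->]]; rewrite -ball_normE /ball_ /= nrmE ltcR.
  exact: HN.
by move=> /cvg_ex[l /cvg_nrmP ul]; exists l.
Qed.

Lemma complex_reflexive : reflexive_space (R[i] : normedModType R[i]).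
Proof.
move=> Phi; have [||I IE] := @mk_dual R R[i] (fun x => x) 1.
- by [].
- by move=> x; rewrite mul1r.
exists (Phi I) => L.
have -> : L = L 1 *: I.
  apply: dual_ext => x; rewrite -[RHS]/(L 1 * I x) IE.
  by rewrite -{1}[x]mulr1 -[x * 1]/(x *: (1 : R[i])) dualZ mulrC.
by rewrite dualZ -[RHS]/(L 1 * I (Phi I)) IE.
Qed.

(** Subsequences converging weakly on a countable dense set converge weakly everywhere by
    equicontinuity, and reflexivity represents the limits. The limit is differentiable in norm since
    its difference quotients satisfy a Cauchy estimate. Completeness enters through sequences, so
    that the lemma also applies to the scalar field. *)
Lemma weak_montel (alpha : R) (X : normedModType R[i]) (f : nat -> bloch alpha X) (M : R) :
  0 < alpha -> (forall u : nat -> X, cauchy_seq u -> exists l, tends u l) ->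
  reflexive_space X -> (forall n, nrm (f n) <= M) ->
  exists2 s, increasing s & exists g : bloch alpha X,
    forall z, disc R z -> weakly_cvg_to (fun n => f (s n) z) (g z).
Proof.
move=> alpha0 Xc Xr fM.
have M0 : 0 <= M by apply: le_trans (fM 0%N); exact: nrm_ge0.
have [q [qD qd]] := dense_disc.
pose P (j : nat) (s : nat -> nat) := exists l : X, weakly_cvg_to (fun n => f (s n) (q j)) l.
have [||s si sP] := @diagonal_subsequence P.
- move=> j s _; have /discE qj := qD j.
  have [|t ti [l tl]] := reflexive_subsequences (u := fun n => f (s n) (q j)) Xr.
    exists ((1 + loc_bound alpha (nrm (q j))) * M) => n.
    apply: le_trans (le_bloch_ball alpha0 _ (lexx _) qj) _.
    by rewrite ler_wpM2l// addr_ge0// loc_bound_ge0.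
  by exists t => //; exists l.
- move=> j s t r K ri tr [l /weakly_cvg_tends sl]; exists l.
  apply/weakly_cvg_tends => L.
  by apply: (@tends_tail R R[i] (fun n => L (f (s n) (q j))) _ _ r K ri) => // n; rewrite tr.
have cauchyL (L : dual X) (z : R[i]) : disc R z -> cauchy_seq (fun n => L (f (s n) z) : R[i]).
  move=> zD e e0; have /discE z1 := zD.
  pose rho := (1 + nrm z) / 2; have rho1 : rho < 1 by rewrite /rho; move: z1; lra.
  pose K := nrm L * (loc_bound alpha rho * M).
  have K0 : 0 <= K by rewrite mulr_ge0 ?nrm_ge0// mulr_ge0// loc_bound_ge0.
  have K1 : 0 < K + 1 by rewrite ltr_wpDl.
  have e3 : 0 < e / 3 by rewrite divr_gt0.
  have m0 : 0 < Num.min (e / 3 / (K + 1)) ((1 - nrm z) / 2).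
    by rewrite lt_min !divr_gt0// subr_gt0.
  have [j] := qd z zD _ m0; rewrite lt_min => /andP[hj1 hj2].
  have zr : nrm z <= rho by rewrite /rho; move: z1; lra.
  have qr : nrm (q j) <= rho.
    by have := ler_nrm_dist (q j) z; rewrite nrm_distC /rho; move: hj2; lra.
  have near_q n : nrm (L (f (s n) z) - L (f (s n) (q j)) : R[i]) <= e / 3.
    rewrite -dualB; apply: le_trans (le_nrm_dual _ _) _.
    apply: (@le_trans _ _ (K * nrm (z - q j))).
      rewrite -mulrA ler_wpM2l ?nrm_ge0//.
      apply: le_trans (bloch_lipschitz alpha0 _ zr qr rho1) _.
      by rewrite ler_wpM2r ?nrm_ge0// ler_wpM2l// loc_bound_ge0.
    apply: (@le_trans _ _ ((K + 1) * nrm (z - q j))).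
      by rewrite ler_wpM2r ?nrm_ge0// lerDl.
    by rewrite mulrC -ler_pdivlMr// ltW.
  have [l /weakly_cvg_tends/(_ L)/tends_cauchy/(_ _ e3)[N HN]] := sP j.
  exists N => m n Nm Nn; have := HN m n Nm Nn.
  have := near_q m; have := near_q n.
  set a := L (f (s n) z); set b := L (f (s n) _); set c := L (f (s m) z); set d := L (f (s m) _).
  move=> h1 h2 h3; have -> : c - a = (c - d) + (d - b) - (a - b) :> R[i] by ring.
  by apply: le_lt_trans (ler_nrmB _ _) _; have := ler_nrmD (c - d) (d - b); lra.
have limX (z : R[i]) : exists x : X, disc R z -> forall L : dual X, tends (fun n => L (f (s n) z) : R[i]) (L x).
  have [zD|zD] := pselect (disc R z); last by exists 0.
  have [Lam HLam] := choice (fun L => complex_complete (cauchyL L z zD)).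
  have /discE z1 := zD.
  have [||Phi PhiE] := @mk_dual R (dual X) Lam ((1 + loc_bound alpha (nrm z)) * M).
  - move=> a L K; apply: (tends_unique (HLam _)).
    exact: tends_lin (HLam L) (HLam K).
  - move=> L; apply: tends_le (HLam L) _; near=> n.
    apply: le_trans (le_nrm_dual _ _) _; rewrite mulrC ler_wpM2r ?nrm_ge0//.
    apply: le_trans (le_bloch_ball alpha0 _ (lexx _) z1) _.
    by rewrite ler_wpM2l// addr_ge0// loc_bound_ge0.
  have [x xE] := Xr Phi.
  by exists x => _ L; rewrite -xE PhiE; exact: HLam.
have [g0 Hg0] := choice limX.
(* [c n] is the derivative of [L \o f (s n)] at [w]. The error constant is independent of [n], so
   the estimate survives the limit. *)
have quot (w : R[i]) (L : dual X) : disc R w ->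
    exists2 c : nat -> R[i], (forall n, nrm (c n) * wgt alpha w <= nrm L * M) &
    forall (h : R[i]) n, h != 0 -> nrm h < (1 - nrm w) / 4 ->
      nrm (h^-1 * (L (f (s n) (h + w)) - L (f (s n) w)) - c n) <=
      snd_bound alpha (nrm w) * (nrm L * M) * nrm h.
  move=> wD; have /discE w1 := wD.
  have /choice[p Hp] := fun n => bloch_push L (f (s n)).
  exists (fun n => derive1 (p n) w) => [n|h n h0 hr]; have [pE p'E pn] := Hp n.
    apply: le_trans (le_bloch_derive (p n) wD) _; apply: le_trans pn _.
    by rewrite ler_wpM2l ?nrm_ge0.
  rewrite -!pE; have nh : 0 < nrm h by rewrite nrm_gt0.
  rewrite -(ler_pM2l nh) -nrmM.
  have -> : h * (h^-1 * (p n (h + w) - p n w) - derive1 (p n) w) =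
      p n (h + w) - p n w - h * derive1 (p n) w by rewrite mulrBr mulVKf.
  apply: le_trans (bloch_taylor2 alpha0 (p n) w1 (lexx _) hr) _.
  rewrite expr2 mulrA [leRHS]mulrC; do 2 (apply: ler_wpM2r; first exact: nrm_ge0).
  apply: ler_wpM2l; first exact: snd_bound_ge0.
  by apply: le_trans pn _; rewrite ler_wpM2l ?nrm_ge0.
pose Q (w h : R[i]) : X := h^-1 *: (g0 (h + w) - g0 w).
have hwD (w h : R[i]) : disc R w -> nrm h < (1 - nrm w) / 4 -> disc R (h + w).
  move=> /discE w1 hr; apply/discE; apply: le_lt_trans (ler_nrmD _ _) _.
  by move: hr w1; lra.
have limQ (w h : R[i]) (L : dual X) : disc R w -> nrm h < (1 - nrm w) / 4 ->
    tends (fun n => h^-1 * (L (f (s n) (h + w)) - L (f (s n) w)) : R[i]) (L (Q w h)).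
  move=> wD hr; rewrite dualZ dualB.
  have l1 := Hg0 _ (hwD w h wD hr) L; have l2 := Hg0 w wD L.
  have := tends_lin h^-1 l1 (tends_lin (- h^-1) l2 (tends_cst (0 : R[i]))).
  rewrite addr0 /GRing.scale /= mulNr -mulrBr.
  by under [fun n : nat => _ * _ + _]eq_fun do rewrite addr0 mulNr -mulrBr.
(* A functional norming [Q w h - Q w k] converts the scalar estimates into one in norm: here weak
   information becomes strong. *)
have Qlip (w h k : R[i]) : disc R w -> h != 0 -> k != 0 ->
    nrm h < (1 - nrm w) / 4 -> nrm k < (1 - nrm w) / 4 ->
    nrm (Q w h - Q w k) <= snd_bound alpha (nrm w) * M * (nrm h + nrm k).
  move=> wD h0 k0 hr kr; have [L Ln LE] := norming (Q w h - Q w k).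
  have L1 : nrm L <= 1 by apply: nrm_dual_le => y y1; apply: le_trans (Ln y) y1.
  have /discE w1 := wD; have S0 := snd_bound_ge0 alpha w1.
  have -> : nrm (Q w h - Q w k) = nrm (L (Q w h) - L (Q w k) : R[i]).
    by rewrite -dualB LE nrm_real ger0_norm ?nrm_ge0.
  have [c _ cQ] := quot w L wD.
  have T := tends_lin (-1) (limQ w k L wD kr) (limQ w h L wD hr).
  rewrite [leLHS](_ : _ = nrm (-1 *: L (Q w k) + L (Q w h) : R[i])); last first.
    by rewrite scaleN1r addrC.
  apply: tends_le T _; near=> n; rewrite scaleN1r addrC.
  set A := h^-1 * _; set B := k^-1 * _.
  have -> : A - B = (A - c n) - (B - c n) by ring.
  apply: le_trans (ler_nrmB _ _) _; rewrite mulrDr; apply: lerD.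
    apply: le_trans (cQ h n h0 hr) _; apply: ler_wpM2r; first exact: nrm_ge0.
    by apply: ler_wpM2l => //; rewrite ler_piMl.
  apply: le_trans (cQ k n k0 kr) _; apply: ler_wpM2r; first exact: nrm_ge0.
  by apply: ler_wpM2l => //; rewrite ler_piMl.
have deriv (w : R[i]) : exists d : X, disc R w -> cdiff g0 w d /\ nrm d * wgt alpha w <= M.
  have [wD|wD] := pselect (disc R w); last by exists 0.
  have /discE w1 := wD; have S0 := snd_bound_ge0 alpha w1.
  pose C := snd_bound alpha (nrm w) * M; have C0 : 0 <= C by rewrite mulr_ge0.
  have C1 : 0 < C + 1 by rewrite ltr_wpDl.
  pose de := (1 - nrm w) / 4; have de0 : 0 < de by rewrite divr_gt0// subr_gt0.
  pose eta n : R := de / 2 * n.+1%:R^-1.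
  have d2 : 0 < de / 2 := divr_gt0 de0 (ltr0Sn R 1).
  have eta0 n : 0 < eta n := divr_gt0 d2 (ltr0Sn R n).
  have etad n : eta n < de.
    apply: (@le_lt_trans _ _ (de / 2)); last by rewrite ltr_pdivrMr// ltr_pMr// ltr1n.
    by apply: ler_piMr; [exact: ltW|rewrite invf_le1// ler1n].
  have etas (e : R) : 0 < e -> \forall n \near \oo, eta n < e.
    move=> e0; have := near_invn (divr_gt0 e0 d2); apply: filterS => n.
    by rewrite ltr_pdivlMr// mulrC.
  pose h n : R[i] := (eta n)%:C.
  have nh n : nrm (h n) = eta n by rewrite nrm_real gtr0_norm.
  have h0 n : h n != 0 by rewrite -nrm_gt0 nh.
  have hd n : nrm (h n) < (1 - nrm w) / 4 by rewrite nh etad.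
  have [|d dQ] := Xc (fun n => Q w (h n)).
    move=> e e0; have e2 : 0 < e / 2 / (C + 1) by rewrite !divr_gt0.
    have [N _ HN] := etas _ e2; exists N => m n Nm Nn.
    apply: le_lt_trans (Qlip w (h m) (h n) wD (h0 m) (h0 n) (hd m) (hd n)) _.
    rewrite -/C !nh; have := HN m Nm; have := HN n Nn; rewrite /= !ltr_pdivlMr// => a b.
    have : 0 <= eta m + eta n by rewrite addr_ge0 ?ltW.
    rewrite !mulrDr in a b *; move: a b; lra.
  have Qd (k : R[i]) : k != 0 -> nrm k < (1 - nrm w) / 4 -> nrm (Q w k - d) <= C * nrm k.
    move=> k0 kr; apply/ler_addgt0Pr => e e0.
    have T := tends_lin (-1) dQ (tends_cst (Q w k)).
    rewrite [leLHS](_ : _ = nrm (-1 *: d + Q w k)); last by rewrite scaleN1r addrC.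
    apply: tends_le T _; near=> n; rewrite scaleN1r addrC.
    apply: le_trans (Qlip w k (h n) wD k0 (h0 n) kr (hd n)) _; rewrite -/C mulrDr lerD2l nh.
    apply: (@le_trans _ _ ((C + 1) * eta n)).
      by rewrite ler_wpM2r ?(ltW (eta0 _))// lerDl.
    rewrite mulrC -ler_pdivlMr//; apply: ltW; near: n; apply: etas.
    by rewrite divr_gt0.
  exists d => _; split.
    move=> e e0; exists (Num.min de (e / (C + 1))); first by rewrite lt_min de0 divr_gt0.
    move=> k; rewrite lt_min => /andP[k1 k2].
    have [->|k0] := eqVneq k 0; first by rewrite add0r subrr scale0r subr0 !nrm0 mulr0.
    have -> : g0 (k + w) - g0 w - k *: d = k *: (Q w k - d).
      by rewrite scalerBr /Q scalerA divff// scale1r.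
    rewrite nrmZ mulrC ler_wpM2r ?nrm_ge0//; apply: le_trans (Qd k k0 k1) _.
    apply: (@le_trans _ _ ((C + 1) * nrm k)); first by rewrite ler_wpM2r ?nrm_ge0// lerDl.
    by rewrite mulrC -ler_pdivlMr// ltW.
  (* The weighted bound is proved for the quotients, through a functional norming [d], and passes to
     [d] as the step [h n] shrinks. *)
  have wg := wgt_gt0 alpha wD; rewrite -ler_pdivlMr//.
  have [L Ln LE] := norming d.
  have L1 : nrm L <= 1 by apply: nrm_dual_le => y y1; apply: le_trans (Ln y) y1.
  have [c cM cQ] := quot w L wD.
  have LQ n : nrm (L (Q w (h n)) : R[i]) <= M / wgt alpha w + C * eta n.
    apply: tends_le (limQ w (h n) L wD (hd n)) _; near=> m.
    apply: le_trans (ler_nrm_dist _ (c m)) _; apply: lerD.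
      by rewrite ler_pdivlMr//; apply: le_trans (cM m) _; rewrite ler_piMl.
    apply: le_trans (cQ (h n) m (h0 n) (hd n)) _; rewrite nh ler_wpM2r ?(ltW (eta0 _))//.
    by rewrite ler_wpM2l// ler_piMl.
  have dE : nrm d = nrm (L d : R[i]) by rewrite LE nrm_real ger0_norm ?nrm_ge0.
  apply/ler_addgt0Pr => e e0.
  have e2 : 0 < e / 2 / (C + 1) by rewrite !divr_gt0.
  near \oo => n.
  have en : (C + 1) * eta n <= e / 2.
    by rewrite mulrC -ler_pdivlMr//; apply: ltW; near: n; exact: etas.
  have := Qd (h n) (h0 n) (hd n); rewrite nh => Qdn.
  have := ler_nrm_dist (L d : R[i]) (L (Q w (h n))); rewrite -dE => H.
  apply: le_trans H _; have := LQ n.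
  have : nrm (L d - L (Q w (h n)) : R[i]) <= C * eta n.
    by rewrite -dualB; apply: le_trans (Ln _) _; rewrite nrm_distC.
  have := eta0 n; rewrite mulrDl mul1r in en; move: en; lra.
have [D HD] := choice deriv.
have [||g [gE _ _]] := @mk_bloch R alpha X g0 D M.
- by move=> z zD; exact: (HD z zD).1.
- by move=> z zD; exact: (HD z zD).2.
exists s => //; exists g => z zD; apply/weakly_cvg_tends => L.
by rewrite gE//; exact: Hg0.
Unshelve. all: by end_near. Qed.

End WeakMontel.

(** * Transfer between scalar and vector-valued operators *)

Section BoundedOperators.
Variable R : realType.
Implicit Types U V : normedModType R[i].

Lemma bounded_op_ge0 U V (T : U -> V) : bounded_op T ->
  exists2 M : R, 0 <= M & forall x, nrm (T x) <= M * nrm x.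
Proof.
move=> [M TM]; exists `|M| => // x; apply: le_trans (TM x) _.
by rewrite ler_wpM2r ?nrm_ge0 ?ler_norm.
Qed.

Lemma dual_comp U V (T : U -> V) (L : dual V) : linear T -> bounded_op T ->
  exists K : dual U, forall x, K x = L (T x).
Proof.
move=> Tl /bounded_op_ge0[M M0 TM].
apply: (@mk_dual R U (fun x => L (T x)) (nrm L * M)) => [a x y|x].
  by rewrite Tl dualD dualZ.
apply: le_trans (le_nrm_dual _ _) _; rewrite -mulrA ler_wpM2l ?nrm_ge0//.
Qed.

Lemma mk_linear U V (T : U -> V) : linear T ->
  exists T' : {linear U -> V}, forall x, T' x = T x.
Proof.
move=> Tl.
by exists (HB.pack_for {linear U -> V} T (GRing.isLinear.Build R[i] U V *:%R T Tl)).
Qed.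

Lemma tends_weakly V (u : nat -> V) (l : V) : tends u l -> weakly_cvg_to u l.
Proof.
move=> ul; apply/weakly_cvg_tends => L e e0.
have L1 : 0 < nrm L + 1 by rewrite ltr_wpDl ?nrm_ge0.
have := ul _ (divr_gt0 e0 L1); apply: filterS => n; rewrite ltr_pdivlMr// => H.
rewrite -dualB; apply: le_lt_trans (le_nrm_dual _ _) _; rewrite mulrC.
by apply: le_lt_trans H; rewrite ler_wpM2l ?nrm_ge0// lerDl.
Qed.

Lemma compact_weakly_compact U V (T : U -> V) : compact_op T -> weakly_compact_op T.
Proof.
move=> Tc u ub; have [s [si [l sl]]] := Tc u ub.
by exists s; split=> //; exists l; apply: tends_weakly; apply/cvg_nrmP.
Qed.

Lemma tends_sum V (m : nat) (u : nat -> nat -> V) (l : nat -> V) :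
  (forall j, tends (u j) (l j)) ->
  tends (fun n => \sum_(j < m) u j n) (\sum_(j < m) l j).
Proof.
move=> ul; elim: m => [|m ih].
  by rewrite big_ord0; under [fun n : nat => _]eq_fun do rewrite big_ord0; exact: tends_cst.
rewrite big_ord_recr; under [fun n : nat => _]eq_fun do rewrite big_ord_recr.
by have := tends_lin 1 ih (ul m); under [fun n : nat => 1 *: _ + _]eq_fun do rewrite scale1r; rewrite scale1r.
Qed.

End BoundedOperators.

Lemma tensor_rule (R : realType) (X : lmodType R[i]) (a b c d e : R[i]) (x : X) :
  (a *: b + c *: (d *: e)) *: x = a *: (b *: x) + c *: (d *: (e *: x)).
Proof. by rewrite scalerDl !scalerA. Qed.

Section WeightedComposition.
Variables (R : realType) (psi phi : R[i] -> R[i]) (alpha beta : R).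
Hypothesis psi_analytic : analytic_on_disc psi.
Hypothesis phi_analytic : analytic_on_disc phi.
Hypothesis phi_disc : forall z, disc R z -> disc R (phi z).
Hypothesis alpha_gt0 : 0 < alpha.
Implicit Types (X : normedModType R[i]) (z : R[i]).

Definition wco X (f : R[i] -> X) z : X := psi z *: f (phi z).

Definition wco_derive X (f : R[i] -> X) z : X :=
  derive1 psi z *: f (phi z) + psi z *: (derive1 phi z *: derive1 f (phi z)).

Lemma wco_cdiff X (f : bloch alpha X) z : disc R z -> cdiff (wco f) z (wco_derive f z).
Proof.
move=> zD; apply: cdiffM; first exact: derivable_cdiff (psi_analytic zD).
apply: cdiff_comp; first exact: derivable_cdiff (phi_analytic zD).
exact: bloch_cdiff (phi_disc zD).
Qed.

Lemma wco_derivative X (T : bloch alpha X -> bloch beta X) :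
  is_weighted_composition psi phi T ->
  forall f z, disc R z -> derive1 (T f) z = wco_derive f z.
Proof.
move=> TE f z zD; apply: cdiff_derive1; have [r r0 Hr] := disc_ball zD.
apply: (@cdiff_local _ _ (wco f) _ z _ r) (wco_cdiff f zD) => // h /Hr hD.
by rewrite TE.
Qed.

(** Only the derivative part needs an assumption: the value at 0 is [psi 0 *: f (phi 0)], and
    evaluation at the interior point [phi 0] is bounded. *)
Lemma wco_boundedP X : wco_bounded psi phi alpha beta X <->
  exists M : R, forall (f : bloch alpha X) z, disc R z ->
    nrm (wco_derive f z) * wgt beta z <= M * nrm f.
Proof.
have D0 : disc R 0 by apply/discE; rewrite nrm0.
split=> [[T [TE [M TM]]]|[M HM]].
  exists M => f z zD; apply: le_trans (TM f).
  by rewrite -(wco_derivative TE)//; exact: le_bloch_derive.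
have H (f : bloch alpha X) : exists g : bloch beta X,
    (forall z, disc R z -> g z = wco f z) /\ nrm g <= nrm (wco f 0) + M * nrm f.
  have [||g [gE _ gn]] := @mk_bloch R beta X (wco f) (wco_derive f) (M * nrm f).
  - by move=> z zD; exact: wco_cdiff.
  - exact: HM.
  - by exists g.
have [T HT] := choice H.
have Tl : linear T.
  move=> a f g; apply: bloch_ext => z zD.
  rewrite bloch_linE !(HT _).1// /wco bloch_linE scalerDr !scalerA.
  by rewrite (mulrC a).
have [T' T'E] := mk_linear Tl.
exists T'; split=> [f z zD|]; first by rewrite T'E (HT f).1.
exists (nrm (psi 0) * (1 + loc_bound alpha (nrm (phi 0))) + M) => f.
rewrite T'E; apply: le_trans (HT f).2 _; rewrite mulrDl lerD2r nrmZ -mulrA.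
rewrite ler_wpM2l ?nrm_ge0//; apply: le_bloch_ball => //.
by apply/discE; exact: phi_disc.
Qed.

Lemma wco_derive_push X (L : dual X) (f : bloch alpha X) (g : bloch alpha R[i]) z :
  disc R z -> (forall z, g z = L (f z)) ->
  (forall z, disc R z -> derive1 g z = L (derive1 f z)) ->
  wco_derive g z = L (wco_derive f z).
Proof.
move=> zD gE g'E; rewrite /wco_derive dualD !dualZ gE g'E//.
exact: phi_disc.
Qed.

Lemma wco_bounded_iff X : (exists x : X, x != 0) ->
  wco_bounded psi phi alpha beta X <-> wco_bounded psi phi alpha beta R[i].
Proof.
move=> [x x0]; rewrite !wco_boundedP; split=> -[M HM].
  have nx : 0 < nrm x by rewrite nrm_gt0.
  exists `|M| => f z zD; rewrite -(ler_pM2r nx).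
  have [g [gE g'E gn]] := bloch_tensor f x.
  have -> : nrm (wco_derive f z) * wgt beta z * nrm x = nrm (wco_derive g z) * wgt beta z.
    rewrite mulrAC -nrmZ; congr (nrm _ * _).
    rewrite /wco_derive gE g'E; last exact: phi_disc.
    exact: tensor_rule.
  apply: le_trans (HM g z zD) _; apply: le_trans (_ : `|M| * nrm g <= _).
    by rewrite ler_wpM2r ?nrm_ge0 ?ler_norm.
  by rewrite -mulrA ler_wpM2l.
exists `|M| => f z zD; have [L Ln LE] := norming (wco_derive f z).
have L1 : nrm L <= 1 by apply: nrm_dual_le => y y1; apply: le_trans (Ln y) y1.
have [g [gE g'E gn]] := bloch_push L f.
have -> : nrm (wco_derive f z) = nrm (wco_derive g z).
  by rewrite (wco_derive_push zD gE g'E) LE nrm_real ger0_norm ?nrm_ge0.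
apply: le_trans (HM g z zD) _; apply: le_trans (_ : `|M| * nrm g <= _).
  by rewrite ler_wpM2r ?nrm_ge0 ?ler_norm.
rewrite ler_wpM2l//; apply: le_trans gn _.
by rewrite ler_piMl ?nrm_ge0.
Qed.

Lemma bloch_one : exists f : bloch alpha R[i], forall z, disc R z -> f z = 1.
Proof.
have [||f [fE _ _]] := @mk_bloch R alpha R[i] (fun=> 1) (fun=> 0) 0.
- by move=> z _; exact: cdiff_cst.
- by move=> z _; rewrite nrm0 mul0r.
- by exists f.
Qed.

Hypothesis beta_gt0 : 0 < beta.

(** Up to the factor [nrm x], the scalar operator factors as: tensor with [x], apply [S], compose
    with a functional norming [x]. The outer maps are bounded, hence preserve bounded sequences and
    weak convergence. *)
Lemma weakly_compact_scalar X (x : X) : x != 0 ->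
  wco_weakly_compact psi phi alpha beta X -> wco_weakly_compact psi phi alpha beta R[i].
Proof.
move=> x0 [S [SE Sb Sc]].
have /(wco_bounded_iff (ex_intro _ x x0)) [T [TE Tb]] :
  wco_bounded psi phi alpha beta X by exists S.
exists T; split=> // u [M uM].
have /choice[U HU] := fun n => bloch_tensor (u n) x.
have [|s [si [l sl]]] := Sc U.
  exists (M * nrm x) => n; have [_ _ Un] := HU n.
  by apply: le_trans Un _; rewrite ler_wpM2r ?nrm_ge0.
have [L Ln Lx] := norming x.
have /choice[P HP] := bloch_push (alpha := beta) L.
have Pl : linear P.
  move=> a f g; apply: bloch_ext => z zD; rewrite bloch_linE.
  have [-> _ _] := HP (a *: f + g); have [-> _ _] := HP f; have [-> _ _] := HP g.
  by rewrite bloch_linE dualD dualZ.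
have Pb : bounded_op P by exists (nrm L) => f; have [] := HP f.
have c0 : (nrm x)%:C != 0 :> R[i] by rewrite -nrm_gt0 nrm_real normr_gt0 gt_eqF// nrm_gt0.
have PSU n : P (S (U n)) = (nrm x)%:C *: T (u n).
  apply: bloch_ext => z zD; have [-> _ _] := HP (S (U n)).
  have [UE _ _] := HU n; rewrite SE// UE bloch_scaleE TE// !dualZ Lx.
  by rewrite /GRing.scale /=; ring.
exists s; split=> //; exists ((nrm x)%:C^-1 *: P l); apply/weakly_cvg_tends => K.
have [K' K'E] := dual_comp K Pl Pb.
have /weakly_cvg_tends/(_ K') H := sl.
have := tends_lin (nrm x)%:C^-1 H (tends_cst (0 : R[i])).
rewrite addr0 K'E dualZ.
have -> : (fun n => (nrm x)%:C^-1 *: (K' (S (U (s n))) : R[i]) + 0) =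
    (fun n => K (T (u (s n)))).
  by apply/funext => n; rewrite addr0 K'E PSU dualZ /GRing.scale /= mulKf.
by [].
Qed.

(** On the constant function [u n], evaluating the image at [z0] gives [psi z0 *: u n]; evaluation
    is bounded, so weak limits of images yield weak limits of the [u n]. *)
Lemma weakly_compact_reflexive X : (exists z, disc R z /\ psi z != 0) ->
  wco_weakly_compact psi phi alpha beta X -> reflexive_space X.
Proof.
move=> [z0 [z0D psi0]] [S [SE Sb Sc]]; apply: subsequences_reflexive => u [M uM].
have [one oneE] := bloch_one.
have /choice[U HU] := fun n => bloch_tensor one (u n).
have [|s [si [l sl]]] := Sc U.
  exists (nrm one * M) => n; have [_ _ Un] := HU n.
  by apply: le_trans Un _; rewrite ler_wpM2l ?nrm_ge0.
have SU n : S (U n) z0 = psi z0 *: u n.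
  by have [UE _ _] := HU n; rewrite SE// UE oneE ?scale1r//; exact: phi_disc.
exists s => //; exists ((psi z0)^-1 *: l z0); apply/weakly_cvg_tends => L.
have [K KE] : exists K : dual (bloch beta X), forall f, K f = L (f z0).
  apply: (@dual_comp R (bloch beta X) X (fun f => f z0) L) => //.
  exists (1 + loc_bound beta (nrm z0)) => f.
  by apply: le_bloch_ball => //; exact/discE.
have /weakly_cvg_tends/(_ K) H := sl.
have := tends_lin (psi z0)^-1 H (tends_cst (0 : R[i])).
rewrite addr0 KE dualZ.
have -> : (fun n => (psi z0)^-1 *: (K (S (U (s n))) : R[i]) + 0) =
    (fun n => L ((u \o s) n)).
  by apply/funext => n; rewrite addr0 KE SU dualZ /GRing.scale /= mulKf.
by [].
Qed.

Lemma null_dense (q : nat -> R[i]) (f : nat -> bloch alpha R[i]) (M : R) :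
  (forall j, disc R (q j)) ->
  (forall z, disc R z -> forall e : R, 0 < e -> exists j, nrm (z - q j) < e) ->
  (forall n, nrm (f n) <= M) -> (forall j, tends (fun n => f n (q j)) 0) ->
  forall z, disc R z -> tends (fun n => f n z) 0.
Proof.
move=> qD qd fM f0 z zD e e0; have /discE z1 := zD.
have M0 : 0 <= M by apply: le_trans (fM 0%N); exact: nrm_ge0.
pose rho := (1 + nrm z) / 2; have rho1 : rho < 1 by rewrite /rho; move: z1; lra.
pose K := loc_bound alpha rho * M.
have K0 : 0 <= K by rewrite mulr_ge0// loc_bound_ge0.
have K1 : 0 < K + 1 by rewrite ltr_wpDl.
have e2 : 0 < e / 2 by rewrite divr_gt0.
have m0 : 0 < Num.min (e / 2 / (K + 1)) ((1 - nrm z) / 2).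
  by rewrite lt_min !divr_gt0// subr_gt0.
have [j] := qd z zD _ m0; rewrite lt_min => /andP[hj1 hj2].
have zr : nrm z <= rho by rewrite /rho; move: z1; lra.
have qr : nrm (q j) <= rho.
  by have := ler_nrm_dist (q j) z; rewrite nrm_distC /rho; move: hj2; lra.
have := f0 j _ e2; apply: filterS => n; rewrite !subr0 => H.
apply: le_lt_trans (ler_nrm_dist _ (f n (q j))) _; rewrite (splitr e).
apply: ltr_leD H _; apply: le_trans (bloch_lipschitz alpha_gt0 _ zr qr rho1) _.
apply: (@le_trans _ _ ((K + 1) * nrm (z - q j))); last by rewrite mulrC -ler_pdivlMr// ltW.
apply: ler_wpM2r; first exact: nrm_ge0.
apply: (@le_trans _ _ K); last by rewrite lerDl.
by rewrite ler_wpM2l// loc_bound_ge0.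
Qed.

Lemma tends_eval X (f : nat -> bloch beta X) (g : bloch beta X) z :
  tends f g -> disc R z -> tends (fun n => f n z) (g z).
Proof.
move=> fg /discE z1 e e0.
have K0 : 0 < 1 + loc_bound beta (nrm z) by rewrite ltr_pwDl// loc_bound_ge0.
have := fg _ (divr_gt0 e0 K0); apply: filterS => n; rewrite ltr_pdivlMr// => H.
rewrite -bloch_subE; apply: le_lt_trans (le_bloch_ball beta_gt0 _ (lexx _) z1) _.
by rewrite mulrC.
Qed.

(** Otherwise, taking [m] both as constant and as number of points gives [f m] in the unit ball
    violating the bound. Boundedness of [T (f m)] forces [f m (q j)] to 0 for each [j], hence [f m]
    to 0 pointwise, so a norm limit of the images is 0, although their norms exceed [e]. *)
Lemma compact_finitely_controlled (q : nat -> R[i]) (T : {linear bloch alpha R[i] -> bloch beta R[i]}) :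
  (forall j, disc R (q j)) ->
  (forall z, disc R z -> forall e : R, 0 < e -> exists j, nrm (z - q j) < e) ->
  is_weighted_composition psi phi T -> bounded_op T -> compact_op T ->
  forall e, 0 < e -> exists (m : nat) (C : R), 0 <= C /\ forall f,
    nrm (T f) <= e * nrm f + C * \sum_(j < m) nrm (f (q j)).
Proof.
move=> qD qd TE /bounded_op_ge0[M M0 TM] Tc e e0; apply: contrapT => nT.
have H m : exists f : bloch alpha R[i], nrm f <= 1 /\
    e + m%:R * \sum_(j < m) nrm (f (q j)) < nrm (T f).
  apply: contrapT => nf; apply: nT; exists m, m%:R; split=> // f.
  have [->|f0] := eqVneq f 0.
    rewrite linear0 !nrm0 mulr0 add0r mulr_ge0//.
    by apply: sumr_ge0 => j _; exact: nrm_ge0.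
  have nf0 : 0 < nrm f by rewrite nrm_gt0.
  rewrite leNgt; apply/negP => lt; apply: nf.
  exists ((nrm f)^-1%:C *: f); split.
    by rewrite nrmZ nrm_real gtr0_norm ?invr_gt0// mulVf// gt_eqF.
  rewrite linearZ /= nrmZ nrm_real gtr0_norm ?invr_gt0//.
  have -> : \sum_(j < m) nrm (((nrm f)^-1%:C *: f) (q j)) =
      (nrm f)^-1 * \sum_(j < m) nrm (f (q j)).
    rewrite mulr_sumr; apply: eq_bigr => j _.
    rewrite -[LHS]/(nrm ((nrm f)^-1%:C *: f (q j))) nrmZ nrm_real.
    by rewrite gtr0_norm ?invr_gt0.
  rewrite -(ltr_pM2l nf0) mulVKf ?gt_eqF//.
  by apply: le_lt_trans lt; rewrite mulrDr mulrCA mulVKf ?gt_eqF// mulrC.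
have [f Hf] := choice H.
have fM n : nrm (f n) <= 1 := (Hf n).1.
have TfM n : nrm (T (f n)) <= M.
  by apply: le_trans (TM _) _; rewrite ler_piMr.
have fq j : tends (fun n => f n (q j)) 0.
  move=> r r0; near=> n; rewrite subr0.
  have jn : (j < n)%N by near: n; exact: nbhs_infty_gt.
  have n0 : (0 : R) < n%:R by rewrite ltr0n (leq_ltn_trans (leq0n j)).
  have S : n%:R * nrm (f n (q j)) <= M.
    apply: le_trans (TfM n); apply: le_trans (ltW (Hf n).2).
    apply: (@le_trans _ _ (n%:R * \sum_(j < n) nrm (f n (q j)))); last by rewrite lerDr ltW.
    rewrite ler_pM2l// (bigD1 (Ordinal jn))//= lerDl.
    by apply: sumr_ge0 => i _; exact: nrm_ge0.
  have M1 : 0 < M + 1 by rewrite ltr_wpDl.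
  rewrite -(ltr_pM2l n0); apply: le_lt_trans S _.
  rewrite -ltr_pdivrMr//; near: n; exact: nbhs_infty_gtr.
have f0 := null_dense qD qd fM fq.
have [|s [si [y /cvg_nrmP sy]]] := Tc f; first by exists 1.
have y0 : y = 0.
  apply: bloch_ext => z zD; apply: (tends_unique (tends_eval sy zD)).
  have := tends_lin (psi z) (tends_subseq si (f0 _ (phi_disc zD))) (tends_cst (0 : R[i])).
  rewrite scaler0 addr0.
  have -> : (fun n => psi z *: ((fun n => f n (phi z)) \o s) n + 0) = (fun n => T (f (s n)) z).
    by apply/funext => n; rewrite addr0 /= TE.
  by [].
have [N _ /(_ N (leqnn N))] := sy e e0; rewrite /= y0 subr0 => lt.
have := (Hf (s N)).2; apply/negP; rewrite -leNgt; apply: le_trans (ltW lt) _.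
rewrite lerDl mulr_ge0//; apply: sumr_ge0 => j _; exact: nrm_ge0.
Unshelve. all: by end_near. Qed.

(** The value at 0 and each weighted derivative of [S f] are normed by functionals, which reduces
    them to [T]; each part is at most [B], and their sum doubles the constants. *)
Lemma push_control X (q : nat -> R[i]) (T : {linear bloch alpha R[i] -> bloch beta R[i]})
    (S : bloch alpha X -> bloch beta X) (m : nat) (e C : R) :
  is_weighted_composition psi phi T -> is_weighted_composition psi phi S ->
  0 <= e -> 0 <= C ->
  (forall f, nrm (T f) <= e * nrm f + C * \sum_(j < m) nrm (f (q j))) ->
  forall f, nrm (S f) <= (C + C) * (\sum_(j < m) nrm (f (q j))) + (e + e) * nrm f.
Proof.
move=> TE SE e0 C0 HT f.
pose B := e * nrm f + C * \sum_(j < m) nrm (f (q j)).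
have push (L : dual X) : (forall y, nrm (L y) <= nrm y) ->
    exists2 g, nrm (T g) <= B & (forall z, g z = L (f z)) /\
       (forall z, disc R z -> derive1 g z = L (derive1 f z)).
  move=> Ln; have L1 : nrm L <= 1 by apply: nrm_dual_le => y y1; apply: le_trans (Ln y) y1.
  have [g [gE g'E gn]] := bloch_push L f; exists g => //.
  apply: le_trans (HT g) _; apply: lerD; apply: ler_wpM2l => //.
    by apply: le_trans gn _; rewrite ler_piMl ?nrm_ge0.
  by apply: ler_sum => j _; rewrite gE.
have D0 : disc R 0 by apply/discE; rewrite nrm0.
have S0 : nrm (S f 0) <= B.
  have [L Ln LE] := norming (S f 0); have [g Tg [gE _]] := push L Ln.
  have -> : nrm (S f 0) = nrm (T g 0).
    have -> : T g 0 = L (S f 0) by rewrite TE// SE// gE dualZ.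
    by rewrite LE nrm_real ger0_norm ?nrm_ge0.
  exact: le_trans (le_bloch0 _) Tg.
have S1 z : disc R z -> nrm (derive1 (S f) z) * wgt beta z <= B.
  move=> zD; have [L Ln LE] := norming (derive1 (S f) z); have [g Tg [gE g'E]] := push L Ln.
  have -> : nrm (derive1 (S f) z) = nrm (derive1 (T g) z).
    have -> : derive1 (T g) z = L (derive1 (S f) z).
      by rewrite !(wco_derivative _ _ zD)//; exact: wco_derive_push.
    by rewrite LE nrm_real ger0_norm ?nrm_ge0.
  exact: le_trans (le_bloch_derive _ zD) Tg.
apply: le_trans (bloch_norm_le S1) _; move: S0; rewrite /B !mulrDl; lra.
Qed.

Lemma compact_weakly_compact_vector (X : completeNormedModType R[i]) :
  (exists x : X, x != 0) -> wco_compact psi phi alpha beta R[i] -> reflexive_space X ->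
  wco_weakly_compact psi phi alpha beta X.
Proof.
move=> X0 [T [TE Tb Tc]] Xr.
have /(wco_bounded_iff X0) [S [SE Sb]] : wco_bounded psi phi alpha beta R[i] by exists T.
exists S; split=> // f [M fM].
have [s si [g fg]] := weak_montel alpha_gt0 (@complete_cauchy R X) Xr fM.
exists s; split=> //; exists (S g); apply/weakly_cvg_tends => Lam e e0.
pose h n := f (s n) - g.
pose M' := M + nrm g.
have hM n : nrm (h n) <= M' by apply: le_trans (ler_nrmB _ _) _; rewrite lerD2r.
have M'0 : 0 <= M' by apply: le_trans (hM 0%N); exact: nrm_ge0.
have [q [qD qd]] := dense_disc R.
have K0 : 0 < (nrm Lam + 1) * (M' + 1) by rewrite mulr_gt0// ltr_wpDl ?nrm_ge0.
(* The remainder is bounded by [e1 + e1] times the norms of [Lam] and [h n], so it stays below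
   [e / 2]; the summands 1 keep the divisor positive. *)
have [e1 e10 e1E] : exists2 e1, 0 < e1 & e1 * ((nrm Lam + 1) * (M' + 1)) = e / 4.
  exists (e / 4 / ((nrm Lam + 1) * (M' + 1))); first by rewrite !divr_gt0.
  by rewrite divfK// gt_eqF.
have [m [C [C0 HT]]] := compact_finitely_controlled qD qd TE Tb Tc e10.
have HS := push_control TE SE (ltW e10) C0 HT.
have [||||||L [F2 [FE F2q]]] := @split_dominated R (bloch alpha X) X m (fun j v => v (q j))
  (fun v => Lam (S v)) (nrm Lam * (C + C)) (fun v => nrm Lam * ((e1 + e1) * nrm v)).
- by [].
- by move=> a u v; rewrite linearP dualD dualZ.
- by rewrite mulr_ge0 ?nrm_ge0// addr_ge0.
- move=> u v; rewrite -mulrDr -mulrDr; apply: ler_wpM2l; first exact: nrm_ge0.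
  by apply: ler_wpM2l; [rewrite addr_ge0// ltW|exact: ler_nrmD].
- by move=> a u; rewrite nrmZ (mulrCA (e1 + e1)) (mulrCA (nrm Lam)).
- move=> v; apply: le_trans (le_nrm_dual _ _) _; rewrite -mulrA -mulrDr.
  by apply: ler_wpM2l; [exact: nrm_ge0|exact: HS].
have e2 : 0 < e / 2 by rewrite divr_gt0.
have lim0 : tends (fun n => \sum_(j < m) L j (h n (q j)) : R[i]) 0.
  rewrite -[X in tends _ X](_ : \sum_(j < m) 0 = 0); last by rewrite big1.
  apply: (@tends_sum R R[i] m (fun j n => L j (h n (q j))) (fun=> 0)) => j.
  have /weakly_cvg_tends/(_ (L j)) H := fg (q j) (qD j).
  move=> r r0; have := H r r0; apply: filterS => n.
  by rewrite subr0 /h bloch_subE dualB.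
have := lim0 _ e2; apply: filterS => n; rewrite subr0 => Hn.
rewrite -dualB -linearB -/(h n) FE; apply: le_lt_trans (ler_nrmD _ _) _.
rewrite (splitr e); apply: ltr_leD Hn _; apply: le_trans (F2q _) _.
apply: (@le_trans _ _ ((nrm Lam + 1) * ((e1 + e1) * (M' + 1)))).
  apply: ler_pM; rewrite ?nrm_ge0 ?lerDl//.
    by rewrite mulr_ge0 ?nrm_ge0// addr_ge0 ?ltW.
  apply: ler_wpM2l; first by rewrite addr_ge0 ?ltW.
  by apply: le_trans (hM n) _; rewrite lerDl.
rewrite mulrCA mulrDl e1E; lra.
Qed.

End WeightedComposition.

(** * Norm-detecting functionals and little Bloch functions *)

Section LittleBloch.
Variables (R : realType) (alpha : R).
Hypothesis alpha_gt0 : 0 < alpha.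
Implicit Types (z : R[i]) (f g : bloch alpha R[i]).

(** Membership in the little Bloch space. *)
Definition little f := forall e : R, 0 < e -> exists2 rho : R, rho < 1 &
  forall z, disc R z -> rho < nrm z -> nrm (derive1 f z) * wgt alpha z <= e.

Lemma wgt_small (e : R) : 0 < e -> exists2 rho : R, rho < 1 &
  forall z, disc R z -> rho < nrm z -> wgt alpha z <= e.
Proof.
move=> e0; pose x := e `^ alpha^-1; have x0 : 0 < x by exact: powR_gt0.
(* [1 - nrm z ^+ 2] is at most [2 * (1 - nrm z)], which is below [x] beyond this radius. *)
exists (1 - x / 2); first by rewrite gtrBl divr_gt0.
move=> z zD zr; have /discE z1 := zD.
have -> : e = x `^ alpha by rewrite /x -powRrM mulVf ?gt_eqF// powRr1// ltW.
apply: ge0_ler_powR; rewrite ?nnegrE ?(ltW alpha_gt0) ?(ltW x0) ?(ltW (disc_sqr zD))//.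
have -> : 1 - nrm z ^+ 2 = (1 - nrm z) * (1 + nrm z) by ring.
apply: (@le_trans _ _ ((1 - nrm z) * 2)); last by move: zr; lra.
by apply: ler_wpM2l; move: z1; lra.
Qed.

Lemma wgt_le1 z : disc R z -> wgt alpha z <= 1.
Proof.
move=> zD; apply: (@le_trans _ _ (1 `^ alpha)); last by rewrite powR1.
apply: ge0_ler_powR; rewrite ?nnegrE ?(ltW alpha_gt0) ?(ltW (disc_sqr zD))//.
by rewrite gerBl sqr_ge0.
Qed.

(** The weight decreases with the modulus, so shrinking the argument does not raise the norm. The
    derivative of the dilation is bounded on the whole disc, while the weight vanishes at the
    boundary. *)
Lemma dilation f (r : R) : 0 < r -> r < 1 -> exists g,
  [/\ forall z, disc R z -> g z = f (r%:C * z), nrm g <= nrm f & little g].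
Proof.
move=> r0 r1.
have rz z : nrm (r%:C * z) = r * nrm z by rewrite nrmM nrm_real gtr0_norm.
have rD z : disc R z -> disc R (r%:C * z).
  move=> /discE z1; apply/discE; rewrite rz.
  by apply: le_lt_trans z1; rewrite ler_piMl ?nrm_ge0// ltW.
have dg z : disc R z -> cdiff (fun w => f (r%:C * w)) z (r%:C *: derive1 f (r%:C * z)).
  move=> zD; apply: (cdiff_comp (phi := fun w => r%:C * w)); last exact: bloch_cdiff (rD z zD).
  by have := cdiffMl r%:C (cdiff_id z); rewrite mulr1.
have bnd z : disc R z -> nrm (r%:C *: derive1 f (r%:C * z)) <= nrm (derive1 f (r%:C * z)).
  by move=> zD; rewrite nrmZ nrm_real gtr0_norm// ler_piMl ?nrm_ge0// ltW.
have [||g [gE g'E gn]] := @mk_bloch R alpha R[i] (fun z => f (r%:C * z))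
  (fun z => r%:C *: derive1 f (r%:C * z)) (nrm f - nrm (f 0)).
- exact: dg.
- move=> z zD; apply: (@le_trans _ _ (nrm (derive1 f (r%:C * z)) * wgt alpha (r%:C * z))).
    apply: ler_pM; rewrite ?nrm_ge0 ?wgt_ge0 ?bnd//.
    have /discE z1 := zD.
    have := @le_wgt_ball R alpha alpha_gt0 (nrm z) (r%:C * z); apply=> //.
      exact: nrm_ge0.
    by rewrite rz ler_piMl ?nrm_ge0// ltW.
  by rewrite lerBrDr; apply: le_bloch_weight; exact: rD.
exists g; split; [exact: gE | by move: gn; rewrite mulr0 addrC subrK | ].
move=> e e0; pose K := loc_bound alpha r * nrm f.
have K0 : 0 <= K by rewrite mulr_ge0 ?nrm_ge0// loc_bound_ge0.
have K1 : 0 < K + 1 by rewrite ltr_wpDl.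
have [rho rho1 H] := wgt_small (divr_gt0 e0 K1).
exists rho => // z zD zr; rewrite g'E//.
have := H z zD zr; rewrite ler_pdivlMr// => h.
apply: le_trans h; rewrite mulrC; apply: ler_wpM2l; first exact: wgt_ge0.
apply: le_trans (bnd z zD) _; apply: (@le_trans _ _ K); last by rewrite lerDl.
have /discE z1 := zD.
by apply: le_bloch_derive_ball => //; rewrite rz ler_piMr// ltW.
Qed.

Lemma dilations f : exists D : nat -> bloch alpha R[i],
  (forall j, nrm (D j) <= nrm f /\ little (D j)) /\
  forall j z, disc R z -> nrm (D j z - f z) <= loc_bound alpha (nrm z) * nrm f * j.+1%:R^-1.
Proof.
(* The shift by 2 keeps [r 0] positive. *)
pose r j : R := 1 - j.+2%:R^-1.
have r0 j : 0 < r j by rewrite subr_gt0 invf_lt1// ltr1n.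
have r1 j : r j < 1 by rewrite gtrBl invr_gt0.
have /choice[D HD] := fun j => dilation f (r0 j) (r1 j).
exists D; split=> [j|j z zD]; first by have [_ Dn Dl] := HD j.
have [DE _ _] := HD j; rewrite DE//; have /discE z1 := zD.
apply: le_trans (bloch_lipschitz alpha_gt0 f _ (lexx _) z1) _.
  by rewrite nrmM nrm_real gtr0_norm// ler_piMl ?nrm_ge0// ltW.
apply: ler_wpM2l; first by rewrite mulr_ge0 ?nrm_ge0// loc_bound_ge0.
have -> : (r j)%:C * z - z = (- j.+2%:R^-1)%:C * z.
  by rewrite /r rmorphB rmorphN /=; ring.
rewrite nrmM nrm_real normrN ger0_norm ?invr_ge0//.
apply: (@le_trans _ _ j.+2%:R^-1); first by rewrite ler_piMr ?invr_ge0// ltW.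
by rewrite lef_pV2 ?posrE// ler_nat.
Qed.

End LittleBloch.

(** Continuity along bounded pointwise null sequences; it is what makes the rows of the matrix in
    the gliding hump tend to 0. *)
Definition null_continuous (R : realType) (beta : R) (L : dual (bloch beta R[i])) :=
  forall (h : nat -> bloch beta R[i]) (M : R), (forall n, nrm (h n) <= M) ->
    (forall z, disc R z -> tends (fun n => h n z) 0) ->
    tends (fun n => L (h n) : R[i]) 0.

Section WeaklyCompact.
Variables (R : realType) (psi phi : R[i] -> R[i]) (alpha beta : R).
Hypothesis phi_disc : forall z, disc R z -> disc R (phi z).
Hypothesis alpha_gt0 : 0 < alpha.
Hypothesis beta_gt0 : 0 < beta.
Variable T : {linear bloch alpha R[i] -> bloch beta R[i]}.
Hypothesis TE : is_weighted_composition psi phi T.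
Hypothesis Tb : bounded_op T.
Implicit Types (z : R[i]).

Lemma wco_null (h : nat -> bloch alpha R[i]) :
  (forall z, disc R z -> tends (fun n => h n z) 0) ->
  forall z, disc R z -> tends (fun n => T (h n) z) 0.
Proof.
move=> h0 z zD; have := tends_lin (psi z) (h0 _ (phi_disc zD)) (tends_cst (0 : R[i])).
rewrite scaler0 addr0.
have -> : (fun n => psi z *: h n (phi z) + 0) = (fun n => T (h n) z).
  by apply/funext => n; rewrite addr0 TE.
by [].
Qed.

(** The value at 0 takes at most [delta / 4] of the norm, so some weighted derivative reaches
    [delta / 2]; replacing [f] by a dilation costs another [delta / 4]. *)
Lemma detect (f : bloch alpha R[i]) (delta : R) (n : nat) :
  0 < delta -> delta <= nrm (T f) -> nrm (T f 0) <= delta / 4 ->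
  exists (g : bloch alpha R[i]) (L : dual (bloch beta R[i])),
    [/\ nrm g <= nrm f, little g,
        forall z, disc R z -> nrm (g z - f z) <= loc_bound alpha (nrm z) * nrm f * n.+1%:R^-1,
        nrm L <= 1 /\ null_continuous L & delta / 4 <= nrm (L (T g))].
Proof.
move=> d0 Tf Tf0.
have [z zD zd] : exists2 z, disc R z & delta / 2 <= nrm (derive1 (T f) z) * wgt beta z.
  apply: contrapT => nz.
  have : nrm (T f) <= nrm (T f 0) + delta / 2.
    apply: bloch_norm_le => z zD; rewrite leNgt; apply/negP => lt; apply: nz.
    by exists z => //; exact: ltW.
  by move: Tf Tf0 d0; lra.
have [L LE L1] := bloch_derive_eval beta zD.
have Ln : null_continuous L.
  move=> h M hM h0.
  have := tends_lin (wgt beta z)%:C (null_derive beta_gt0 hM h0 zD) (tends_cst (0 : R[i])).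
  rewrite scaler0 addr0.
  have -> : (fun n => (wgt beta z)%:C *: derive1 (h n) z + 0) = (fun n => L (h n)).
    by apply/funext => k; rewrite addr0 LE.
  by [].
have LTf : delta / 2 <= nrm (L (T f)).
  by rewrite LE nrmM nrm_real ger0_norm ?wgt_ge0// [leRHS]mulrC.
have [D [Dn Df]] := dilations alpha_gt0 f.
have [M M0 TM] := bounded_op_ge0 Tb.
have D0 z' : disc R z' -> tends (fun j => (D j - f) z') 0.
  move=> z'D e e0; set K := loc_bound alpha (nrm z') * nrm f.
  have K0 : 0 <= K by rewrite mulr_ge0 ?nrm_ge0// loc_bound_ge0.
  have K1 : 0 < K + 1 by rewrite ltr_wpDl.
  have := near_invn (divr_gt0 e0 K1); apply: filterS => j; rewrite ltr_pdivlMr// => h.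
  rewrite subr0 bloch_subE; apply: le_lt_trans (Df j z' z'D) _.
  apply: le_lt_trans h; rewrite mulrC ler_wpM2l// lerDl//.
have DM j : nrm (T (D j - f)) <= M * (nrm f + nrm f).
  apply: le_trans (TM _) _; apply: ler_wpM2l => //.
  by apply: le_trans (ler_nrmB _ _) _; rewrite lerD2r; exact: (Dn j).1.
have d4 : 0 < delta / 4 by rewrite divr_gt0.
(* [L] was chosen for [f]; its null continuity lets it detect a dilation close enough to [f] as
   well. *)
have LD := Ln _ _ DM (wco_null D0) _ d4.
have [N _ HN] := LD; pose j := maxn N n.
have := HN j (leq_maxl N n); rewrite /= subr0 => Lj.
exists (D j), L; split; [exact: (Dn j).1 | exact: (Dn j).2 | | by split | ].
- move=> z' z'D; apply: le_trans (Df j z' z'D) _.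
  apply: ler_wpM2l; first by rewrite mulr_ge0 ?nrm_ge0// loc_bound_ge0.
  by rewrite lef_pV2 ?posrE// ler_nat ltnS leq_maxr.
have := ler_nrm_dist (L (T f)) (L (T (D j))).
rewrite nrm_distC -dualB -linearB; move: Lj LTf; lra.
Qed.

(** At a fixed [z], each new term either adds at most [2^-1 ^+ J] or comes on top of a sum that is
    itself at most that, so the weighted derivatives add up to at most [M + 2]. The values at 0
    contribute the other 2. *)
Lemma weighted_sum_bound (x : nat -> bloch alpha R[i]) (M : R) :
  (forall n, nrm (x n) <= M) -> (forall n, nrm (x n 0) <= 2^-1 ^+ n) ->
  (forall J z, disc R z -> nrm (derive1 (x J) z) * wgt alpha z <= 2^-1 ^+ J \/
     \sum_(j < J) nrm (derive1 (x j) z) * wgt alpha z <= 2^-1 ^+ J) ->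
  forall (e : pred nat) J, nrm (\sum_(j < J | e j) x j) <= M + 4.
Proof.
move=> xM x0 hump e J.
have half_ge0 n : 0 <= 2^-1 ^+ n :> R by rewrite exprn_ge0// invr_ge0.
have geo n : \sum_(j < n) 2^-1 ^+ j = 2 - 2 * 2^-1 ^+ n :> R.
  elim: n => [|n ih]; first by rewrite big_ord0 expr0 mulr1 subrr.
  by rewrite big_ord_recr /= ih exprS; field.
have geo2 n : \sum_(j < n) 2^-1 ^+ j <= 2 :> R by rewrite geo; have := half_ge0 n; lra.
have P n z : disc R z -> \sum_(j < n) nrm (derive1 (x j) z) * wgt alpha z <=
    M + \sum_(j < n) 2^-1 ^+ j.
  move=> zD; have M0 : 0 <= M by apply: le_trans (xM 0%N); exact: nrm_ge0.
  elim: n => [|n ih]; first by rewrite !big_ord0 addr0.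
  rewrite !big_ord_recr /= addrA; have [h|h] := hump n z zD; first exact: lerD.
  rewrite addrAC; apply: (@le_trans _ _ (2^-1 ^+ n + M)).
    by apply: lerD h _; apply: le_trans (le_bloch_derive _ zD) (xM n).
  rewrite [leLHS]addrC lerDl; apply: sumr_ge0 => i _; exact: half_ge0.
have dE z : disc R z -> derive1 (\sum_(j < J | e j) x j : bloch alpha R[i]) z =
    \sum_(j < J | e j) derive1 (x j) z.
  move=> zD; elim/big_rec2: _ => [|i y1 y2 _ <-].
    by apply: (derive1_cst (0 : R[i])).
  by have := bloch_derive_lin 1 (x i) y2 zD; rewrite !scale1r.
have S1 z : disc R z ->
    nrm (derive1 (\sum_(j < J | e j) x j : bloch alpha R[i]) z) * wgt alpha z <= M + 2.
  move=> zD; rewrite dE//.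
  apply: le_trans (ler_wpM2r (wgt_ge0 _ _) (ler_nrm_sum _ _ _)) _.
  rewrite mulr_suml; apply: (@le_trans _ _ (\sum_(j < J) nrm (derive1 (x j) z) * wgt alpha z)).
    rewrite big_mkcond /=; apply: ler_sum => i _; case: ifP => // _.
    by rewrite mulr_ge0 ?nrm_ge0 ?wgt_ge0.
  by apply: le_trans (P J z zD) _; rewrite lerD2l.
apply: le_trans (bloch_norm_le S1) _.
have : nrm ((\sum_(j < J | e j) x j : bloch alpha R[i]) 0) <= 2; last by lra.
rewrite bloch_sumE; apply: le_trans (ler_nrm_sum _ _ _) _; apply: le_trans (geo2 J).
rewrite big_mkcond /=; apply: ler_sum => i _; case: ifP => // _.
Qed.

End WeaklyCompact.

(** * Gliding hump *)

Section GlidingHump.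
Variables (R : realType) (U V : normedModType R[i]) (T : {linear U -> V}).
Variables (x : nat -> U) (K : nat -> dual V) (al : nat -> R[i]) (al0 : R[i]).
Variables (B eta : R).
Hypothesis T_bounded : bounded_op T.
Hypothesis eta_gt0 : 0 < eta.
Hypothesis sum_x : forall (e : pred nat) J, nrm (\sum_(j < J | e j) x j) <= B.
Hypothesis K_le1 : forall i, nrm (K i) <= 1.
Let b i j := K i (T (x j)).
Hypothesis b_upper : forall i j, (i < j)%N -> nrm (b i j) <= eta * 2^-1 ^+ j.
Hypothesis b_lower : forall i, \sum_(j < i) nrm (b i j - al j) <= eta.
Hypothesis b_tends : forall j, tends (fun i => b i j : R[i]) (al j).
Hypothesis al_near : forall j, nrm (al j - al0) <= eta.

Let KT_le i v M : nrm v <= M -> nrm (K i v) <= M.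
Proof.
move=> vM; apply: le_trans (le_nrm_dual _ _) _; apply: le_trans vM.
by rewrite ler_piMl ?nrm_ge0.
Qed.

(** Row [J] applied to the sum of the first [J] vectors is bounded independently of [J] and is
    within [eta] of the sum of the [al j]. These are all close to [al0], so [J * (nrm al0 - eta)]
    stays bounded. *)
Lemma hump_limit_small : nrm al0 <= eta.
Proof.
have [M M0 TM] := bounded_op_ge0 T_bounded.
have sum_al J : nrm (\sum_(j < J) al j) <= M * B + eta.
  have h : nrm (\sum_(j < J) b J j) <= M * B.
    rewrite /b -dual_sum -linear_sum; apply: KT_le; apply: le_trans (TM _) _.
    by apply: ler_wpM2l => //; exact: (sum_x predT J).
  apply: le_trans (ler_nrm_dist _ (\sum_(j < J) b J j)) _; apply: lerD => //.
  rewrite nrm_distC -sumrB; apply: le_trans (ler_nrm_sum _ _ _) _; exact: b_lower.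
have bound (J : nat) : J%:R * (nrm al0 - eta) <= M * B + eta.
  have : nrm (\sum_(j < J) al0) <= nrm (\sum_(j < J) al j) + J%:R * eta.
    apply: le_trans (ler_nrm_dist _ (\sum_(j < J) al j)) _; rewrite lerD2l nrm_distC -sumrB.
    apply: le_trans (ler_nrm_sum _ _ _) _.
    apply: (@le_trans _ _ (\sum_(i < J) eta)); first by apply: ler_sum => i _.
    by rewrite sumr_const card_ord mulr_natl.
  rewrite sumr_const card_ord -[al0 *+ J]mulr_natl.
  have -> : (J%:R : R[i]) = (J%:R : R)%:C by rewrite rmorph_nat.
  rewrite nrmM nrm_real ger0_norm//; have := sum_al J; rewrite mulrBr; lra.
rewrite leNgt; apply/negP => lt.
have d0 : 0 < nrm al0 - eta by rewrite subr_gt0.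
have := bound (Num.truncn ((M * B + eta) / (nrm al0 - eta))).+1.
by rewrite leNgt => /negP; apply; rewrite -ltr_pdivrMr// truncnS_gt.
Qed.

Let al_small j : nrm (al j) <= 2 * eta.
Proof.
have := ler_nrm_dist (al j) al0; have := al_near j; have := hump_limit_small; lra.
Qed.

Let c i j := b i j - b i.+1 j.

Let geo m n : \sum_(m <= j < n) 2^-1 ^+ j <= 2 :> R.
Proof.
have half_ge0 k : 0 <= 2^-1 ^+ k :> R by rewrite exprn_ge0// invr_ge0.
have E k : \sum_(0 <= j < k) 2^-1 ^+ j = 2 - 2 * 2^-1 ^+ k :> R.
  elim: k => [|k ih]; first by rewrite big_geq// expr0 mulr1 subrr.
  by rewrite big_nat_recr //= ih exprS; field.
have [nm|mn] := leqP n m; first by rewrite big_geq.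
have : \sum_(0 <= j < n) 2^-1 ^+ j <= 2 :> R by rewrite E; have := half_ge0 n; lra.
rewrite (@big_cat_nat _ _ _ m) //=; last exact: ltnW.
have : 0 <= \sum_(0 <= j < m) 2^-1 ^+ j :> R by apply: sumr_ge0 => j _.
lra.
Qed.

(** Left of [i] both rows are close to [al] and cancel up to [2 * eta]; right of [i] both are small,
    in total [4 * eta]; the entry [b i.+1 i] is at most [3 * eta]. What remains is [b i i]. *)
Lemma hump_oscillation (delta : R) i N : ~~ odd i -> (i < N)%N -> delta <= nrm (b i i) ->
  delta - 9 * eta <= nrm (\sum_(j < N | ~~ odd j) c i j).
Proof.
move=> ei iN di.
have lower m k : (k <= m)%N -> \sum_(0 <= j < k) nrm (b m j - al j) <= eta.
  move=> km; apply: le_trans (b_lower m).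
  rewrite -(big_mkord predT (fun j => nrm (b m j - al j))) (@big_cat_nat _ _ _ k 0 m) //=.
  by rewrite lerDl; apply: sumr_ge0 => j _; exact: nrm_ge0.
rewrite -(big_mkord (fun j => ~~ odd j) (c i)) (@big_cat_nat _ _ _ i) //=; last exact: ltnW.
rewrite (@big_ltn_cond _ _ _ i)// ei.
set S1 := \sum_(0 <= j < i | _) _; set S2 := \sum_(i.+1 <= j < N | _) _.
have h1 : nrm S1 <= 2 * eta.
  apply: le_trans (ler_nrm_sum _ _ _) _.
  apply: (@le_trans _ _ (\sum_(0 <= j < i) (nrm (b i j - al j) + nrm (b i.+1 j - al j)))).
    rewrite big_mkcond /=; apply: ler_sum => j _; case: ifP => _; last first.
      by rewrite addr_ge0 ?nrm_ge0.
    have -> : c i j = (b i j - al j) - (b i.+1 j - al j) by rewrite /c opprB addrA subrK.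
    exact: ler_nrmB.
  rewrite big_split /=; have := lower i i (leqnn i); have := lower i.+1 i (leqnSn i); lra.
have h2 : nrm S2 <= 4 * eta.
  apply: le_trans (ler_nrm_sum _ _ _) _.
  apply: (@le_trans _ _ (\sum_(i.+1 <= j < N) (2 * eta) * 2^-1 ^+ j)); last first.
    by rewrite -mulr_sumr; have := geo i.+1 N; move: eta_gt0; nra.
  rewrite big_mkcond /=; apply: ler_sum_nat => j /andP[ij _]; case: ifP => [oj|_]; last first.
    by rewrite !mulr_ge0 ?exprn_ge0 ?invr_ge0 ?(ltW eta_gt0).
  (* [j] is even and [i.+1] odd, so the large diagonal entry of row [i.+1] never enters the sum. *)
  have ij' : (i.+1 < j)%N.
    by rewrite ltn_neqAle ij andbT; apply: contraTneq oj => <-; rewrite /= ei.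
  by apply: le_trans (ler_nrmB _ _) _; have := b_upper ij; have := b_upper ij'; lra.
have h3 : nrm (b i.+1 i) <= 3 * eta.
  have := lower i.+1 i.+1 (leqnn _); rewrite big_nat_recr //=.
  have : 0 <= \sum_(0 <= j < i) nrm (b i.+1 j - al j) by apply: sumr_ge0 => j _; exact: nrm_ge0.
  have := ler_nrm_dist (b i.+1 i) (al i); have := al_small i; lra.
have := ler_nrmD (S1 + (c i i + S2)) (- S1 - S2 + b i.+1 i).
have -> : S1 + (c i i + S2) + (- S1 - S2 + b i.+1 i) = b i i by rewrite /c; ring.
have := ler_nrmD (- S1 - S2) (b i.+1 i); have := ler_nrmB (- S1) S2; rewrite nrmN; lra.
Qed.

(** The constant is 9 from [hump_oscillation] plus 3 from the approximation [w] of the weak limit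
    [y]: one [eta] for the difference of the two functionals at [w], one for each of them at
    [y - w]. *)
Lemma weakly_compact_no_hump (delta : R) : weakly_compact_op T ->
  (forall i, delta <= nrm (b i i)) -> delta <= 12 * eta.
Proof.
move=> wT bd; pose h N := \sum_(j < N | ~~ odd j) x j.
have [|t [tI [y Ty]]] := wT h; first by exists B => N; exact: (sum_x (fun j => ~~ odd j)).
have dualW L := (weakly_cvg_tends _ _).1 Ty L.
pose Y : set V := [set v | tends (fun k => K (2 * k)%N v - K (2 * k).+1 v : R[i]) 0].
have YL a u w : Y u -> Y w -> Y (a *: u + w).
  move=> Yu Yw; have := tends_lin a Yu Yw; rewrite scaler0 addr0 /Y /=.
  by under eq_fun do rewrite scalerBr addrACA -opprD -!dual_linear.
have Y0 : Y 0.
  rewrite /Y /=; under eq_fun do rewrite !dual0 subrr; exact: tends_cst.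
have Yx j : Y (T (x j)).
  have e1 : increasing (fun k => (2 * k)%N) by move=> m n mn; rewrite ltn_pmul2l.
  have e2 : increasing (fun k => (2 * k).+1%N) by move=> m n mn; rewrite ltnS ltn_pmul2l.
  have := tends_lin (-1) (tends_subseq e2 (@b_tends j)) (tends_subseq e1 (@b_tends j)).
  rewrite scaleN1r addNr /Y /=.
  by under eq_fun do rewrite scaleN1r addrC.
have Yh N : Y (T (h N)).
  rewrite /h linear_sum; elim/big_ind: _ => // u w Yu Yw.
  by have := YL 1 u w Yu Yw; rewrite scale1r.
have [w Yw yw] := mazur Y0 YL (fun n => Yh (t n)) Ty eta_gt0.
have [k _ /(_ k (leqnn k)) /=] := Yw _ eta_gt0; rewrite subr0 => wk.
have far : delta - 9 * eta <= nrm (K (2 * k)%N y - K (2 * k).+1 y).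
  have := tends_lin (-1) (dualW (K (2 * k).+1)) (dualW (K (2 * k)%N)).
  rewrite leNgt => tl; apply/negP => lt.
  have := tl (delta - 9 * eta - nrm (K (2 * k)%N y - K (2 * k).+1 y)).
  rewrite subr_gt0 => /(_ lt) [N _ HN].
  have := HN (maxn N (2 * k).+1) (leq_maxl _ _); rewrite /= !scaleN1r.
  set n := maxn _ _.
  have nk : (2 * k < t n)%N by apply: leq_trans (leq_maxr N _) _; exact: increasing_ge.
  have := @hump_oscillation delta (2 * k) (t n).
  rewrite oddM /= => /(_ isT nk (bd _)).
  have -> : \sum_(j < t n | ~~ odd j) c (2 * k) j =
      - K (2 * k).+1 (T (h (t n))) + K (2 * k)%N (T (h (t n))).
    have KTh i N' : K i (T (h N')) = \sum_(j < N' | ~~ odd j) b i j.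
      by rewrite /b -dual_sum -linear_sum.
    by rewrite !KTh addrC -sumrB.
  set p := - _ + _; rewrite (addrC (- K (2 * k).+1 y)).
  have := ler_nrm_dist p (K (2 * k)%N y - K (2 * k).+1 y); lra.
have d1 : nrm (K (2 * k)%N (y - w)) <= eta by apply: KT_le; exact: ltW.
have d2 : nrm (K (2 * k).+1 (y - w)) <= eta by apply: KT_le; exact: ltW.
have E : K (2 * k)%N y - K (2 * k).+1 y =
    (K (2 * k)%N w - K (2 * k).+1 w) + (K (2 * k)%N (y - w) - K (2 * k).+1 (y - w)).
  by rewrite !dualB; ring.
have := ler_nrmD (K (2 * k)%N w - K (2 * k).+1 w) (K (2 * k)%N (y - w) - K (2 * k).+1 (y - w)).
rewrite -E; have := ler_nrmB (K (2 * k)%N (y - w)) (K (2 * k).+1 (y - w)); lra.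
Qed.

End GlidingHump.

(** * Weak compactness implies compactness *)

Lemma near_all (l : seq nat) (P : nat -> nat -> Prop) :
  (forall m, \forall n \near \oo, P m n) ->
  \forall n \near \oo, forall m, m \in l -> P m n.
Proof.
move=> Pn; elim: l => [|m l ih]; first by apply: nearW.
apply: filterS2 (Pn m) ih => n Pm Pl k; rewrite inE => /orP[/eqP ->//|]; exact: Pl.
Qed.

Section Selection.
Variable R : realType.

Lemma near_sum (l : seq nat) (F : nat -> nat -> R) (e : R) :
  (forall m e, 0 < e -> \forall n \near \oo, F m n <= e) -> 0 < e ->
  \forall n \near \oo, \sum_(m <- l) F m n <= e.
Proof.
move=> Fn; elim: l e => [|m l ih] e e0.
  by apply: nearW => n; rewrite big_nil ltW.
have e2 : 0 < e / 2 by rewrite divr_gt0.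
apply: filterS2 (Fn m _ e2) (ih _ e2) => n Fm Fl.
by rewrite big_cons [e]splitr lerD.
Qed.

Lemma double_subsequence (a : nat -> nat -> R[i]) (M : R) :
  (forall k j, nrm (a k j) <= M) ->
  exists2 s, increasing s & exists (al : nat -> R[i]) (al0 : R[i]),
    (forall j, tends (fun k => a (s k) (s j)) (al j)) /\ tends al al0.
Proof.
move=> aM.
have [||t tI Ht] := @diagonal_subsequence
    (fun j s => exists l, tends (fun k => a (s k) j) l).
- move=> j s sI; have [t tI [l tl]] := bounded_subseq_cvg (fun n => aM (s n) j).
  by exists t => //; exists l.
- move=> j s t r N rI tE [l sl]; exists l.
  by apply: (tends_tail (N := N) rI _ sl) => n; rewrite tE.
have [al Hal] := choice Ht.
have alM j : nrm (al j) <= M by apply: tends_le (Hal j) _; apply: nearW => n.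
have [r rI [al0 ral]] := bounded_subseq_cvg (fun n => alM (t n)).
exists (t \o r); first exact: increasing_comp.
exists (fun j => al (t (r j))), al0; split=> [j|//].
exact: tends_subseq rI (Hal (t (r j))).
Qed.

Variables (alpha : R) (g : nat -> bloch alpha R[i]) (M : R).
Hypothesis alpha_gt0 : 0 < alpha.
Hypothesis g_bounded : forall n, nrm (g n) <= M.
Hypothesis g_little : forall n, little (g n).
Hypothesis g_null : forall z, disc R z -> tends (fun n => g n z) 0.

Lemma little_sum (l : seq nat) (e : R) : 0 < e -> exists2 rho : R, rho < 1 &
  forall z, disc R z -> rho < nrm z ->
    \sum_(m <- l) nrm (derive1 (g m) z) * wgt alpha z <= e.
Proof.
elim: l e => [|m l ih] e e0.
  by exists 0 => // z _ _; rewrite big_nil ltW.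
have e2 : 0 < e / 2 by rewrite divr_gt0.
have [r1 r11 H1] := g_little m e2; have [r2 r21 H2] := ih _ e2.
exists (Num.max r1 r2); first by rewrite gt_max r11.
move=> z zD; rewrite gt_max => /andP[z1 z2].
by rewrite big_cons [e]splitr lerD// ?H1// H2.
Qed.

(** Each requirement on a new index holds eventually once the earlier ones are fixed. For the
    alternative at [z]: the finitely many earlier functions are small beyond some radius [rho], and
    on the disc of radius [rho] the derivatives of late functions are uniformly small. *)
Lemma hump_subsequence (a : nat -> nat -> R[i]) (al : nat -> R[i]) (al0 : R[i]) (eta : R) :
  (forall k, tends (a k) 0) -> (forall j, tends (fun k => a k j) (al j)) ->
  tends al al0 -> 0 < eta ->
  exists2 s, increasing s &
  [/\ forall J, nrm (g (s J) 0) <= 2^-1 ^+ J,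
      forall J z, disc R z -> nrm (derive1 (g (s J)) z) * wgt alpha z <= 2^-1 ^+ J \/
        \sum_(j < J) nrm (derive1 (g (s j)) z) * wgt alpha z <= 2^-1 ^+ J,
      forall i j, (i < j)%N -> nrm (a (s i) (s j)) <= eta * 2^-1 ^+ j,
      forall i, \sum_(j < i) nrm (a (s i) (s j) - al (s j)) <= eta &
      forall j, nrm (al (s j) - al0) <= eta].
Proof.
move=> a_row a_col al_cvg eta0.
have half_gt0 n : 0 < 2^-1 ^+ n :> R by rewrite exprn_gt0// invr_gt0.
pose C (l : seq nat) (n : nat) :=
  [/\ nrm (g n 0) <= 2^-1 ^+ size l,
      forall z, disc R z -> nrm (derive1 (g n) z) * wgt alpha z <= 2^-1 ^+ size l \/
        \sum_(m <- l) nrm (derive1 (g m) z) * wgt alpha z <= 2^-1 ^+ size l,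
      forall m, m \in l -> nrm (a m n) <= eta * 2^-1 ^+ size l,
      \sum_(m <- l) nrm (a n m - al m) <= eta &
      nrm (al n - al0) <= eta].
have [l|s sI Hs] := @selection C.
  have D0 : disc R (0 : R[i]) by apply/discE; rewrite nrm0.
  have N1 : \forall n \near \oo, nrm (g n 0) <= 2^-1 ^+ size l.
    by apply: filterS (g_null D0 (half_gt0 (size l))) => n; rewrite subr0 => /ltW.
  have N2 : \forall n \near \oo, forall z, disc R z ->
      nrm (derive1 (g n) z) * wgt alpha z <= 2^-1 ^+ size l \/
      \sum_(m <- l) nrm (derive1 (g m) z) * wgt alpha z <= 2^-1 ^+ size l.
    have [rho rho1 Hrho] := little_sum l (half_gt0 (size l)).
    have := null_derive_unif alpha_gt0 rho1 g_bounded g_null (half_gt0 (size l)).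
    apply: filterS => n Hn z zD; have [zr|zr] := leP (nrm z) rho; last by right; exact: Hrho.
    left; apply: le_trans (Hn z zr); rewrite ler_piMr ?nrm_ge0//; exact: wgt_le1.
  have N3 : \forall n \near \oo, forall m, m \in l -> nrm (a m n) <= eta * 2^-1 ^+ size l.
    apply: near_all => m; apply: filterS (a_row m _ (mulr_gt0 eta0 (half_gt0 (size l)))) => n.
    by rewrite subr0 => /ltW.
  have N4 : \forall n \near \oo, \sum_(m <- l) nrm (a n m - al m) <= eta.
    apply: (@near_sum l (fun m n => nrm (a n m - al m))) eta0 => m e e0.
    by apply: filterS (a_col m e e0) => n /ltW.
  have N5 : \forall n \near \oo, nrm (al n - al0) <= eta.
    by apply: filterS (al_cvg eta eta0) => n /ltW.
  by apply: filterS3 (filterI N1 N2) (filterI N3 N4) N5 => n [h1 h2] [h3 h4] h5.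
have sumE (F : nat -> R) J : \sum_(m <- mkseq s J) F m = \sum_(j < J) F (s j).
  by rewrite big_map -(big_mkord predT (fun j => F (s j))) /index_iota subn0.
exists s => //; split.
- by move=> J; have [] := Hs J; rewrite size_mkseq.
- by move=> J z zD; have [_ + _ _ _] := Hs J; rewrite size_mkseq => /(_ z zD); rewrite sumE.
- move=> i j ij; have [_ _ + _ _] := Hs j; rewrite size_mkseq; apply.
  by apply/mapP; exists i => //; rewrite mem_iota.
- by move=> i; have [_ _ _ + _] := Hs i; rewrite sumE.
- by move=> j; have [_ _ _ _] := Hs j.
Qed.

End Selection.

Section WeaklyCompactScalar.
Variables (R : realType) (psi phi : R[i] -> R[i]) (alpha beta : R).
Hypothesis phi_disc : forall z, disc R z -> disc R (phi z).
Hypothesis alpha_gt0 : 0 < alpha.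
Hypothesis beta_gt0 : 0 < beta.
Variable T : {linear bloch alpha R[i] -> bloch beta R[i]}.
Hypothesis TE : is_weighted_composition psi phi T.
Hypothesis Tb : bounded_op T.
Hypothesis Tw : weakly_compact_op T.
Implicit Types (z : R[i]).

Lemma wco_vanishing (f : nat -> bloch alpha R[i]) (M delta : R) :
  (forall n, nrm (f n) <= M) -> (forall z, disc R z -> tends (fun n => f n z) 0) ->
  (forall n, delta <= nrm (T (f n))) -> delta <= 0.
Proof.
move=> fM f0 Tf; rewrite leNgt; apply/negP => d0.
have [MT MT0 TM] := bounded_op_ge0 Tb.
have D0 : disc R (0 : R[i]) by apply/discE; rewrite nrm0.
have d4 : 0 < delta / 4 by rewrite divr_gt0.
(* Dropping [N] terms makes the values at 0 small, as [detect] requires. *)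
have [N _ HN] := wco_null phi_disc TE f0 D0 d4.
have small n : nrm (T (f (N + n)%N) 0) <= delta / 4.
  by have := HN (N + n)%N (leq_addr _ _); rewrite /= subr0 => /ltW.
have shiftI : increasing (fun n => (N + n)%N) by move=> m n; rewrite ltn_add2l.
have /choice[gL HgL] : forall n, exists p : bloch alpha R[i] * dual (bloch beta R[i]),
    [/\ nrm p.1 <= M, little p.1,
      forall z, disc R z -> nrm (p.1 z - f (N + n)%N z) <=
        loc_bound alpha (nrm z) * M * n.+1%:R^-1,
      nrm p.2 <= 1 /\ null_continuous p.2 & delta / 4 <= nrm (p.2 (T p.1))].
  move=> n; have [g [L [gM gl gf Ln Lg]]] :=
    detect phi_disc alpha_gt0 beta_gt0 TE Tb n d0 (Tf (N + n)%N) (small n).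
  exists (g, L); split; [exact: le_trans gM (fM _) | exact: gl | | exact: Ln | exact: Lg].
  move=> z zD; apply: le_trans (gf z zD) _; rewrite ler_wpM2r ?invr_ge0//.
  by rewrite ler_wpM2l ?loc_bound_ge0.
pose g n := (gL n).1; pose L n := (gL n).2.
have gM n : nrm (g n) <= M by have [] := HgL n.
have gl n : little (g n) by have [] := HgL n.
have L1 n : nrm (L n) <= 1 by have [_ _ _ []] := HgL n.
have L0 n : null_continuous (L n) by have [_ _ _ []] := HgL n.
have Lg n : delta / 4 <= nrm (L n (T (g n))) by have [] := HgL n.
have g0 z : disc R z -> tends (fun n => g n z) 0.
  move=> zD e e0; set K := loc_bound alpha (nrm z) * M.
  have M0 : 0 <= M by apply: le_trans (fM 0%N); exact: nrm_ge0.
  have K0 : 0 <= K by rewrite mulr_ge0 ?loc_bound_ge0.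
  have K1 : 0 < K + 1 by rewrite ltr_wpDl.
  have e2 : 0 < e / 2 by rewrite divr_gt0.
  apply: filterS2 (near_invn (divr_gt0 e2 K1)) (tends_subseq shiftI (f0 z zD) e2) => n.
  rewrite ltr_pdivlMr//= !subr0 => h1 h2.
  have [_ _ /(_ z zD) h3 _ _] := HgL n.
  have h4 : K * n.+1%:R^-1 < e / 2.
    by apply: le_lt_trans h1; rewrite mulrC ler_wpM2l ?invr_ge0// lerDl.
  have h5 := le_lt_trans h3 h4.
  apply: le_lt_trans (ler_nrm_dist _ (f (N + n)%N z)) _.
  by rewrite [e]splitr; exact: ltrD.
have aM k j : nrm (L k (T (g j))) <= MT * M.
  apply: le_trans (le_nrm_dual _ _) _; apply: (@le_trans _ _ (nrm (T (g j)))).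
    by rewrite ler_piMl ?nrm_ge0.
  by apply: le_trans (TM _) _; rewrite ler_wpM2l.
have [t tI [al [al0 [a_col al_cvg]]]] := double_subsequence aM.
(* Null continuity of the functionals enters here: the [T (g (t j))] are bounded and known to tend
   to 0 pointwise. *)
have a_row k : tends (fun j => L (t k) (T (g (t j))) : R[i]) 0.
  apply: (L0 (t k) _ (MT * M)).
    by move=> n; apply: le_trans (TM _) _; rewrite ler_wpM2l.
  by apply: (wco_null phi_disc TE) => z zD; exact: tends_subseq tI (g0 z zD).
(* The humps have height [delta / 4], that is 16 times this [eta], above the 12 allowed by
   [weakly_compact_no_hump]. *)
have eta0 : 0 < delta / 64 by rewrite divr_gt0.
have [s sI [x0 hump upper lower near_al]] := hump_subsequence alpha_gt0
  (fun n => gM (t n)) (fun n => gl (t n)) (fun z zD => tends_subseq tI (g0 z zD))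
  a_row a_col al_cvg eta0.
have sum_x := weighted_sum_bound (x := fun j => g (t (s j))) (fun n => gM _) x0 hump.
have := @weakly_compact_no_hump R _ _ T (fun j => g (t (s j))) (fun i => L (t (s i)))
  (fun j => al (s j)) al0 (M + 4) (delta / 64) Tb eta0 sum_x (fun i => L1 _) upper lower
  (fun j => tends_subseq sI (a_col (s j))) near_al (delta / 4) Tw (fun i => Lg _).
lra.
Qed.

(** After subtracting a pointwise limit of a subsequence, failure of norm convergence of the images
    would leave a bounded pointwise null sequence whose images stay away from 0, which
    [wco_vanishing] excludes. *)
Lemma weakly_compact_compact : compact_op T.
Proof.
move=> u [M uM].
have [s sI [g ug]] := weak_montel alpha_gt0 (@complex_complete R) (@complex_reflexive R) uM.
have [||I IE] := @mk_dual R R[i] (fun x => x) 1; first by [].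
  by move=> x; rewrite mul1r.
have uz z : disc R z -> tends (fun n => u (s n) z) (g z).
  move=> zD; have := (weakly_cvg_tends _ _).1 (ug z zD) I; rewrite IE.
  by under eq_fun do rewrite IE.
exists s; split=> //; exists (T g); apply/cvg_nrmP => e e0; apply: contrapT => nn.
have [r rI Hr] := not_near_subseq nn.
suff : e <= 0 by rewrite leNgt e0.
have [f fdef] : exists f : nat -> bloch alpha R[i], forall n, f n = u (s (r n)) - g.
  by exists (fun n => u (s (r n)) - g).
have fE n z : f n z = u (s (r n)) z - g z by rewrite fdef; exact: bloch_subE.
apply: (@wco_vanishing f (M + nrm g)).
- by move=> n; rewrite fdef; apply: le_trans (ler_nrmB _ _) _; rewrite lerD2r.
- move=> z zD d d0; apply: filterS (tends_subseq rI (uz z zD) d0) => n /=.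
  by rewrite fE subr0.
- by move=> n; rewrite fdef linearB leNgt; apply/negP; exact: Hr.
Qed.

End WeaklyCompactScalar.

Theorem theorem6 (R : realType) (psi phi : R[i] -> R[i]) (alpha beta : R)
    (X : completeNormedModType R[i])
    (psi_analytic : analytic_on_disc psi)
    (psi_neq0 : exists z, disc R z /\ psi z != 0)
    (phi_analytic : analytic_on_disc phi)
    (phi_disc : forall z, disc R z -> disc R (phi z))
    (alpha_gt0 : 0 < alpha) (beta_gt0 : 0 < beta)
    (X_neq0 : exists x : X, x != 0) :
  [/\ wco_weakly_compact psi phi alpha beta R[i] <->
        wco_compact psi phi alpha beta R[i],
      wco_bounded psi phi alpha beta X <->
        wco_bounded psi phi alpha beta R[i] &
      wco_weakly_compact psi phi alpha beta X <->
        (wco_compact psi phi alpha beta R[i] /\ reflexive_space X)].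
Proof.
have wc_c : wco_weakly_compact psi phi alpha beta R[i] <->
    wco_compact psi phi alpha beta R[i].
  split=> -[T [TE Tb Tc]]; exists T; split=> //; last exact: compact_weakly_compact.
  exact: weakly_compact_compact phi_disc alpha_gt0 beta_gt0 T TE Tb Tc.
split=> //; first exact: wco_bounded_iff.
split=> [wX|[c Xr]]; last exact: compact_weakly_compact_vector.
split; last exact: weakly_compact_reflexive wX.
have [x x0] := X_neq0; apply/wc_c; exact: weakly_compact_scalar x0 wX.
Qed.
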